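(* Let $\mathcal{K}$ be a tame knot class in $\mathbb{R}^3$. For $n\ge 3$ define $\mathcal{F}_n:\mathcal{C}(\mathcal{K})\to[0,\infty]$ by $\mathcal{F}_n(\gamma)=\Delta_n[\gamma]^{-1}$ if $\gamma\in\mathcal{P}_n(\mathcal{K})$ and $\mathcal{F}_n(\gamma)=+\infty$ otherwise, and define $\mathcal{F}:\mathcal{C}(\mathcal{K})\to[0,\infty]$ by $\mathcal{F}(\gamma)=\Delta[\gamma]^{-1}$. Then $\mathcal{F}_n$ $\Gamma$-converges to $\mathcal{F}$ on the space $\mathcal{C}(\mathcal{K})$ equipped with the topology induced by the norm $\|\cdot\|_{W^{1,\infty}(\mathbb{S}_1,\mathbb{R}^3)}$. That is: (i) for every sequence $\gamma_n\to\gamma$ in $\mathcal{C}(\mathcal{K})$ (w.r.t. $\|\cdot\|_{W^{1,\infty}}$) one has $\mathcal{F}(\gamma)\le\liminf_{n\to\infty}\mathcal{F}_n(\gamma_n)$; (ii) for every $\gamma\in\mathcal{C}(\mathcal{K})$ there exist $\gamma_n\in\mathcal{C}(\mathcal{K})$ with $\gamma_n\to\gamma$ in $W^{1,\infty}$ and $\limsup_{n\to\infty}\mathcal{F}_n(\gamma_n)\le\mathcal{F}(\gamma)$.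
   Context: $\mathbb{S}_1=\mathbb{R}/\mathbb{Z}$ is the circle of length $1$. $\mathcal{C}$ denotes the set of curves $\gamma\in W^{1,\infty}(\mathbb{S}_1,\mathbb{R}^d)$ with $|\gamma'|=1$ a.e. (arc length parametrised, length $1$); here $d=3$. For pairwise distinct $x,y,z\in\mathbb{R}^d$, $r(x,y,z)$ is the radius of the unique circle through $x,y,z$ ($=\infty$ if collinear). The thickness is $\Delta[\gamma]=\inf\{r(x,y,z): x,y,z\in\gamma(\mathbb{S}_1)\text{ pairwise distinct}\}$, and $\Delta[\gamma]^{-1}=1/\Delta[\gamma]\in[0,\infty]$ (with $1/0=\infty$). $\mathcal{P}_n\subset\mathcal{C}$ is the set of arc length parametrisations of closed equilateral polygons with $n$ edges (each of length $1/n$); if $x_1,\dots,x_n$ are the consecutive vertices, set $x_0=x_n$, $x_{n+1}=x_1$. For consecutive vertices $x,y,z$ let $\phi=\measuredangle(y-x,z-y)\in[0,\pi]$ be the exterior angle at $y$ and $\kappa_d(x,y,z)=\frac{2\tan(\phi/2)}{(|x-y|+|z-y|)/2}$. Set $\mathrm{maxCurv}(p)=\max_{i}\kappa_d(x_{i-1},x_i,x_{i+1})$ and $\mathrm{minRad}(p)=1/\mathrm{maxCurv}(p)$. The set $\mathrm{dcrit}(p)$ of doubly critical pairs consists of pairs $(x,y)$ of distinct points $x=p(t)$, $y=p(s)$ such that $s$ is a local extremum of $u\mapsto|p(t)-p(u)|^2$ and $t$ is a local extremum of $v\mapsto|p(v)-p(s)|^2$; $\mathrm{dcsd}(p)=\min_{(x,y)\in\mathrm{dcrit}(p)}|x-y|$.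 The discrete thickness is $\Delta_n[p]=\min\{\mathrm{minRad}(p),\tfrac12\mathrm{dcsd}(p)\}$ if all vertices of $p$ are pairwise distinct, and $\Delta_n[p]=0$ otherwise; $\Delta_n[p]^{-1}=1/\Delta_n[p]$. A tame knot class $\mathcal{K}$ is an ambient isotopy class of tame knots in $\mathbb{R}^3$ (knots ambient isotopic to polygonal knots). $\mathcal{C}(\mathcal{K})$ (resp. $\mathcal{P}_n(\mathcal{K})$) is the set of injective $\gamma\in\mathcal{C}$ (resp. $\mathcal{P}_n$) whose image is a knot in $\mathcal{K}$. *)

(* Defs.v *)
From Stdlib Require Import Reals Lra ZArith ClassicalEpsilon.
Open Scope R_scope.

Definition V3 : Type := (R * R * R)%type.
Definition c1 (v : V3) : R := fst (fst v).
Definition c2 (v : V3) : R := snd (fst v).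
Definition c3 (v : V3) : R := snd v.
Definition vadd (u v : V3) : V3 := (c1 u + c1 v, c2 u + c2 v, c3 u + c3 v).
Definition vsub (u v : V3) : V3 := (c1 u - c1 v, c2 u - c2 v, c3 u - c3 v).
Definition vscal (a : R) (v : V3) : V3 := (a * c1 v, a * c2 v, a * c3 v).
Definition dot (u v : V3) : R := c1 u * c1 v + c2 u * c2 v + c3 u * c3 v.
Definition vnorm (v : V3) : R := sqrt (dot v v).
Definition dist3 (u v : V3) : R := vnorm (vsub u v).

Inductive ereal : Type := Fin : R -> ereal | PInf : ereal.

Definition ele (a b : ereal) : Prop :=
  match a, b with
  | _, PInf => True
  | Fin x, Fin y => x <= y
  | PInf, Fin _ => False
  end.
Definition elt (a b : ereal) : Prop :=
  match a, b with
  | Fin _, PInf => True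
  | Fin x, Fin y => x < y
  | PInf, _ => False
  end.

Definition einv (a : ereal) : ereal :=
  match a with
  | PInf => Fin 0
  | Fin x => if Req_EM_T x 0 then PInf else Fin (/ x)
  end.
Definition emin (a b : ereal) : ereal :=
  match a, b with
  | PInf, _ => b
  | _, PInf => a
  | Fin x, Fin y => Fin (Rmin x y)
  end.
Definition emax (a b : ereal) : ereal :=
  match a, b with
  | PInf, _ => PInf
  | _, PInf => PInf
  | Fin x, Fin y => Fin (Rmax x y)
  end.
Definition ehalf (a : ereal) : ereal :=
  match a with PInf => PInf | Fin x => Fin (x / 2) end.

Definition is_eglb (S : ereal -> Prop) (m : ereal) : Prop :=
  (forall x, S x -> ele m x) /\
  (forall m', (forall x, S x -> ele m' x) -> ele m' m).
Definition einf (S : ereal -> Prop) : ereal :=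
  epsilon (inhabits PInf) (is_eglb S).

(* max over i = 0..n-1 of f i (values are >= 0; empty max := 0) *)
Fixpoint emax_upto (f : nat -> ereal) (n : nat) : ereal :=
  match n with
  | O => Fin 0
  | S k => emax (emax_upto f k) (f k)
  end.

Definition is_glb (S : R -> Prop) (m : R) : Prop :=
  (forall x, S x -> m <= x) /\ (forall m', (forall x, S x -> m' <= x) -> m' <= m).
Definition Rinf (S : R -> Prop) : R := epsilon (inhabits 0) (is_glb S).

Definition le_liminf (L : ereal) (a : nat -> ereal) : Prop :=
  forall c : R, elt (Fin c) L -> exists N : nat, forall n, (N <= n)%nat -> elt (Fin c) (a n).
Definition limsup_le (a : nat -> ereal) (L : ereal) : Prop :=
  forall c : R, elt L (Fin c) -> exists N : nat, forall n, (N <= n)%nat -> elt (a n) (Fin c).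

(* ---------- Curves S_1 -> R^3 (as 1-periodic maps R -> R^3) ---------- *)
Definition curve : Type := R -> V3.

Definition periodic1 (g : curve) : Prop := forall t, g (t + 1) = g t.

Definition has_deriv (g : curve) (t : R) (v : V3) : Prop :=
  derivable_pt_lim (fun s => c1 (g s)) t (c1 v) /\
  derivable_pt_lim (fun s => c2 (g s)) t (c2 v) /\
  derivable_pt_lim (fun s => c3 (g s)) t (c3 v).

Definition null_set (N : R -> Prop) : Prop :=
  forall eps, 0 < eps -> exists a b : nat -> R,
    (forall k, a k <= b k) /\
    (forall t, N t -> exists k, a k < t < b k) /\
    (forall m, sum_f_R0 (fun k => b k - a k) m <= eps).

Definition ae_S1 (P : R -> Prop) : Prop :=
  null_set (fun t => 0 <= t < 1 /\ ~ P t).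

(* W^{1,oo}(S_1,R^3): 1-periodic Lipschitz maps (Sobolev W^{1,oo} = Lipschitz) *)
Definition W1inf (g : curve) : Prop :=
  periodic1 g /\ exists L, forall s t, dist3 (g s) (g t) <= L * Rabs (s - t).

Definition Linf_norm (g : curve) : R :=
  Rinf (fun M => 0 <= M /\ ae_S1 (fun t => vnorm (g t) <= M)).
Definition Linf_norm_deriv (g : curve) : R :=
  Rinf (fun M => 0 <= M /\ ae_S1 (fun t => exists v, has_deriv g t v /\ vnorm v <= M)).
Definition W1inf_norm (g : curve) : R := Linf_norm g + Linf_norm_deriv g.

Definition csub (g h : curve) : curve := fun t => vsub (g t) (h t).

Definition W1inf_conv (gs : nat -> curve) (g : curve) : Prop :=
  forall eps, 0 < eps -> exists N : nat, forall n, (N <= n)%nat ->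
    W1inf_norm (csub (gs n) g) < eps.

Definition in_C (g : curve) : Prop :=
  W1inf g /\ ae_S1 (fun t => exists v, has_deriv g t v /\ vnorm v = 1).

Definition injective_S1 (g : curve) : Prop :=
  forall s t, g s = g t -> exists k : Z, s - t = IZR k.

Definition image (g : curve) : V3 -> Prop := fun x => exists t, x = g t.

Definition cont_map (f : V3 -> V3) : Prop :=
  forall x eps, 0 < eps -> exists del, 0 < del /\
    forall y, dist3 y x < del -> dist3 (f y) (f x) < eps.
Definition homeo (f : V3 -> V3) : Prop :=
  cont_map f /\ exists g, cont_map g /\ (forall x, g (f x) = x) /\ (forall y, f (g y) = y).

Definition cont_curve (g : curve) : Prop :=
  forall t eps, 0 < eps -> exists del, 0 < del /\
    forall s, Rabs (s - t) < del -> dist3 (g s) (g t) < eps.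

Definition is_knot (K : V3 -> Prop) : Prop :=
  exists g : curve, cont_curve g /\ periodic1 g /\ injective_S1 g /\
    forall x, K x <-> image g x.

Definition ambient_isotopic (K1 K2 : V3 -> Prop) : Prop :=
  exists H : R -> V3 -> V3,
    (forall t x eps, 0 <= t <= 1 -> 0 < eps -> exists del, 0 < del /\
        forall s y, 0 <= s <= 1 -> Rabs (s - t) < del -> dist3 y x < del ->
          dist3 (H s y) (H t x) < eps) /\
    (forall t, 0 <= t <= 1 -> homeo (H t)) /\
    (forall x, H 0 x = x) /\
    (forall y, K2 y <-> exists x, K1 x /\ y = H 1 x).

Definition polygonal_knot (K : V3 -> Prop) : Prop :=
  is_knot K /\ exists (m : Z) (p : Z -> V3), (3 <= m)%Z /\ (forall k, p (k + m)%Z = p k) /\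
    forall x, K x <-> exists k u, (0 <= k < m)%Z /\ 0 <= u <= 1 /\
       x = vadd (p k) (vscal u (vsub (p (k + 1)%Z) (p k))).

Definition tame_knot (K : V3 -> Prop) : Prop :=
  is_knot K /\ exists P, polygonal_knot P /\ ambient_isotopic K P.

(* C(K) for the knot class K of the representative K0 *)
Definition in_CK (K0 : V3 -> Prop) (g : curve) : Prop :=
  in_C g /\ injective_S1 g /\ ambient_isotopic K0 (image g).

Definition collinear (x y z : V3) : Prop :=
  exists a b c : R, (a <> 0 \/ b <> 0 \/ c <> 0) /\ a + b + c = 0 /\
    vadd (vscal a x) (vadd (vscal b y) (vscal c z)) = (0, 0, 0).

(* radius of the unique circle through x, y, z (oo if collinear):
   the common distance to x, y, z of a centre lying in their plane *)
Definition circ_rad (x y z : V3) : ereal :=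
  match excluded_middle_informative (collinear x y z) with
  | left _ => PInf
  | right _ => Fin (epsilon (inhabits 0) (fun r => exists a b : R,
        let c := vadd x (vadd (vscal a (vsub y x)) (vscal b (vsub z x))) in
        dist3 c x = r /\ dist3 c y = r /\ dist3 c z = r))
  end.

Definition thickness (g : curve) : ereal :=
  einf (fun e => exists x y z, image g x /\ image g y /\ image g z /\
          x <> y /\ y <> z /\ x <> z /\ e = circ_rad x y z).

Definition F (g : curve) : ereal := einv (thickness g).

(* g is the arc length parametrisation (starting at parameter s) of the closed
   polygon with consecutive vertices x k (indices mod n), edges of length 1/n *)
Definition Pn_rep (n : nat) (g : curve) (sx : R * (Z -> V3)) : Prop :=
  let s := fst sx in let x := snd sx in
  (forall k, x (k + Z.of_nat n)%Z = x k) /\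
  (forall k, dist3 (x (k + 1)%Z) (x k) = / INR n) /\
  (forall (k : Z) (u : R), 0 <= u <= 1 ->
     g (s + (IZR k + u) / INR n) = vadd (x k) (vscal u (vsub (x (k + 1)%Z) (x k)))).

Definition in_Pn (n : nat) (g : curve) : Prop := in_C g /\ exists sx, Pn_rep n g sx.

Definition ext_angle (x y z : V3) : R :=
  acos (dot (vsub y x) (vsub z y) / (vnorm (vsub y x) * vnorm (vsub z y))).

Definition kappa_d (x y z : V3) : ereal :=
  let phi := ext_angle x y z in
  if Req_EM_T phi PI then PInf
  else Fin (2 * tan (phi / 2) / ((dist3 x y + dist3 z y) / 2)).

Definition maxCurv (n : nat) (x : Z -> V3) : ereal :=
  emax_upto (fun i => kappa_d (x (Z.of_nat i - 1)%Z) (x (Z.of_nat i)) (x (Z.of_nat i + 1)%Z)) n.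

Definition minRad (n : nat) (x : Z -> V3) : ereal := einv (maxCurv n x).

Definition loc_extremum (f : R -> R) (s : R) : Prop :=
  exists del, 0 < del /\
    ((forall u, Rabs (u - s) < del -> f u <= f s) \/
     (forall u, Rabs (u - s) < del -> f s <= f u)).

Definition dcrit (p : curve) (a b : V3) : Prop :=
  a <> b /\ exists t s, a = p t /\ b = p s /\
    loc_extremum (fun u => (dist3 (p t) (p u)) ^ 2) s /\
    loc_extremum (fun v => (dist3 (p v) (p s)) ^ 2) t.

Definition dcsd (p : curve) : ereal :=
  einf (fun e => exists a b, dcrit p a b /\ e = Fin (dist3 a b)).

Definition vertices_distinct (n : nat) (x : Z -> V3) : Prop :=
  forall i j : Z, (0 <= i < Z.of_nat n)%Z -> (0 <= j < Z.of_nat n)%Z -> i <> j -> x i <> x j.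

Definition Delta_n (n : nat) (p : curve) (x : Z -> V3) : ereal :=
  match excluded_middle_informative (vertices_distinct n x) with
  | left _ => emin (minRad n x) (ehalf (dcsd p))
  | right _ => Fin 0
  end.

(* F_n(g) = Delta_n[g]^{-1} if g in P_n(K) (g is assumed in C(K)), +oo otherwise *)
Definition Fn (n : nat) (g : curve) : ereal :=
  match excluded_middle_informative (in_Pn n g) with
  | left _ => einv (Delta_n n g (snd (epsilon (inhabits (0, fun _ => (0, 0, 0))) (Pn_rep n g))))
  | right _ => PInf
  end.

(* Main.v *)
(* Thickness at least D is the algebraic condition 4 D^2 gram <= sides on triples of points.

   Liminf: along polygons converging uniformly with F_n <= c, the bound on the exterior angles
   passes to the limit, which is therefore C^1 with angle(T s, T u) <= c |s - u|.  Put D = 1/c.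
   Then chords dominate those of a circle of radius D, and two points at arc distance at least
   pi D are at distance at least 2 D: otherwise the distance of the approximating polygon,
   restricted to such pairs, would have an interior minimum, a doubly critical pair that is
   too short.  In a triangle of circumradius r < D each angle would exceed h/(2D), where h is
   the arc joining the two other vertices.  If the arcs wind around the curve their sum
   contradicts Fenchel; otherwise the exterior angle at the middle vertex is at most the sum of
   the tangent-chord angles, hence at most (h + h')/(2D), again a contradiction.

   Limsup: positive thickness D forces C^{1,1}, since g stays outside the circles of radius D
   tangent at points of differentiability.  Inscribe equilateral polygons and rescale them to
   length 1.  Their discrete curvature is 1/(r cos(phi/2)) with r >= D the circumradius of three
   points of g, and at a doubly critical pair the chord is almost normal to g, hence of length
   almost 2 D at least.  They are isotopic to g because p - g is Lipschitz with small constant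
   as a function of g, so it extends to a contraction Phi of R^3 and id + t Phi is an isotopy. *)

From Stdlib Require Import Reals Lra Psatz Lia ZArith ClassicalEpsilon FunctionalExtensionality.
Require Import Defs.
Open Scope R_scope.

(** * Vectors and angles *)

Notation "u [+] v" := (vadd u v) (at level 50, left associativity).
Notation "u [-] v" := (vsub u v) (at level 50, left associativity).
Notation "a [*] v" := (vscal a v) (at level 40, left associativity).
Notation vzero := ((0, 0, 0) : V3).

Ltac vunf := unfold dist3, vadd, vsub, vscal, dot, c1, c2, c3 in *; simpl in *.

(** Admissible curves are only Lipschitz, with a derivative off a null set, and polygons have
    corners. Integration is therefore replaced by a mean value inequality with a local hypothesis,
    which allows for an exceptional null set. The thickness inequality is polynomial in the three
    points. It holds for collinear and for coinciding points as well, so it passes to limits without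
    case distinctions. The liminf half must keep the constant c sharp, hence turning is measured by
    angles. The length pi D is that of a half circle of radius D: up to there the half arc h/(2D)
    stays within [0, pi/2], where the sine increases; beyond it the chord bound obtained from
    turning decreases again and a global argument has to take over. In the limsup half the C^{1,1}
    constants may be crude, because the sharp radius D enters only through triples of points of g.
    Infima, circumradii and the vertices of a polygon are values of a choice operator, so existence
    has to be shown before any of them can be evaluated. *)

Lemma Rabs_le_inv a b : Rabs a <= b -> - b <= a <= b.
Proof. unfold Rabs; destruct (Rcase_abs a); lra. Qed.

Lemma mul_le_of_le_div a b x : 0 < a -> x <= b / a -> a * x <= b.
Proof.
  intros Ha H. apply Rle_trans with (a * (b / a)); [apply Rmult_le_compat_l; lra | right; field; lra].
Qed.

Lemma small_positive a b C : 0 < a -> 0 < b -> 0 < C -> exists r, 0 < r /\ r <= a /\ C * r <= b.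
Proof.
  intros Ha Hb HC. exists (Rmin a (b / C)).
  split; [apply Rmin_glb_lt; [|apply Rdiv_lt_0_compat]; auto|split; [apply Rmin_l|]].
  apply mul_le_of_le_div; [auto | apply Rmin_r].
Qed.

Lemma choose_fun {A B} (P : A -> B -> Prop) : (forall a, exists b, P a b) -> exists f, forall a, P a (f a).
Proof.
  intros H. exists (fun a => proj1_sig (constructive_indefinite_description _ (H a))).
  intros a. apply proj2_sig.
Qed.

Lemma vext (u v : V3) : c1 u = c1 v -> c2 u = c2 v -> c3 u = c3 v -> u = v.
Proof. destruct u as [[? ?] ?], v as [[? ?] ?]; unfold c1, c2, c3; simpl; congruence. Qed.

(** Values of curves and of vector sequences are generalised to variables first, so that every
    vector can be split into coordinates. Vector and scalar identities are both covered. *)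
Ltac vring :=
  repeat match goal with
  | |- context [?g ?t] => is_var g;
      match type of g with
      | curve => generalize (g t)
      | R -> V3 => generalize (g t)
      | Z -> V3 => generalize (g t)
      | nat -> V3 => generalize (g t)
      | V3 -> V3 => generalize (g t)
      end
  end; intros;
  repeat match goal with v : V3 |- _ => destruct v as [[? ?] ?] end;
  first [apply vext | idtac]; vunf; first [ring | field; lra].

Lemma dot_sym u v : dot u v = dot v u. Proof. vring. Qed.
Lemma dot_addl u v w : dot (u [+] v) w = dot u w + dot v w. Proof. vring. Qed.
Lemma dot_addr u v w : dot w (u [+] v) = dot w u + dot w v. Proof. vring. Qed.
Lemma dot_subl u v w : dot (u [-] v) w = dot u w - dot v w. Proof. vring. Qed.
Lemma dot_subr u v w : dot w (u [-] v) = dot w u - dot w v. Proof. vring. Qed.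
Lemma dot_scall a u w : dot (a [*] u) w = a * dot u w. Proof. vring. Qed.
Lemma dot_scalr a u w : dot w (a [*] u) = a * dot w u. Proof. vring. Qed.

Ltac dots := repeat first [rewrite dot_addl | rewrite dot_addr | rewrite dot_subl
  | rewrite dot_subr | rewrite dot_scall | rewrite dot_scalr].

Lemma dot_nonneg v : 0 <= dot v v.
Proof. destruct v as [[a b] c]; vunf; nra. Qed.

Lemma vnorm_nonneg v : 0 <= vnorm v.
Proof. apply sqrt_pos. Qed.

Lemma vnorm_sq v : vnorm v * vnorm v = dot v v.
Proof. apply sqrt_sqrt, dot_nonneg. Qed.

Lemma vnorm_le v M : 0 <= M -> dot v v <= M * M -> vnorm v <= M.
Proof.
  intros H H1. unfold vnorm. rewrite <- (sqrt_square M H).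
  now apply sqrt_le_1_alt.
Qed.

Lemma vnorm_ge v M : M * M <= dot v v -> M <= vnorm v.
Proof.
  intros H. destruct (Rle_dec 0 M) as [h|h].
  - unfold vnorm. rewrite <- (sqrt_square M h). now apply sqrt_le_1_alt.
  - pose proof (vnorm_nonneg v); lra.
Qed.

Lemma vnorm_eq v M : 0 <= M -> dot v v = M * M -> vnorm v = M.
Proof. intros H H1. unfold vnorm. rewrite H1. now apply sqrt_square. Qed.

Lemma vnorm_zero_inv v : vnorm v = 0 -> v = vzero.
Proof.
  intros H. pose proof (vnorm_sq v) as H1. rewrite H in H1.
  destruct v as [[a b] c]; vunf.
  assert (a = 0) by nra. assert (b = 0) by nra. assert (c = 0) by nra. congruence.
Qed.

Lemma vnorm_zero : vnorm vzero = 0.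
Proof. apply vnorm_eq; [lra | vring]. Qed.

Lemma gram_nonneg u v : 0 <= dot u u * dot v v - dot u v * dot u v.
Proof.
  destruct u as [[a b] c], v as [[d e] f]; vunf.
  (* Lagrange's identity: the difference is the squared length of the cross product. *)
  replace (_ - _) with (Rsqr (a * e - b * d) + Rsqr (a * f - c * d) + Rsqr (b * f - c * e))
    by (unfold Rsqr; ring).
  pose proof (Rle_0_sqr (a * e - b * d)); pose proof (Rle_0_sqr (a * f - c * d));
  pose proof (Rle_0_sqr (b * f - c * e)); lra.
Qed.

Lemma dot_abs_le u v : Rabs (dot u v) <= vnorm u * vnorm v.
Proof.
  pose proof (gram_nonneg u v). pose proof (vnorm_sq u). pose proof (vnorm_sq v).
  pose proof (vnorm_nonneg u). pose proof (vnorm_nonneg v).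
  apply Rabs_le.
  set (p := vnorm u * vnorm v).
  assert (dot u v * dot u v <= p * p) by (unfold p; nra).
  assert (0 <= p) by (unfold p; nra). nra.
Qed.

Lemma dot_le u v : dot u v <= vnorm u * vnorm v.
Proof. eapply Rle_trans; [apply Rle_abs | apply dot_abs_le]. Qed.

Lemma dot_ge u v : - (vnorm u * vnorm v) <= dot u v.
Proof. pose proof (dot_abs_le u v) as H. apply Rabs_le_inv in H. lra. Qed.

Lemma vnorm_add u v : vnorm (u [+] v) <= vnorm u + vnorm v.
Proof.
  pose proof (vnorm_nonneg u). pose proof (vnorm_nonneg v).
  apply vnorm_le; [lra|]. dots. rewrite (dot_sym v u), <- !vnorm_sq.
  pose proof (dot_le u v). nra.
Qed.

Lemma vnorm_scal a v : vnorm (a [*] v) = Rabs a * vnorm v.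
Proof.
  apply vnorm_eq.
  - apply Rmult_le_pos; [apply Rabs_pos | apply vnorm_nonneg].
  - dots. rewrite <- vnorm_sq.
    replace (Rabs a * vnorm v * (Rabs a * vnorm v)) with (Rabs a * Rabs a * (vnorm v * vnorm v)) by ring.
    rewrite <- Rabs_mult, (Rabs_pos_eq (a * a)) by nra. ring.
Qed.

Lemma vnorm_sub_sym u v : vnorm (u [-] v) = vnorm (v [-] u).
Proof. unfold vnorm. f_equal. vring. Qed.

Lemma vnorm_sub u v : vnorm (u [-] v) <= vnorm u + vnorm v.
Proof.
  replace (u [-] v) with (u [+] (-1) [*] v) by vring.
  eapply Rle_trans; [apply vnorm_add|]. rewrite vnorm_scal, Rabs_left by lra. lra.
Qed.

Lemma vnorm_sub3 u v w : vnorm (u [-] w) <= vnorm (u [-] v) + vnorm (v [-] w).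
Proof. replace (u [-] w) with ((u [-] v) [+] (v [-] w)) by vring. apply vnorm_add. Qed.

Lemma vnorm_sub_ge u v : vnorm u - vnorm v <= vnorm (u [-] v).
Proof.
  pose proof (vnorm_add (u [-] v) v) as H.
  replace (u [-] v [+] v) with u in H by vring. lra.
Qed.

Lemma vsub_self u : u [-] u = vzero. Proof. vring. Qed.

Lemma vsub_zero_inv u v : vnorm (u [-] v) = 0 -> u = v.
Proof.
  intros H. apply vnorm_zero_inv in H.
  destruct u as [[a b] c], v as [[d e] f]; vunf. injection H; intros.
  f_equal; [f_equal|]; lra.
Qed.

Lemma dist3_pos u v : u <> v -> 0 < vnorm (u [-] v).
Proof.
  intros H. destruct (vnorm_nonneg (u [-] v)) as [h|h]; auto.
  exfalso; apply H, vsub_zero_inv; auto.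
Qed.

Lemma comp_le_vnorm v : Rabs (c1 v) <= vnorm v /\ Rabs (c2 v) <= vnorm v /\ Rabs (c3 v) <= vnorm v.
Proof.
  assert (forall a, a * a <= dot v v -> Rabs a <= vnorm v) as K.
  { intros a Ha. apply vnorm_ge. rewrite <- Rabs_mult, Rabs_pos_eq by nra. auto. }
  repeat split; apply K; destruct v as [[a b] c]; vunf; nra.
Qed.

(** The factor 2 rounds up the square root of 3; it is the reason why constants are halved wherever
    a vector estimate is assembled from coordinates. *)
Lemma vnorm_le_comp v M : Rabs (c1 v) <= M -> Rabs (c2 v) <= M -> Rabs (c3 v) <= M ->
  vnorm v <= 2 * M.
Proof.
  intros H1 H2 H3. pose proof (Rabs_pos (c1 v)).
  apply vnorm_le; [lra|]. apply Rabs_le_inv in H1, H2, H3.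
  unfold dot. nra.
Qed.

Lemma vnorm_dual v : v <> vzero -> exists e, vnorm e = 1 /\ dot v e = vnorm v /\ v = vnorm v [*] e.
Proof.
  intros H. assert (0 < vnorm v) as Hp.
  { destruct (vnorm_nonneg v) as [h|h]; auto. exfalso; apply H, vnorm_zero_inv; auto. }
  exists (/ vnorm v [*] v). repeat split.
  - rewrite vnorm_scal, Rabs_pos_eq by (left; now apply Rinv_0_lt_compat). now field_simplify; [|lra].
  - dots. rewrite <- vnorm_sq. field; lra.
  - apply vext; unfold vscal, c1, c2, c3; simpl; field; lra.
Qed.

Lemma unit_dot v : vnorm v = 1 -> dot v v = 1.
Proof. intros H. rewrite <- vnorm_sq, H. ring. Qed.

(** Meant for unit vectors, where it is the spherical distance; unlike in [ext_angle] nothing is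
    normalised. *)
Definition ang (u v : V3) : R := acos (dot u v).

Lemma unit_dot_bound u v : vnorm u = 1 -> vnorm v = 1 -> -1 <= dot u v <= 1.
Proof. intros Hu Hv. pose proof (dot_abs_le u v) as H. rewrite Hu, Hv in H.
  apply Rabs_le_inv in H. lra. Qed.

Lemma cos_ang u v : vnorm u = 1 -> vnorm v = 1 -> cos (ang u v) = dot u v.
Proof. intros. apply cos_acos, unit_dot_bound; auto. Qed.

Lemma ang_bound u v : 0 <= ang u v <= PI.
Proof. apply acos_bound. Qed.

Lemma ang_sym u v : ang u v = ang v u.
Proof. unfold ang. now rewrite dot_sym. Qed.

Lemma ang_le u v x : vnorm u = 1 -> vnorm v = 1 -> 0 <= x <= PI -> cos x <= dot u v -> ang u v <= x.
Proof.
  intros Hu Hv Hx H. rewrite <- cos_ang in H by auto. pose proof (ang_bound u v).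
  apply cos_decr_0; lra.
Qed.

Lemma ang_le_cos u v x : vnorm u = 1 -> vnorm v = 1 -> ang u v <= x -> x <= PI -> cos x <= dot u v.
Proof.
  intros Hu Hv H Hx. rewrite <- cos_ang by auto. pose proof (ang_bound u v).
  apply cos_decr_1; lra.
Qed.

(** The components of u and w orthogonal to v have lengths sin A and sin B. The Cauchy-Schwarz
    inequality for these components says that the product of u and w is at least cos(A + B). *)
Lemma ang_triangle u v w : vnorm u = 1 -> vnorm v = 1 -> vnorm w = 1 ->
  ang u w <= ang u v + ang v w.
Proof.
  intros Hu Hv Hw. pose proof (ang_bound u v) as Ba. pose proof (ang_bound v w) as Bb.
  destruct (Rle_dec PI (ang u v + ang v w)) as [h|h].
  { pose proof (ang_bound u w). lra. }
  apply ang_le; auto; [lra|]. rewrite cos_plus.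
  pose proof (cos_ang u v Hu Hv) as Ea. pose proof (cos_ang v w Hv Hw) as Eb.
  set (A := ang u v) in *. set (B := ang v w) in *.
  pose proof (dot_ge (u [-] cos A [*] v) (w [-] cos B [*] v)) as Hd.
  pose proof (unit_dot _ Hu) as Du. pose proof (unit_dot _ Hv) as Dv. pose proof (unit_dot _ Hw) as Dw.
  assert (vnorm (u [-] cos A [*] v) = sin A) as Na.
  { apply vnorm_eq; [apply sin_ge_0; lra|]. dots. rewrite (dot_sym v u), <- Ea, Du, Dv.
    pose proof (sin2_cos2 A); unfold Rsqr in *; lra. }
  assert (vnorm (w [-] cos B [*] v) = sin B) as Nb.
  { apply vnorm_eq; [apply sin_ge_0; lra|]. dots. rewrite (dot_sym w v), <- Eb, Dw, Dv.
    pose proof (sin2_cos2 B); unfold Rsqr in *; lra. }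
  rewrite Na, Nb in Hd. revert Hd. dots. rewrite <- Ea, <- Eb, Dv. lra.
Qed.

(** * Circumradius and thickness *)

Lemma ele_trans a b c : ele a b -> ele b c -> ele a c.
Proof. destruct a, b, c; simpl; try tauto; lra. Qed.

(** A lower bound m is enough for an infimum to exist: completeness gives it if S has a finite
    member, and otherwise it is [PInf]. *)
Lemma einf_spec (S : ereal -> Prop) m : (forall x, S x -> ele (Fin m) x) -> is_eglb S (einf S).
Proof.
  intros Hm. unfold einf. apply epsilon_spec.
  destruct (classic (exists r, S (Fin r))) as [[r0 Hr0]|Hno].
  - destruct (completeness (fun y => S (Fin (- y)))) as [l [Hl1 Hl2]].
    + exists (- m). intros y Hy. apply Hm in Hy. simpl in Hy. lra.
    + exists (- r0). now rewrite Ropp_involutive.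
    + exists (Fin (- l)). split.
      * intros [x|] Hx; simpl; auto.
        assert (- x <= l) by (apply Hl1; now rewrite Ropp_involutive). lra.
      * intros [m'|] Hm'; simpl.
        -- assert (l <= - m'); [|lra]. apply Hl2. intros y Hy. apply Hm' in Hy. simpl in Hy. lra.
        -- exact (Hm' _ Hr0).
  - exists PInf. split.
    + intros [x|] Hx; simpl; auto. apply Hno; eauto.
    + intros [m'|] _; exact I.
Qed.

Lemma Rinf_spec (S : R -> Prop) m x : (forall x, S x -> m <= x) -> S x -> is_glb S (Rinf S).
Proof.
  intros Hm Hx. unfold Rinf. apply epsilon_spec.
  destruct (completeness (fun y => S (- y))) as [l [Hl1 Hl2]].
  - exists (- m). intros y Hy. apply Hm in Hy. lra.
  - exists (- x). now rewrite Ropp_involutive.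
  - exists (- l). split.
    + intros y Hy. assert (- y <= l) by (apply Hl1; now rewrite Ropp_involutive). lra.
    + intros m' Hm'. assert (l <= - m'); [|lra]. apply Hl2. intros y Hy. apply Hm' in Hy. lra.
Qed.

(* The circumradius r of 0, u, v satisfies 4 r^2 gram u v = sides u v. *)
Definition gram (u v : V3) : R := dot u u * dot v v - dot u v * dot u v.
Definition sides (u v : V3) : R := dot u u * dot v v * dot (u [-] v) (u [-] v).

(** [circ_rad] takes the first point as origin, [thick_at_least] the middle one. Both quantities are
    symmetric functions of the triangle, so the origin can be moved. *)
Lemma gram_cycle x y z : gram (x [-] y) (z [-] y) = gram (y [-] x) (z [-] x).
Proof. unfold gram. vring. Qed.

Lemma sides_cycle x y z : sides (x [-] y) (z [-] y) = sides (y [-] x) (z [-] x).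
Proof. unfold sides. vring. Qed.

Lemma gram_swap u v : gram u v = gram v u.
Proof. unfold gram. vring. Qed.

Lemma sides_swap u v : sides u v = sides v u.
Proof. unfold sides. vring. Qed.

Lemma collinear_gram x y z : collinear x y z -> gram (y [-] x) (z [-] x) = 0.
Proof.
  intros (a & b & c & Hn & Hs & Hc).
  assert (Hl : b [*] (y [-] x) [+] c [*] (z [-] x) = vzero).
  { rewrite <- Hc. assert (Ha : a = - b - c) by (clear - Hs; lra). rewrite Ha. clear. vring. }
  set (u := y [-] x) in *. set (v := z [-] x) in *.
  assert (E1 : b * dot u u + c * dot u v = 0).
  { replace 0 with (dot u vzero) by (destruct u as [[? ?] ?]; vunf; ring).
    rewrite <- Hl. dots. ring. }
  assert (E2 : b * dot u v + c * dot v v = 0).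
  { replace 0 with (dot v vzero) by (destruct v as [[? ?] ?]; vunf; ring).
    rewrite <- Hl. dots. rewrite (dot_sym v u). ring. }
  assert (b <> 0 \/ c <> 0) as [h|h].
  { destruct (Req_dec b 0); auto. destruct (Req_dec c 0); auto. lra. }
  - apply (Rmult_eq_reg_l b); auto. unfold gram.
    transitivity ((b * dot u u + c * dot u v) * dot v v - (b * dot u v + c * dot v v) * dot u v);
      [ring | rewrite E1, E2; ring].
  - apply (Rmult_eq_reg_l c); auto. unfold gram.
    transitivity ((b * dot u v + c * dot v v) * dot u u - (b * dot u u + c * dot u v) * dot u v);
      [ring | rewrite E1, E2; ring].
Qed.

(** Equality in the Cauchy-Schwarz inequality: v coincides with its projection g u onto u. *)
Lemma gram_collinear x y z : gram (y [-] x) (z [-] x) = 0 -> collinear x y z.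
Proof.
  intros H. set (u := y [-] x) in *. set (v := z [-] x) in *.
  destruct (Req_dec (dot u u) 0) as [h|h].
  - exists 1, (-1), 0. repeat split; try lra.
    assert (x = y).
    { symmetry. apply vsub_zero_inv. fold u. apply vnorm_eq; lra. }
    subst y. vring.
  - set (g := dot u v / dot u u).
    assert (v [-] g [*] u = vzero).
    { apply vnorm_zero_inv, vnorm_eq; [lra|]. dots. rewrite (dot_sym v u).
      unfold gram in H. unfold g.
      replace (dot v v) with (dot u v * dot u v / dot u u); [field; auto|].
      apply (Rmult_eq_reg_r (dot u u)); auto. field_simplify; auto; lra. }
    exists (g - 1), (- g), 1. repeat split; try lra.
    rewrite <- H0. unfold u, v. clearbody g. clear. vring.
Qed.

(** The centre w, taken relative to x, satisfies <w,u> = |u|^2/2 and <w,v> = |v|^2/2. Cramer's rule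
    for this linear system in a and b, with the determinant [gram] kept as a factor, turns r^2 =
    <w,w> into the formula. *)
Lemma circumcenter x y z a b r :
  let c := x [+] (a [*] (y [-] x) [+] b [*] (z [-] x)) in
  dist3 c x = r -> dist3 c y = r -> dist3 c z = r ->
  4 * r * r * gram (y [-] x) (z [-] x) = sides (y [-] x) (z [-] x).
Proof.
  intros c H1 H2 H3. unfold dist3 in *.
  set (u := y [-] x) in *. set (v := z [-] x) in *.
  set (w := a [*] u [+] b [*] v) in *.
  assert (E1 : dot w w = r * r).
  { rewrite <- H1, vnorm_sq. f_equal; unfold c; clearbody w; clear; vring. }
  assert (E2 : dot (w [-] u) (w [-] u) = r * r).
  { rewrite <- H2, vnorm_sq. f_equal; unfold c, u; clearbody w; clear; vring. }
  assert (E3 : dot (w [-] v) (w [-] v) = r * r).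
  { rewrite <- H3, vnorm_sq. f_equal; unfold c, v; clearbody w; clear; vring. }
  revert E2 E3. dots. rewrite (dot_sym w u), (dot_sym w v), E1. intros E2 E3.
  assert (F1 : a * dot u u + b * dot u v = dot u u / 2).
  { replace (a * dot u u + b * dot u v) with (dot u w); [lra|]. unfold w. dots. ring. }
  assert (F2 : a * dot u v + b * dot v v = dot v v / 2).
  { replace (a * dot u v + b * dot v v) with (dot v w); [lra|]. unfold w. dots.
    rewrite (dot_sym v u). ring. }
  assert (F3 : r * r = (a * dot u u + b * dot v v) / 2).
  { rewrite <- E1. unfold w at 1. dots. replace (dot u w) with (dot u u / 2) by lra.
    replace (dot v w) with (dot v v / 2) by lra. field. }
  unfold gram, sides. dots. rewrite (dot_sym v u).
  replace (4 * r * r) with (4 * (r * r)) by ring. rewrite F3.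
  clear - F1 F2. set (U := dot u u) in *. set (V := dot v v) in *. set (G := dot u v) in *.
  clearbody U V G. clear u v.
  assert (a * (U * V - G * G) = V * (U - G) / 2).
  { replace (a * (U * V - G * G)) with ((a * U + b * G) * V - (a * G + b * V) * G) by ring.
    rewrite F1, F2. field. }
  assert (b * (U * V - G * G) = U * (V - G) / 2).
  { replace (b * (U * V - G * G)) with ((a * G + b * V) * U - (a * U + b * G) * G) by ring.
    rewrite F1, F2. field. }
  replace (4 * ((a * U + b * V) / 2) * (U * V - G * G))
    with (2 * (U * (a * (U * V - G * G)) + V * (b * (U * V - G * G)))) by field.
  rewrite H, H0. field.
Qed.

Lemma circumcenter_exists x y z : gram (y [-] x) (z [-] x) <> 0 -> exists r a b,
  let c := x [+] (a [*] (y [-] x) [+] b [*] (z [-] x)) in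
  dist3 c x = r /\ dist3 c y = r /\ dist3 c z = r.
Proof.
  intros Hg. set (u := y [-] x) in *. set (v := z [-] x) in *. unfold gram in Hg.
  set (U := dot u u) in *. set (V := dot v v) in *. set (G := dot u v) in *.
  (* The solution of <w,u> = |u|^2/2, <w,v> = |v|^2/2 by Cramer's rule. *)
  set (a := V * (U - G) / (2 * (U * V - G * G))).
  set (b := U * (V - G) / (2 * (U * V - G * G))).
  set (w := a [*] u [+] b [*] v).
  assert (F1 : dot w u = U / 2).
  { unfold w. dots. rewrite (dot_sym v u). fold U G. unfold a, b. field; auto. }
  assert (F2 : dot w v = V / 2).
  { unfold w. dots. fold V G. unfold a, b. field; auto. }
  exists (vnorm w), a, b. simpl. fold w. unfold dist3. repeat split.
  - f_equal; clearbody w; clear; vring.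
  - apply vnorm_eq; [apply vnorm_nonneg|]. rewrite vnorm_sq.
    replace (x [+] w [-] y) with (w [-] u) by (unfold u; clearbody w; clear; vring).
    dots. rewrite (dot_sym u w), F1. fold U. lra.
  - apply vnorm_eq; [apply vnorm_nonneg|]. rewrite vnorm_sq.
    replace (x [+] w [-] z) with (w [-] v) by (unfold v; clearbody w; clear; vring).
    dots. rewrite (dot_sym v w), F2. fold V. lra.
Qed.

(** Existence of a circumcentre certifies the value that the choice operator in [circ_rad] returns;
    from here on only the algebraic relation is used. *)
Lemma circ_rad_cases x y z :
  (circ_rad x y z = PInf /\ gram (y [-] x) (z [-] x) = 0) \/
  (exists r, circ_rad x y z = Fin r /\ 0 <= r /\ 0 < gram (y [-] x) (z [-] x) /\
    4 * r * r * gram (y [-] x) (z [-] x) = sides (y [-] x) (z [-] x)).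
Proof.
  unfold circ_rad. destruct (excluded_middle_informative _) as [h|h].
  - left. split; auto. now apply collinear_gram.
  - right. assert (Hg : gram (y [-] x) (z [-] x) <> 0) by (intros E; apply h, gram_collinear, E).
    destruct (circumcenter_exists x y z Hg) as (r0 & H0).
    eexists. split; [reflexivity|].
    match goal with |- context [epsilon ?i ?P] =>
      assert (Hs : P (epsilon i P)) by (apply epsilon_spec; exists r0; exact H0);
      set (r := epsilon i P) in * end.
    destruct Hs as (a & b & H1 & H2 & H3).
    repeat split.
    + rewrite <- H1. apply vnorm_nonneg.
    + pose proof (gram_nonneg (y [-] x) (z [-] x)) as Hp. unfold gram in *. lra.
    + eapply circumcenter; eauto.
Qed.

Lemma circ_rad_nonneg x y z : ele (Fin 0) (circ_rad x y z).
Proof.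
  destruct (circ_rad_cases x y z) as [[-> _]|(r & -> & H & _)]; simpl; auto.
Qed.

(** In the collinear case both sides are true: the radius is infinite and the Gram determinant
    vanishes. Otherwise a positive factor [gram] is cancelled. *)
Lemma circ_rad_ge_iff x y z D : 0 <= D ->
  ele (Fin D) (circ_rad x y z) <->
  4 * D * D * gram (y [-] x) (z [-] x) <= sides (y [-] x) (z [-] x).
Proof.
  intros HD.
  assert (Hsd : 0 <= sides (y [-] x) (z [-] x)).
  { unfold sides. repeat apply Rmult_le_pos; apply dot_nonneg. }
  destruct (circ_rad_cases x y z) as [[-> H]|(r & -> & H & Hg & He)]; simpl.
  - rewrite H. split; auto. intros _. lra.
  - rewrite <- He. split; intros h.
    + apply Rmult_le_compat_r; nra.
    + apply Rmult_le_reg_r in h; auto. nra.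
Qed.

Definition distinct3 (x y z : V3) : Prop := x <> y /\ y <> z /\ x <> z.

Definition thick_at_least (g : curve) (D : R) : Prop :=
  forall x y z, image g x -> image g y -> image g z -> distinct3 x y z ->
    4 * D * D * gram (x [-] y) (z [-] y) <= sides (x [-] y) (z [-] y).

Lemma thickness_glb g : is_eglb (fun e => exists x y z, image g x /\ image g y /\ image g z /\
          x <> y /\ y <> z /\ x <> z /\ e = circ_rad x y z) (thickness g).
Proof.
  apply (einf_spec _ 0). intros e (x & y & z & _ & _ & _ & _ & _ & _ & ->). apply circ_rad_nonneg.
Qed.

Lemma thickness_ge_iff g D : 0 <= D -> ele (Fin D) (thickness g) <-> thick_at_least g D.
Proof.
  intros HD. destruct (thickness_glb g) as [H1 H2]. split.
  - intros H x y z Hx Hy Hz (n1 & n2 & n3). rewrite gram_cycle, sides_cycle.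
    apply circ_rad_ge_iff; auto. eapply ele_trans; [apply H|]. apply H1.
    exists x, y, z. tauto.
  - intros H. apply H2. intros e (x & y & z & Hx & Hy & Hz & n1 & n2 & n3 & ->).
    apply circ_rad_ge_iff; auto. rewrite <- gram_cycle, <- sides_cycle.
    apply H; auto. repeat split; auto.
Qed.

Lemma thickness_nonneg g : ele (Fin 0) (thickness g).
Proof.
  apply thickness_glb. intros e (x & y & z & _ & _ & _ & _ & _ & _ & ->). apply circ_rad_nonneg.
Qed.

(** * Null sets and the mean value inequality *)

Lemma sum_mono_length (F : nat -> R) m m' : (forall k, 0 <= F k) -> (m <= m')%nat ->
  sum_f_R0 F m <= sum_f_R0 F m'.
Proof.
  intros HF H. induction H; [lra|]. simpl. pose proof (HF (S m0)). lra.
Qed.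

(** Charges a growth d to the single index j. The range of summation is enlarged to m' because j may
    lie beyond m. *)
Lemma sum_mono_gain (F G : nat -> R) d j m m' :
  (forall k, 0 <= F k) -> (forall k, F k <= G k) -> F j + d <= G j -> (m <= m')%nat -> (j <= m')%nat ->
  sum_f_R0 F m + d <= sum_f_R0 G m'.
Proof.
  intros HF HG Hd Hm Hj. pose proof (sum_mono_length F m m' HF Hm).
  assert (sum_f_R0 F m' + d <= sum_f_R0 G m'); [|lra].
  clear - HF HG Hd Hj. induction m' as [|m' IH]; simpl.
  - replace j with 0%nat in Hd by lia. lra.
  - destruct (Nat.eq_dec j (S m')) as [->|h].
    + pose proof (sum_Rle F G m' (fun n _ => HG n)). lra.
    + pose proof (HG (S m')). assert (j <= m')%nat by lia. specialize (IH H0). lra.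
Qed.

Lemma null_subset (N N' : R -> Prop) : (forall t, N t -> N' t) -> null_set N' -> null_set N.
Proof.
  intros H HN eps Heps. destruct (HN eps Heps) as (a & b & H1 & H2 & H3). exists a, b. eauto.
Qed.

Lemma null_shift (N : R -> Prop) c : null_set N -> null_set (fun t => N (t + c)).
Proof.
  intros HN eps Heps. destruct (HN eps Heps) as (a & b & H1 & H2 & H3).
  exists (fun k => a k - c), (fun k => b k - c). repeat split.
  - intros k. specialize (H1 k). lra.
  - intros t Ht. destruct (H2 _ Ht) as (k & Hk). exists k. lra.
  - intros m. rewrite (sum_eq _ (fun k => b k - a k)); auto. intros; ring.
Qed.

Lemma sum_interleave (F : nat -> R) m :
  sum_f_R0 F (2 * m + 1) =
  sum_f_R0 (fun k => F (2 * k)%nat) m + sum_f_R0 (fun k => F (2 * k + 1)%nat) m.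
Proof.
  induction m as [|m IH]; [simpl; ring|].
  replace (2 * S m + 1)%nat with (S (S (2 * m + 1))) by lia.
  rewrite !tech5, IH.
  replace (S (S (2 * m + 1))) with (2 * S m + 1)%nat by lia.
  replace (S (2 * m + 1)) with (2 * S m)%nat by lia. ring.
Qed.

Lemma null_union (N N' : R -> Prop) : null_set N -> null_set N' -> null_set (fun t => N t \/ N' t).
Proof.
  intros HN HN' eps Heps.
  destruct (HN (eps / 2) ltac:(lra)) as (a & b & H1 & H2 & H3).
  destruct (HN' (eps / 2) ltac:(lra)) as (a' & b' & H1' & H2' & H3').
  (* The two covers are interleaved, even indices for N and odd ones for N'. *)
  set (mix := fun (f g : nat -> R) k => if Nat.even k then f (Nat.div2 k) else g (Nat.div2 k)).
  assert (Me : forall f g k, mix f g (2 * k)%nat = f k).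
  { intros. unfold mix. rewrite Nat.even_even, Nat.div2_double. reflexivity. }
  assert (Mo : forall f g k, mix f g (2 * k + 1)%nat = g k).
  { intros. unfold mix. rewrite Nat.even_odd, Nat.add_1_r, Nat.div2_succ_double. reflexivity. }
  exists (mix a a'), (mix b b').
  assert (Hp : forall k, mix a a' k <= mix b b' k).
  { intros k. unfold mix. destruct (Nat.even k); auto. }
  repeat split; auto.
  - intros t [Ht|Ht].
    + destruct (H2 _ Ht) as (k & Hk). exists (2 * k)%nat. now rewrite !Me.
    + destruct (H2' _ Ht) as (k & Hk). exists (2 * k + 1)%nat. now rewrite !Mo.
  - intros m. apply Rle_trans with (sum_f_R0 (fun k => mix b b' k - mix a a' k) (2 * m + 1)).
    + apply sum_mono_length; [|lia]. intros k. specialize (Hp k). lra.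
    + rewrite sum_interleave.
      rewrite (sum_eq _ (fun k => b k - a k)) by (intros; now rewrite !Me).
      rewrite (sum_eq (fun k => mix b b' (2 * k + 1)%nat - _) (fun k => b' k - a' k))
        by (intros; now rewrite !Mo).
      specialize (H3 m). specialize (H3' m). lra.
Qed.

Lemma null_countable (x : nat -> R) : null_set (fun t => exists k, t = x k).
Proof.
  intros eps Heps. set (r := fun k => eps / 4 * (/ 2) ^ k).
  assert (Hr : forall k, 0 < r k).
  { intros k. unfold r. apply Rmult_lt_0_compat; [lra|]. apply pow_lt. lra. }
  exists (fun k => x k - r k), (fun k => x k + r k). repeat split.
  - intros k. specialize (Hr k). lra.
  - intros t (k & ->). exists k. specialize (Hr k). lra.
  - intros m. assert (E : sum_f_R0 (fun k => x k + r k - (x k - r k)) m = eps - 2 * r m).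
    { induction m as [|m IH]; simpl; [unfold r; simpl; field|]. rewrite IH. unfold r. simpl. field. }
    rewrite E. specialize (Hr m). lra.
Qed.

Lemma null_empty : null_set (fun _ => False).
Proof. eapply null_subset; [|apply (null_countable (fun _ => 0))]. tauto. Qed.

(* Real induction on [x]: [f] may grow at rate [M] only inside the intervals covering [N],
   and the part of these intervals lying in [a, x] pays for that growth. *)
Lemma mean_value_ineq_ae (f : curve) (N : R -> Prop) a b M eps :
  a <= b -> 0 <= M -> 0 <= eps -> null_set N ->
  (forall t, a <= t <= b -> exists eta, 0 < eta /\ forall x y, a <= x <= t -> t <= y <= b ->
     t - eta < x -> y < t + eta -> vnorm (f y [-] f x) <= M * (y - x)) ->
  (forall t, a <= t <= b -> ~ N t -> forall del, 0 < del -> exists eta, 0 < eta /\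
     forall x y, a <= x <= t -> t <= y <= b ->
     t - eta < x -> y < t + eta -> vnorm (f y [-] f x) <= (eps + del) * (y - x)) ->
  vnorm (f b [-] f a) <= eps * (b - a).
Proof.
  intros Hab HM He HN Hloc Hloc2.
  apply le_epsilon. intros d0 Hd0.
  set (del := d0 / (2 * (b - a + 1))).
  assert (Hdel : 0 < del) by (apply Rdiv_lt_0_compat; lra).
  assert (Hdel2 : del * (b - a) <= d0 / 2).
  { apply Rle_trans with (del * (b - a + 1)); [nra|]. right. unfold del. field. lra. }
  destruct (HN (d0 / (2 * (M + 1)))) as (p & q & Hpq & Hcov & Hsum).
  { apply Rdiv_lt_0_compat; lra. }
  (* The length of the part of the k-th covering interval that lies in [a, x]. *)
  set (len := fun x k => Rmax 0 (Rmin x (q k) - Rmax a (p k))).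
  assert (L0 : forall x k, 0 <= len x k) by (intros; apply Rmax_l).
  assert (Lm : forall x y k, x <= y -> len x k <= len y k).
  { intros x y k H. unfold len. apply Rle_max_compat_l.
    assert (Rmin x (q k) <= Rmin y (q k)) by (apply Rmin_glb; [eapply Rle_trans; [apply Rmin_l | lra] | apply Rmin_r]). lra. }
  assert (Lq : forall x k, len x k <= q k - p k).
  { intros x k. specialize (Hpq k). unfold len. apply Rmax_lub; [lra|].
    pose proof (Rmin_r x (q k)). pose proof (Rmax_r a (p k)). lra. }
  set (S := fun x => a <= x <= b /\ exists m,
     vnorm (f x [-] f a) <= (eps + del) * (x - a) + M * sum_f_R0 (len x) m).
  destruct (completeness S) as [c [Hc1 Hc2]].
  { exists b. intros x [Hx _]. lra. }
  { exists a. split; [lra|]. exists 0%nat. rewrite vsub_self, vnorm_zero.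
    simpl. specialize (L0 a 0%nat). nra. }
  assert (Sa : S a).
  { split; [lra|]. exists 0%nat. rewrite vsub_self, vnorm_zero.
    simpl. specialize (L0 a 0%nat). nra. }
  assert (Hca : a <= c <= b).
  { split; [now apply Hc1|]. apply Hc2. intros x [Hx _]. lra. }
  (* The supremum c is not yet known to belong to S, so a step starts at a point of S just left of c
     and ends at c or beyond. This is why the hypotheses speak of pairs x, y with t between them. *)
  assert (Step : exists eta, 0 < eta /\ forall x y, S x -> c - eta < x <= c -> c <= y <= b ->
            y < c + eta -> S y).
  { destruct (classic (N c)) as [n|n].
    - destruct (Hcov _ n) as (j & Hj). destruct (Hloc c Hca) as (eta & Heta & Hl).
      exists (Rmin eta (Rmin (c - p j) (q j - c))).
      split; [repeat apply Rmin_glb_lt; lra|].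
      intros x y [Hx (m & Hm)] H1 H2 H3.
      assert (Rmin eta (Rmin (c - p j) (q j - c)) <= eta) by apply Rmin_l.
      assert (Rmin eta (Rmin (c - p j) (q j - c)) <= c - p j)
        by (eapply Rle_trans; [apply Rmin_r | apply Rmin_l]).
      assert (Rmin eta (Rmin (c - p j) (q j - c)) <= q j - c)
        by (eapply Rle_trans; [apply Rmin_r | apply Rmin_r]).
      split; [lra|]. exists (Nat.max m j).
      pose proof (vnorm_sub3 (f y) (f x) (f a)).
      assert (vnorm (f y [-] f x) <= M * (y - x)) by (apply Hl; lra).
      assert (sum_f_R0 (len x) m + (y - x) <= sum_f_R0 (len y) (Nat.max m j)).
      { apply sum_mono_gain with j; try lia; auto.
        - intros k. apply Lm. lra.
        - assert (Rmax a (p j) <= x) by (apply Rmax_lub; lra).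
          unfold len. rewrite !(Rmin_left _ (q j)) by lra. rewrite !(Rmax_right 0) by lra. lra. }
      assert (0 <= y - x) by lra. nra.
    - destruct (Hloc2 c Hca n del Hdel) as (eta & Heta & Hl).
      exists eta. split; auto. intros x y [Hx (m & Hm)] H1 H2 H3.
      split; [lra|]. exists m.
      pose proof (vnorm_sub3 (f y) (f x) (f a)).
      assert (vnorm (f y [-] f x) <= (eps + del) * (y - x)) by (apply Hl; lra).
      assert (sum_f_R0 (len x) m <= sum_f_R0 (len y) m).
      { apply sum_Rle. intros; apply Lm; lra. }
      nra. }
  destruct Step as (eta & Heta & Step).
  assert (exists x, S x /\ c - eta < x <= c) as (x & Sx & Hx).
  { apply NNPP. intros Hn. assert (c <= c - eta); [|lra]. apply Hc2. intros x Sx.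
    destruct (Rle_dec x (c - eta)); auto. exfalso; apply Hn. exists x. split; auto.
    split; [lra|]. now apply Hc1. }
  assert (Sb : S b).
  { destruct (Rle_lt_dec b c) as [h|h].
    - replace b with c by lra. apply (Step x c); auto; lra.
    - exfalso. set (y := Rmin (c + eta / 2) b).
      assert (y <= c + eta / 2) by apply Rmin_l. assert (y <= b) by apply Rmin_r.
      assert (c < y) by (apply Rmin_glb_lt; lra).
      assert (S y) by (apply (Step x y); auto; lra).
      apply Hc1 in H2. lra. }
  destruct Sb as [_ (m & Hm)].
  assert (sum_f_R0 (len b) m <= d0 / (2 * (M + 1))).
  { eapply Rle_trans; [|apply (Hsum m)]. apply sum_Rle. intros; apply Lq. }
  assert (M * (d0 / (2 * (M + 1))) <= d0 / 2).
  { apply Rle_trans with ((M + 1) * (d0 / (2 * (M + 1)))); [|right; field; lra].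
    apply Rmult_le_compat_r; [|lra]. left. apply Rdiv_lt_0_compat; lra. }
  nra.
Qed.

Lemma mean_value_ineq (f : curve) a b eps : a <= b -> 0 <= eps ->
  (forall t, a <= t <= b -> forall del, 0 < del -> exists eta, 0 < eta /\
     forall x y, a <= x <= t -> t <= y <= b ->
     t - eta < x -> y < t + eta -> vnorm (f y [-] f x) <= (eps + del) * (y - x)) ->
  vnorm (f b [-] f a) <= eps * (b - a).
Proof.
  intros Hab He H. apply (mean_value_ineq_ae f (fun _ => False) a b (eps + 1)); auto; [lra | apply null_empty |].
  intros t Ht. apply H; auto; lra.
Qed.

(** If the interval were contained in N, the mean value inequality with rate 0 would apply to the
    identity and make it constant. *)
Lemma null_no_interval (N : R -> Prop) a b : a < b -> null_set N -> exists t, a < t < b /\ ~ N t.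
Proof.
  intros Hab HN. apply NNPP. intros Hn.
  set (u := (2 * a + b) / 3). set (v := (a + 2 * b) / 3).
  assert (vnorm ((v, 0, 0) [-] (u, 0, 0)) <= 0 * (v - u)).
  { apply (mean_value_ineq_ae (fun t => (t, 0, 0)) N u v 1); auto; try lra; try (unfold u, v; lra).
    - intros t _. exists 1. split; [lra|]. intros x y Hx Hy _ _.
      right. apply vnorm_eq; [lra|]. vunf. ring.
    - intros t Ht h. exfalso. apply Hn. exists t. split; auto. unfold u, v in Ht. lra. }
  assert (vnorm ((v, 0, 0) [-] (u, 0, 0)) = v - u).
  { apply vnorm_eq; [unfold u, v; lra|]. vunf. ring. }
  unfold u, v in *. lra.
Qed.

(** * Derivatives of curves *)

Lemma local_lip_derivable (f : curve) t V del : has_deriv f t V -> 0 < del -> exists eta, 0 < eta /\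
  forall u, Rabs (u - t) < eta -> vnorm (f u [-] f t [-] (u - t) [*] V) <= del * Rabs (u - t).
Proof.
  intros (H1 & H2 & H3) Hd.
  destruct (H1 (del / 2) ltac:(lra)) as (e1 & K1). destruct (H2 (del / 2) ltac:(lra)) as (e2 & K2).
  destruct (H3 (del / 2) ltac:(lra)) as (e3 & K3).
  exists (Rmin e1 (Rmin e2 e3)). split.
  { repeat apply Rmin_glb_lt; apply cond_pos. }
  intros u Hu.
  assert (Rabs (u - t) < e1) by (eapply Rlt_le_trans; [apply Hu | apply Rmin_l]).
  assert (Rabs (u - t) < e2)
    by (eapply Rlt_le_trans; [apply Hu | eapply Rle_trans; [apply Rmin_r | apply Rmin_l]]).
  assert (Rabs (u - t) < e3)
    by (eapply Rlt_le_trans; [apply Hu | eapply Rle_trans; [apply Rmin_r | apply Rmin_r]]).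
  destruct (Req_dec u t) as [->|hn].
  { replace (f t [-] f t [-] (t - t) [*] V) with vzero; [rewrite vnorm_zero; pose proof (Rabs_pos (t - t)); nra|].
    vring. }
  assert (G : forall (phi : R -> R) l, 
     Rabs ((phi (t + (u - t)) - phi t) / (u - t) - l) < del / 2 ->
     Rabs (phi u - phi t - (u - t) * l) <= del / 2 * Rabs (u - t)).
  { intros phi l Hl. replace (t + (u - t)) with u in Hl by ring.
    replace (phi u - phi t - (u - t) * l) with (((phi u - phi t) / (u - t) - l) * (u - t)) by (field; lra).
    rewrite Rabs_mult. apply Rmult_le_compat_r; [apply Rabs_pos | lra]. }
  replace (del * Rabs (u - t)) with (2 * (del / 2 * Rabs (u - t))) by field.
  apply vnorm_le_comp.
  - apply (G (fun s => c1 (f s))), K1; auto; lra.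
  - apply (G (fun s => c2 (f s))), K2; auto; lra.
  - apply (G (fun s => c3 (f s))), K3; auto; lra.
Qed.

(** Differentiability at t in the form that the mean value inequality consumes: increments over
    intervals containing t. *)
Lemma derivable_straddle (f : curve) t V del : has_deriv f t V -> 0 < del -> exists eta, 0 < eta /\
  forall x y, x <= t -> t <= y -> t - eta < x -> y < t + eta ->
    vnorm (f y [-] f x [-] (y - x) [*] V) <= del * (y - x).
Proof.
  intros H Hd. destruct (local_lip_derivable f t V del H Hd) as (eta & He & K).
  exists eta. split; auto. intros x y h1 h2 h3 h4.
  pose proof (K x ltac:(apply Rabs_def1; lra)) as Kx.
  pose proof (K y ltac:(apply Rabs_def1; lra)) as Ky.
  rewrite (Rabs_left1 (x - t)) in Kx by lra. rewrite (Rabs_pos_eq (y - t)) in Ky by lra.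
  replace (f y [-] f x [-] (y - x) [*] V) with
    ((f y [-] f t [-] (y - t) [*] V) [-] (f x [-] f t [-] (x - t) [*] V)).
  - eapply Rle_trans; [apply vnorm_sub|]. lra.
  - vring.
Qed.

(** * Tangents and compactness *)

Lemma real_cauchy_rate (x r : nat -> R) : Un_cv r 0 ->
  (forall k l, (k <= l)%nat -> Rabs (x k - x l) <= r k) ->
  exists L, forall k, Rabs (x k - L) <= r k.
Proof.
  intros Hr Hx. destruct (R_complete x) as [L HL].
  - intros eps Heps. destruct (Hr (eps / 2) ltac:(lra)) as (N & HN).
    exists N. intros n m Hn Hm. unfold Rdist.
    specialize (HN N (Nat.le_refl _)). unfold Rdist in HN. rewrite Rminus_0_r in HN.
    pose proof (Hx N n Hn) as E1. pose proof (Hx N m Hm) as E2.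
    apply Rabs_le_inv in E1, E2. apply Rabs_def2 in HN.
    apply Rabs_def1; lra.
  - exists L. intros k. apply le_epsilon. intros eps Heps.
    destruct (HL eps Heps) as (N & HN).
    specialize (HN (Nat.max N k) ltac:(lia)). unfold Rdist in HN.
    pose proof (Hx k (Nat.max N k) ltac:(lia)) as E1.
    apply Rabs_le_inv in E1. apply Rabs_def2 in HN. apply Rabs_le; lra.
Qed.

Lemma vec_cauchy_rate (E : nat -> V3) (r : nat -> R) : Un_cv r 0 ->
  (forall k l, (k <= l)%nat -> vnorm (E k [-] E l) <= r k) ->
  exists V, forall k, vnorm (E k [-] V) <= 2 * r k.
Proof.
  intros Hr HE.
  destruct (real_cauchy_rate (fun k => c1 (E k)) r Hr) as (x & Hx).
  { intros k l H. eapply Rle_trans; [|apply (HE k l H)]. apply (comp_le_vnorm (E k [-] E l)). }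
  destruct (real_cauchy_rate (fun k => c2 (E k)) r Hr) as (y & Hy).
  { intros k l H. eapply Rle_trans; [|apply (HE k l H)]. apply (comp_le_vnorm (E k [-] E l)). }
  destruct (real_cauchy_rate (fun k => c3 (E k)) r Hr) as (z & Hz).
  { intros k l H. eapply Rle_trans; [|apply (HE k l H)]. apply (comp_le_vnorm (E k [-] E l)). }
  exists (x, y, z). intros k. apply vnorm_le_comp; [exact (Hx k) | exact (Hy k) | exact (Hz k)].
Qed.

Lemma inv_succ_cv C : Un_cv (fun k => C / INR (S k)) 0.
Proof.
  intros eps Heps. destruct (INR_unbounded (Rabs C / eps)) as (N & HN).
  exists N. intros n Hn. unfold Rdist. rewrite Rminus_0_r.
  assert (0 < INR (S n)) by (apply lt_0_INR; lia).
  assert (INR N < INR (S n)) by (apply lt_INR; lia).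
  unfold Rdiv. rewrite Rabs_mult, (Rabs_pos_eq (/ _)) by (left; now apply Rinv_0_lt_compat).
  apply (Rmult_lt_reg_r (INR (S n))); auto. rewrite Rmult_assoc, Rinv_l by lra.
  rewrite Rmult_1_r. apply Rlt_le_trans with (eps * INR N); [|nra].
  apply (Rmult_lt_reg_r (/ eps)); [now apply Rinv_0_lt_compat|].
  replace (eps * INR N * / eps) with (INR N) by (field; lra). apply HN.
Qed.

Lemma quad_has_deriv g s V K : (forall u, Rabs (u - s) <= 1 ->
    vnorm (g u [-] g s [-] (u - s) [*] V) <= K * (u - s) ^ 2) -> has_deriv g s V.
Proof.
  intros H.
  assert (G : forall (phi : R -> R) l, (forall u, Rabs (u - s) <= 1 ->
     Rabs (phi u - phi s - (u - s) * l) <= K * (u - s) ^ 2) -> derivable_pt_lim phi s l).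
  { intros phi l Hp eps Heps.
    assert (0 <= Rabs K) by apply Rabs_pos.
    assert (Hpos : 0 < Rmin 1 (eps / (2 * (Rabs K + 1)))).
    { apply Rmin_glb_lt; [lra|]. apply Rdiv_lt_0_compat; lra. }
    exists (mkposreal _ Hpos). intros h Hh Hlt. simpl in Hlt.
    assert (H1 : Rabs h < 1) by (eapply Rlt_le_trans; [apply Hlt | apply Rmin_l]).
    assert (H2 : Rabs h < eps / (2 * (Rabs K + 1))) by (eapply Rlt_le_trans; [apply Hlt | apply Rmin_r]).
    specialize (Hp (s + h)). replace (s + h - s) with h in Hp by ring.
    specialize (Hp ltac:(lra)).
    assert (Hh' : 0 < Rabs h) by (now apply Rabs_pos_lt).
    replace ((phi (s + h) - phi s) / h - l) with ((phi (s + h) - phi s - h * l) / h) by (field; auto).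
    unfold Rdiv. rewrite Rabs_mult, Rabs_inv. apply (Rmult_lt_reg_r (Rabs h)); auto.
    rewrite Rmult_assoc, Rinv_l, Rmult_1_r by lra.
    eapply Rle_lt_trans; [apply Hp|].
    replace (h ^ 2) with (Rabs h * Rabs h) by (rewrite <- Rabs_mult, Rabs_pos_eq by nra; ring).
    rewrite <- Rmult_assoc. apply Rmult_lt_compat_r; auto.
    pose proof (Rle_abs K).
    assert ((Rabs K + 1) * Rabs h < eps / 2).
    { replace (eps / 2) with ((Rabs K + 1) * (eps / (2 * (Rabs K + 1)))) by (field; lra).
      apply Rmult_lt_compat_l; lra. }
    nra. }
  repeat split; apply G; intros u Hu; (eapply Rle_trans; [|apply (H u Hu)]);
    apply (comp_le_vnorm (g u [-] g s [-] (u - s) [*] V)).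
Qed.

Lemma has_deriv_unique g s V V' : has_deriv g s V -> has_deriv g s V' -> V = V'.
Proof.
  intros (a1 & a2 & a3) (b1 & b2 & b3).
  apply vext; eapply uniqueness_limite; eauto.
Qed.

Lemma has_deriv_ext f g s V : (forall t, f t = g t) -> has_deriv f s V -> has_deriv g s V.
Proof. intros E. now rewrite (functional_extensionality f g E). Qed.

Lemma has_deriv_shift g s V c : has_deriv g (s + c) V -> has_deriv (fun t => g (t + c)) s V.
Proof.
  assert (G : forall phi l, derivable_pt_lim phi (s + c) l -> derivable_pt_lim (fun t => phi (t + c)) s l).
  { intros phi l H eps Heps. destruct (H eps Heps) as (d & Hd). exists d. intros h.
    replace (s + h + c) with (s + c + h) by ring. apply Hd. }
  intros (a1 & a2 & a3). exact (conj (G _ _ a1) (conj (G _ _ a2) (G _ _ a3))).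
Qed.

Lemma has_deriv_dot g s V w : has_deriv g s V -> derivable_pt_lim (fun t => dot (g t) w) s (dot V w).
Proof.
  intros (a1 & a2 & a3). unfold dot.
  apply (derivable_pt_lim_plus (fun t => c1 (g t) * c1 w + c2 (g t) * c2 w) (fun t => c3 (g t) * c3 w)).
  - apply (derivable_pt_lim_plus (fun t => c1 (g t) * c1 w) (fun t => c2 (g t) * c2 w)).
    + replace (c1 V * c1 w) with (c1 V * c1 w + c1 (g s) * 0) by ring.
      apply (derivable_pt_lim_mult (fun t => c1 (g t)) (fun _ => c1 w)); auto. apply derivable_pt_lim_const.
    + replace (c2 V * c2 w) with (c2 V * c2 w + c2 (g s) * 0) by ring.
      apply (derivable_pt_lim_mult (fun t => c2 (g t)) (fun _ => c2 w)); auto. apply derivable_pt_lim_const.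
  - replace (c3 V * c3 w) with (c3 V * c3 w + c3 (g s) * 0) by ring.
    apply (derivable_pt_lim_mult (fun t => c3 (g t)) (fun _ => c3 w)); auto. apply derivable_pt_lim_const.
Qed.

(** Take unit vectors with error h^2 for h = 1/(k+1). At the parameter s + h, a pair of them, the
    second with an error at most h^2, predicts the same increment of g up to O(h^2), so they differ
    by at most (2K + 2) h and form a Cauchy sequence. *)
Lemma tangent_exists (g : curve) K s : 0 <= K ->
  (forall eps, 0 < eps -> exists e, vnorm e = 1 /\ forall u, Rabs (u - s) <= 1 ->
     vnorm (g u [-] g s [-] (u - s) [*] e) <= K * (u - s) ^ 2 + eps) ->
  exists V, vnorm V = 1 /\ forall u, Rabs (u - s) <= 1 ->
     vnorm (g u [-] g s [-] (u - s) [*] V) <= K * (u - s) ^ 2.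
Proof.
  intros HK H. set (h := fun k => / INR (S k)).
  assert (Hh : forall k, 0 < h k).
  { intros k. apply Rinv_0_lt_compat, lt_0_INR. lia. }
  assert (Hh1 : forall k, h k <= 1).
  { intros k. unfold h. rewrite <- Rinv_1. apply Rinv_le_contravar; [lra|].
    rewrite S_INR. pose proof (pos_INR k). lra. }
  assert (Hhm : forall k l, (k <= l)%nat -> h l <= h k).
  { intros k l Hkl. unfold h. apply Rinv_le_contravar; [apply lt_0_INR; lia|]. apply le_INR; lia. }
  destruct (choose_fun _ (fun k => H (h k * h k) (Rmult_lt_0_compat _ _ (Hh k) (Hh k)))) as (E & HE).
  destruct (vec_cauchy_rate E (fun k => (2 * K + 2) / INR (S k))) as (V & HV).
  { apply inv_succ_cv. }
  { intros k l Hkl. replace ((2 * K + 2) / INR (S k)) with ((2 * K + 2) * h k) by reflexivity.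
    pose proof (Hh k). pose proof (Hh l). pose proof (Hh1 k). pose proof (Hhm k l Hkl).
    set (u := s + h k).
    assert (Hu : u - s = h k) by (unfold u; ring).
    assert (Hu1 : Rabs (u - s) <= 1) by (rewrite Hu, Rabs_pos_eq; lra).
    pose proof (proj2 (HE k) u Hu1) as Ek. pose proof (proj2 (HE l) u Hu1) as El.
    rewrite Hu in *.
    apply (Rmult_le_reg_l (h k)); auto.
    rewrite <- (Rabs_pos_eq (h k)) at 1 by lra. rewrite <- vnorm_scal.
    replace (h k [*] (E k [-] E l)) with
      ((g u [-] g s [-] h k [*] E l) [-] (g u [-] g s [-] h k [*] E k)) by vring.
    eapply Rle_trans; [apply vnorm_sub|].
    assert (h l * h l <= h k * h k) by nra. nra. }
  assert (HV0 : forall eps, 0 < eps -> exists k, vnorm (E k [-] V) <= eps /\ h k * h k <= eps).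
  { intros eps Heps. destruct (inv_succ_cv (2 * (2 * K + 2)) eps Heps) as (k & Hk).
    specialize (Hk k (Nat.le_refl _)). unfold Rdist in Hk. rewrite Rminus_0_r in Hk.
    exists k. pose proof (Hh k). pose proof (Hh1 k).
    apply Rabs_def2 in Hk. replace (2 * (2 * K + 2) / INR (S k)) with (2 * (2 * K + 2) * h k) in Hk by reflexivity.
    specialize (HV k). replace ((2 * K + 2) / INR (S k)) with ((2 * K + 2) * h k) in HV by reflexivity.
    split; nra. }
  exists V. split.
  - apply Rle_antisym; apply le_epsilon; intros eps Heps; destruct (HV0 eps Heps) as (k & Hk & _).
    + pose proof (vnorm_sub_ge V (E k)). rewrite vnorm_sub_sym in Hk.
      rewrite (proj1 (HE k)) in H0. lra.
    + pose proof (vnorm_sub_ge (E k) V). rewrite (proj1 (HE k)) in H0. lra.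
  - intros u Hu. apply le_epsilon. intros eps Heps.
    destruct (HV0 (eps / 2) ltac:(lra)) as (k & Hk & Hk2).
    pose proof (proj2 (HE k) u Hu).
    replace (g u [-] g s [-] (u - s) [*] V) with
      ((g u [-] g s [-] (u - s) [*] E k) [+] (u - s) [*] (E k [-] V)) by vring.
    eapply Rle_trans; [apply vnorm_add|]. rewrite vnorm_scal.
    pose proof (vnorm_nonneg (E k [-] V)). pose proof (Rabs_pos (u - s)). nra.
Qed.

(** Both vectors predict the increment of g from s to s + h. The bound is used with eps = h^2, where
    it is of order h. *)
Lemma unit_close g s K e V eps h : 0 < h -> h <= 1 ->
  (forall u, Rabs (u - s) <= 1 -> vnorm (g u [-] g s [-] (u - s) [*] e) <= K * (u - s) ^ 2 + eps) ->
  (forall u, Rabs (u - s) <= 1 -> vnorm (g u [-] g s [-] (u - s) [*] V) <= K * (u - s) ^ 2) ->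
  vnorm (e [-] V) <= 2 * K * h + eps / h.
Proof.
  intros Hh Hh1 H1 H2. set (u := s + h).
  assert (Hu : u - s = h) by (unfold u; ring).
  assert (Hu1 : Rabs (u - s) <= 1) by (rewrite Hu, Rabs_pos_eq; lra).
  specialize (H1 u Hu1). specialize (H2 u Hu1). rewrite Hu in *.
  apply (Rmult_le_reg_l h); auto.
  rewrite <- (Rabs_pos_eq h) at 1 by lra. rewrite <- vnorm_scal.
  replace (h [*] (e [-] V)) with
      ((g u [-] g s [-] h [*] V) [-] (g u [-] g s [-] h [*] e)) by vring.
  eapply Rle_trans; [apply vnorm_sub|].
  replace (h * (2 * K * h + eps / h)) with (2 * K * h ^ 2 + eps) by (field; lra). lra.
Qed.

Lemma periodic_Z g : periodic1 g -> forall k t, g (t + IZR k) = g t.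
Proof.
  intros H.
  assert (Hn : forall n t, g (t + INR n) = g t).
  { induction n as [|n IH]; intros t; [f_equal; simpl; ring|].
    rewrite S_INR. replace (t + (INR n + 1)) with (t + INR n + 1) by ring. rewrite H. apply IH. }
  intros k t. destruct (Z_le_gt_dec 0 k) as [h|h].
  - rewrite <- (Z2Nat.id k h), <- INR_IZR_INZ. apply Hn.
  - rewrite <- (Hn (Z.to_nat (- k)) (t + IZR k)). f_equal.
    rewrite INR_IZR_INZ, Z2Nat.id by lia. rewrite opp_IZR. ring.
Qed.

Lemma frac_exists t : exists k u, t = IZR k + u /\ 0 <= u < 1.
Proof.
  exists (Int_part t), (frac_part t). pose proof (base_fp t). unfold frac_part in *.
  split; [ring|]. lra.
Qed.

Definition lipschitz (L : R) (g : curve) : Prop := forall s t, vnorm (g s [-] g t) <= L * Rabs (s - t).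

Lemma lip_continuity_pt (f : R -> R) L x : (forall s t, Rabs (f s - f t) <= L * Rabs (s - t)) -> continuity_pt f x.
Proof.
  intros H eps Heps. pose proof (Rabs_pos L). pose proof (Rle_abs L).
  exists (eps / (Rabs L + 1)). split; [apply Rdiv_lt_0_compat; lra|].
  intros y [_ Hy]. simpl in *. unfold Rdist in *.
  eapply Rle_lt_trans; [apply H|].
  apply Rle_lt_trans with ((Rabs L + 1) * Rabs (y - x)).
  - apply Rmult_le_compat_r; [apply Rabs_pos | lra].
  - replace eps with ((Rabs L + 1) * (eps / (Rabs L + 1))) by (field; lra).
    apply Rmult_lt_compat_l; lra.
Qed.

Lemma lipschitz_of_le L g : (forall a b, a <= b -> vnorm (g b [-] g a) <= L * (b - a)) -> lipschitz L g.
Proof.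
  intros H s t. destruct (Rle_lt_dec t s).
  - rewrite Rabs_pos_eq by lra. auto.
  - rewrite Rabs_left, vnorm_sub_sym by lra. replace (- (s - t)) with (t - s) by ring. apply H. lra.
Qed.

Lemma vnorm_sub_lip a b a' b' : Rabs (vnorm (a [-] b) - vnorm (a' [-] b')) <= vnorm (a [-] a') + vnorm (b [-] b').
Proof.
  pose proof (vnorm_sub3 a a' b). pose proof (vnorm_sub3 a' b' b). pose proof (vnorm_sub3 a' a b').
  pose proof (vnorm_sub3 a b b'). rewrite (vnorm_sub_sym a' a) in *. rewrite (vnorm_sub_sym b' b) in *.
  apply Rabs_le. lra.
Qed.

Lemma lip_nonneg L g : lipschitz L g -> 0 <= L.
Proof.
  intros H. pose proof (H 1 0). pose proof (vnorm_nonneg (g 1 [-] g 0)).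
  rewrite Rabs_pos_eq in H0 by lra. lra.
Qed.

(* Compactness of the torus S_1 x [a, b], in two one-dimensional steps. *)
Lemma min_chord (g : curve) L a b : periodic1 g -> lipschitz L g -> a <= b ->
  exists s h, a <= h <= b /\ forall s' h', a <= h' <= b ->
    vnorm (g (s + h) [-] g s) <= vnorm (g (s' + h') [-] g s').
Proof.
  intros Hp HL Hab. set (f := fun s h => vnorm (g (s + h) [-] g s)).
  pose proof (lip_nonneg _ _ HL) as HL0.
  assert (Hex : forall s, exists m, a <= m <= b /\ forall h, a <= h <= b -> f s m <= f s h).
  { intros s.
    destruct (continuity_ab_min (f s) a b Hab) as (m & Hm1 & Hm2).
    - intros c _. apply lip_continuity_pt with L. intros x y. unfold f.
      eapply Rle_trans; [apply vnorm_sub_lip|]. rewrite vsub_self, vnorm_zero.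
      specialize (HL (s + x) (s + y)). replace (s + x - (s + y)) with (x - y) in HL by ring. lra.
    - exists m. auto. }
  destruct (choose_fun _ Hex) as (hm & Hm).
  destruct (continuity_ab_min (fun s => f s (hm s)) 0 1 ltac:(lra)) as (s0 & Hs1 & Hs2).
  - intros c _. apply lip_continuity_pt with (2 * L).
    assert (G : forall s t, f s (hm s) - f t (hm t) <= 2 * L * Rabs (s - t)).
    { intros s t. pose proof (proj2 (Hm s) (hm t) (proj1 (Hm t))).
      assert (Rabs (f s (hm t) - f t (hm t)) <= 2 * L * Rabs (s - t)).
      { unfold f. eapply Rle_trans; [apply vnorm_sub_lip|].
        pose proof (HL (s + hm t) (t + hm t)). replace (s + hm t - (t + hm t)) with (s - t) in * by ring.
        pose proof (HL s t). lra. }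
      apply Rabs_le_inv in H0. lra. }
    intros s t. apply Rabs_le. pose proof (G s t). pose proof (G t s).
    rewrite (Rabs_minus_sym t s) in H0. lra.
  - exists s0, (hm s0). split; [apply Hm|]. intros s' h' Hh'.
    destruct (frac_exists s') as (k & u & -> & Hu).
    replace (IZR k + u + h') with (u + h' + IZR k) by ring. rewrite (Rplus_comm (IZR k) u).
    rewrite !periodic_Z by auto.
    eapply Rle_trans; [apply (Hs1 u); lra|]. apply (Hm u); auto.
Qed.

(** * Curves of bounded turning *)

(** The angle is bounded rather than |T s - T u|, since comparison with a circle of radius 1/c needs
    the sharp spherical distance. This replaces a bound c on the curvature. *)
Definition turning (g : curve) (T : R -> V3) (c : R) : Prop :=
  (forall s, has_deriv g s (T s)) /\ (forall s, vnorm (T s) = 1) /\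
  (forall s u, ang (T s) (T u) <= c * Rabs (s - u)).

Lemma derivable_incr (f f' : R -> R) a b : a <= b ->
  (forall t, a <= t <= b -> derivable_pt_lim f t (f' t)) ->
  (forall t, a <= t <= b -> 0 <= f' t) -> f a <= f b.
Proof.
  intros [Hab| ->] Hd Hp; [|lra].
  destruct (MVT_cor2 f f' a b Hab Hd) as (t & E & Ht). specialize (Hp t ltac:(lra)). nra.
Qed.

Lemma derivable_sin_affine c m u : derivable_pt_lim (fun u => sin (c * (u - m))) u (c * cos (c * (u - m))).
Proof.
  rewrite Rmult_comm.
  apply (derivable_pt_lim_comp (fun u => c * (u - m)) sin); [|apply derivable_pt_lim_sin].
  assert (H : derivable_pt_lim (fun u => c * (u - m)) u (c * (1 - 0))).
  { apply (derivable_pt_lim_scal (fun u => u - m)).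
    apply (derivable_pt_lim_minus (fun u => u) (fun _ => m)).
    - apply derivable_pt_lim_id.
    - apply derivable_pt_lim_const. }
  replace (c * (1 - 0)) with c in H by ring. exact H.
Qed.

(** The chord is projected onto the tangent at the midpoint m. The projected speed at u is at least
    cos(c|u - m|), because c|u - m| is at most PI, and integrating this gives the chord of the
    circle of radius 1/c. *)
Lemma chord_lower g T c s h : turning g T c -> 0 < c -> 0 <= h -> c * h <= 2 * PI ->
  2 * sin (c * h / 2) <= c * vnorm (g (s + h) [-] g s).
Proof.
  intros (HT & H1 & Ha) Hc Hh Hch. set (m := s + h / 2).
  assert (Hmono : c * dot (g s) (T m) - sin (c * (s - m))
                  <= c * dot (g (s + h)) (T m) - sin (c * (s + h - m))).
  { apply (derivable_incr (fun u => c * dot (g u) (T m) - sin (c * (u - m)))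
             (fun u => c * dot (T u) (T m) - c * cos (c * (u - m)))); [lra| |].
    - intros t _.
      apply (derivable_pt_lim_minus (fun u => c * dot (g u) (T m)) (fun u => sin (c * (u - m)))).
      + apply (derivable_pt_lim_scal (fun u => dot (g u) (T m))). now apply has_deriv_dot.
      + apply derivable_sin_affine.
    - intros t Ht.
      assert (Rabs (t - m) <= h / 2) by (apply Rabs_le; unfold m; lra).
      assert (E : cos (c * (t - m)) = cos (c * Rabs (t - m))).
      { unfold Rabs; destruct (Rcase_abs (t - m)); auto.
        rewrite Ropp_mult_distr_r_reverse, cos_neg. auto. }
      rewrite E. assert (cos (c * Rabs (t - m)) <= dot (T t) (T m)); [|nra].
      apply ang_le_cos; auto. nra. }
  replace (c * (s - m)) with (- (c * h / 2)) in Hmono by (unfold m; field).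
  replace (c * (s + h - m)) with (c * h / 2) in Hmono by (unfold m; field).
  rewrite sin_neg in Hmono.
  pose proof (dot_le (g (s + h) [-] g s) (T m)) as Hd. rewrite H1, Rmult_1_r in Hd.
  rewrite dot_subl in Hd. nra.
Qed.

(** Let x, y be the angles of a, b with t, and w the angle between a and b. Then |a + b| = 2
    cos(w/2) and <t, a + b> = 2 cos((x+y)/2) cos((x-y)/2), and the triangle inequality gives |x - y|
    <= w. *)
Lemma cone_pair t a b A B h : vnorm t = 1 -> vnorm a = 1 -> vnorm b = 1 ->
  ang t a <= A -> ang t b <= B -> A + B <= 2 * h -> h <= PI / 2 ->
  cos h * vnorm (a [+] b) <= dot t (a [+] b).
Proof.
  intros Ht Ha Hb HA HB Hs Hh.
  pose proof (ang_bound t a). pose proof (ang_bound t b). pose proof (ang_bound a b).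
  pose proof (ang_triangle t a b Ht Ha Hb). pose proof (ang_triangle t b a Ht Hb Ha).
  rewrite (ang_sym b a) in *.
  dots. rewrite <- (cos_ang t a), <- (cos_ang t b) by auto.
  set (x := ang t a) in *. set (y := ang t b) in *. set (w := ang a b) in *.
  assert (E : vnorm (a [+] b) = 2 * cos (w / 2)).
  { pose proof (cos_ge_0 (w / 2) ltac:(lra) ltac:(lra)).
    apply vnorm_eq; [lra|]. dots. rewrite (dot_sym b a), !unit_dot by auto.
    rewrite <- (cos_ang a b) by auto. fold w.
    replace w with (2 * (w / 2)) at 1 2 by field. rewrite cos_2a_cos. ring. }
  rewrite E.
  replace x with ((x + y) / 2 + (x - y) / 2) by field.
  replace y with ((x + y) / 2 - (x - y) / 2) at 3 by field.
  rewrite cos_plus, cos_minus.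
  assert (cos (w / 2) <= cos ((x - y) / 2)).
  { assert (cos ((x - y) / 2) = cos (Rabs (x - y) / 2)) as ->.
    { unfold Rabs; destruct (Rcase_abs (x - y)); auto.
      rewrite <- cos_neg. f_equal. field. }
    assert (Rabs (x - y) <= w) by (apply Rabs_le; lra). pose proof (Rabs_pos (x - y)).
    apply cos_decr_1; lra. }
  assert (cos h <= cos ((x + y) / 2)) by (apply cos_decr_1; lra).
  assert (0 <= cos h) by (apply cos_ge_0; lra).
  assert (0 <= cos (w / 2)) by (apply cos_ge_0; lra).
  nra.
Qed.

Lemma has_deriv_refl_shift g m x V : has_deriv g (m - x) V ->
  has_deriv (fun x => g (m - x)) x ((-1) [*] V).
Proof.
  assert (G : forall phi l, derivable_pt_lim phi (m - x) l ->
     derivable_pt_lim (fun x => phi (m - x)) x (-1 * l)).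
  { intros phi l H. rewrite Rmult_comm. apply (derivable_pt_lim_comp (fun x => m - x) phi); auto.
    replace (-1) with (0 - 1) by ring.
    apply (derivable_pt_lim_minus (fun _ => m) (fun x => x)); [apply derivable_pt_lim_const | apply derivable_pt_lim_id]. }
  intros (a1 & a2 & a3). exact (conj (G _ _ a1) (conj (G _ _ a2) (G _ _ a3))).
Qed.

(* Writing the chord as the integral of T(m + x) + T(m - x) around the midpoint m, each pair
   lies in the convex cone of half-angle c h / 2 about T(s), although T(m + x) need not. *)
Lemma chord_cone g T c s h : turning g T c -> 0 < c -> 0 <= h -> c * h <= PI ->
  cos (c * h / 2) * vnorm (g (s + h) [-] g s) <= dot (T s) (g (s + h) [-] g s).
Proof.
  intros (HT & H1 & Ha) Hc Hh Hch.
  destruct (excluded_middle_informative (g (s + h) [-] g s = vzero)) as [E|E].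
  { rewrite E, vnorm_zero. right. vring. }
  destruct (vnorm_dual _ E) as (e & He & Hde & _).
  set (m := s + h / 2). set (k := cos (c * h / 2)) in *.
  set (w := T s [-] k [*] e).
  assert (Hk : 0 <= k) by (apply cos_ge_0; [pose proof PI_RGT_0; nra | lra]).
  assert (Hmono : dot (g (m + 0)) w - dot (g (m - 0)) w
                  <= dot (g (m + h / 2)) w - dot (g (m - h / 2)) w).
  { apply (derivable_incr (fun x => dot (g (m + x)) w - dot (g (m - x)) w)
             (fun x => dot (T (m + x)) w - dot ((-1) [*] T (m - x)) w)); [lra| |].
    - intros t _.
      apply (derivable_pt_lim_minus (fun x => dot (g (m + x)) w) (fun x => dot (g (m - x)) w)).
      + apply (has_deriv_dot (fun x => g (m + x))).
        apply has_deriv_ext with (fun x => g (x + m)); [intros; f_equal; ring|].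
        rewrite (Rplus_comm m t). apply has_deriv_shift, HT.
      + apply (has_deriv_dot (fun x => g (m - x))). apply has_deriv_refl_shift, HT.
    - intros x Hx.
      assert (P : k * vnorm (T (m + x) [+] T (m - x)) <= dot (T s) (T (m + x) [+] T (m - x))).
      { apply cone_pair with (c * (h / 2 + x)) (c * (h / 2 - x)); auto; try lra.
        - eapply Rle_trans; [apply Ha|]. right. f_equal. rewrite Rabs_left1; unfold m; lra.
        - eapply Rle_trans; [apply Ha|]. right. f_equal. rewrite Rabs_left1; unfold m; lra. }
      pose proof (dot_le (T (m + x) [+] T (m - x)) e) as P2. rewrite He, Rmult_1_r in P2.
      unfold w. revert P P2. dots. rewrite !(dot_sym (T s)). intros. nra. }
  replace (m + h / 2) with (s + h) in Hmono by (unfold m; field).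
  replace (m - h / 2) with s in Hmono by (unfold m; field).
  rewrite Rplus_0_r, Rminus_0_r in Hmono.
  rewrite <- Hde. unfold w in Hmono. revert Hmono. dots. rewrite !(dot_sym (T s)). lra.
Qed.

Lemma ang_opp u v : ang ((-1) [*] u) ((-1) [*] v) = ang u v.
Proof. unfold ang. f_equal. vring. Qed.

Lemma turning_rev g T c : turning g T c -> turning (fun t => g (0 - t)) (fun t => (-1) [*] T (0 - t)) c.
Proof.
  intros (HT & H1 & Ha). split; [|split].
  - intros s. apply has_deriv_refl_shift, HT.
  - intros s. rewrite vnorm_scal, H1, Rabs_left by lra. ring.
  - intros s u. rewrite ang_opp. eapply Rle_trans; [apply Ha|].
    right. f_equal. rewrite Rabs_minus_sym. f_equal. ring.
Qed.

Lemma chord_cone_back g T c s h : turning g T c -> 0 < c -> 0 <= h -> c * h <= PI ->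
  cos (c * h / 2) * vnorm (g s [-] g (s - h)) <= dot (T s) (g s [-] g (s - h)).
Proof.
  intros HT Hc Hh Hch.
  pose proof (chord_cone _ _ c (- s) h (turning_rev _ _ _ HT) Hc Hh Hch) as H. simpl in H.
  replace (0 - (- s + h)) with (s - h) in H by ring. replace (0 - - s) with s in H by ring.
  rewrite vnorm_sub_sym. eapply Rle_trans; [apply H|]. right.
  vring.
Qed.

(** Over a full period the chord is zero, which [chord_lower] forbids if c < 2 PI. *)
Lemma fenchel g T c : turning g T c -> 0 < c -> periodic1 g -> 2 * PI <= c.
Proof.
  intros HT Hc Hp. destruct (Rle_lt_dec (2 * PI) c) as [h|h]; auto. exfalso.
  pose proof (chord_lower g T c 0 1 HT Hc ltac:(lra) ltac:(lra)) as H.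
  rewrite Hp, vsub_self, vnorm_zero in H.
  pose proof (sin_gt_0 (c * 1 / 2) ltac:(lra) ltac:(lra)). lra.
Qed.

(** * Triangles of small circumradius *)

Lemma cos_inj_0_PI x y : 0 <= x <= PI -> 0 <= y <= PI -> cos x = cos y -> x = y.
Proof.
  intros Hx Hy E. apply Rle_antisym; apply cos_decr_0; lra.
Qed.

Lemma vangle p q : 0 < gram p q -> exists A, 0 < A < PI /\
  cos A * (vnorm p * vnorm q) = dot p q /\ sin A * (vnorm p * vnorm q) = sqrt (gram p q).
Proof.
  intros Hg. pose proof (vnorm_nonneg p). pose proof (vnorm_nonneg q).
  pose proof (vnorm_sq p). pose proof (vnorm_sq q).
  assert (Hpq : gram p q = (vnorm p * vnorm q) * (vnorm p * vnorm q) - dot p q * dot p q).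
  { unfold gram. rewrite <- H1, <- H2. ring. }
  assert (0 <= vnorm p * vnorm q) by nra.
  set (n := vnorm p * vnorm q) in *.
  assert (0 < n) by nra.
  pose proof (dot_abs_le p q) as Hd. fold n in Hd. apply Rabs_le_inv in Hd.
  assert (Hd' : -1 < dot p q / n < 1).
  { split; apply (Rmult_lt_reg_r n); auto; unfold Rdiv; rewrite Rmult_assoc, Rinv_l by lra; nra. }
  exists (acos (dot p q / n)).
  assert (Hc : cos (acos (dot p q / n)) * n = dot p q).
  { rewrite cos_acos by lra. field. lra. }
  split; [|split]; auto.
  - apply acos_bound_lt. lra.
  - symmetry. apply sqrt_lem_1; [lra| |].
    + apply Rmult_le_pos; [|lra]. apply sin_ge_0; apply acos_bound.
    + rewrite Hpq. pose proof (sin2_cos2 (acos (dot p q / n))) as E. unfold Rsqr in E.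
      set (S := sin _) in *. set (C := cos _) in *. rewrite <- Hc.
      transitivity ((S * S + C * C) * (n * n) - C * n * (C * n)); [ring | rewrite E; ring].
Qed.

(** B is the angle at the origin, A the one at the tip of u, C the one at the tip of v, so A lies
    opposite v and C opposite u. The sum is obtained from cos(A + C) = - cos B and sin(A + C) = sin
    B; positivity of the latter excludes A + C >= PI. *)
Lemma triangle_angles u v : 0 < gram u v -> exists A B C,
  0 < A < PI /\ 0 < B < PI /\ 0 < C < PI /\ A + B + C = PI /\
  cos B * (vnorm u * vnorm v) = dot u v /\
  sin A * (vnorm u * vnorm (v [-] u)) = sqrt (gram u v) /\
  sin B * (vnorm u * vnorm v) = sqrt (gram u v) /\
  sin C * (vnorm v * vnorm (v [-] u)) = sqrt (gram u v).
Proof.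
  intros Hg.
  assert (GA : gram ((-1) [*] u) (v [-] u) = gram u v) by (unfold gram; vring).
  assert (GC : gram ((-1) [*] v) (u [-] v) = gram u v) by (unfold gram; vring).
  destruct (vangle u v Hg) as (B & HB & CB & SB).
  destruct (vangle ((-1) [*] u) (v [-] u) ltac:(lra)) as (A & HA & CA & SA).
  destruct (vangle ((-1) [*] v) (u [-] v) ltac:(lra)) as (C & HC & CC & SC).
  rewrite GA in SA. rewrite GC in SC.
  rewrite vnorm_scal, Rabs_left in CA, SA by lra. rewrite vnorm_scal, Rabs_left in CC, SC by lra.
  rewrite (vnorm_sub_sym u v) in CC, SC.
  exists A, B, C. 
  pose proof (vnorm_nonneg u) as Pu. pose proof (vnorm_nonneg v) as Pv.
  pose proof (vnorm_nonneg (v [-] u)) as Pw.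
  pose proof (vnorm_sq u) as Su. pose proof (vnorm_sq v) as Sv. pose proof (vnorm_sq (v [-] u)) as Sw.
  assert (Hs : 0 < sqrt (gram u v)) by (now apply sqrt_lt_R0).
  assert (Hss : sqrt (gram u v) * sqrt (gram u v) = gram u v) by (apply sqrt_sqrt; lra).
  unfold gram in Hss at 3. revert CA CC Sw. dots. rewrite (dot_sym v u). intros CA CC Sw.
  set (a := vnorm u) in *. set (b := vnorm v) in *. set (w := vnorm (v [-] u)) in *.
  set (S := sqrt (gram u v)) in *.
  set (U := dot u u) in *. set (V := dot v v) in *. set (G := dot u v) in *.
  assert (0 < a * b). { destruct (Rle_lt_dec (a * b) 0); [|auto]. pose proof (SIN_bound B). nra. }
  assert (0 < a) by nra. assert (0 < b) by nra.
  assert (0 < w). { destruct (Rle_lt_dec w 0); [|auto]. replace w with 0 in SA by lra. lra. }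
  set (N := a * b * w * w).
  assert (0 < a * b * w * w) by (repeat apply Rmult_lt_0_compat; auto).
  assert (E1 : cos (A + C) = - cos B).
  { apply (Rmult_eq_reg_r N); [|unfold N; lra]. rewrite cos_plus.
    replace ((cos A * cos C - sin A * sin C) * N) with
      ((cos A * (- -1 * a * w)) * (cos C * (- -1 * b * w)) - (sin A * (- -1 * a * w)) * (sin C * (- -1 * b * w)))
      by (unfold N; ring).
    rewrite CA, CC, SA, SC.
    replace (- cos B * N) with (- (cos B * (a * b)) * (w * w)) by (unfold N; ring).
    rewrite CB, Sw, Hss. ring. }
  assert (E2 : sin (A + C) = sin B).
  { apply (Rmult_eq_reg_r N); [|unfold N; lra]. rewrite sin_plus.
    replace ((sin A * cos C + cos A * sin C) * N) with
      ((sin A * (- -1 * a * w)) * (cos C * (- -1 * b * w)) + (cos A * (- -1 * a * w)) * (sin C * (- -1 * b * w)))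
      by (unfold N; ring).
    rewrite CA, CC, SA, SC.
    replace (sin B * N) with ((sin B * (a * b)) * (w * w)) by (unfold N; ring).
    rewrite SB, Sw. ring. }
  assert (0 < sin B) by (apply sin_gt_0; lra).
  assert (Hlt : A + C < PI).
  { destruct (Rlt_le_dec (A + C) PI) as [h|h]; auto.
    pose proof (sin_le_0 (A + C) h ltac:(lra)). lra. }
  assert (A + C = PI - B).
  { apply cos_inj_0_PI; try lra. rewrite E1, Rtrigo_facts.cos_pi_minus. auto. }
  repeat split; try lra.
Qed.

Definition wide (D : R) (x y z : V3) : Prop :=
  4 * D * D * gram (x [-] y) (z [-] y) <= sides (x [-] y) (z [-] y).

Lemma wide_swap D x y z : wide D x y z -> wide D z y x.
Proof. unfold wide. rewrite gram_swap, sides_swap. auto. Qed.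

Lemma wide_rot D x y z : wide D x y z -> wide D y x z.
Proof. unfold wide. rewrite gram_cycle, sides_cycle. auto. Qed.

Ltac wide_perm H := first [exact H | apply wide_swap; exact H | apply wide_rot; exact H
  | apply wide_swap, wide_rot; exact H | apply wide_rot, wide_swap; exact H
  | apply wide_swap, wide_rot, wide_swap; exact H].

(** No side of a triangle is longer than the diameter of its circumcircle. *)
Lemma wide_long_side D x y z : 0 <= D -> 2 * D <= vnorm (x [-] z) -> wide D x y z.
Proof.
  intros HD H. unfold wide, gram, sides.
  set (u := x [-] y) in *. set (v := z [-] y) in *.
  replace (x [-] z) with (u [-] v) in H by (unfold u, v; vring).
  pose proof (vnorm_sq (u [-] v)). pose proof (dot_nonneg u). pose proof (dot_nonneg v).
  pose proof (Rle_0_sqr (dot u v)). unfold Rsqr in *.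
  assert (0 <= dot u u * dot v v) by nra.
  assert (4 * D * D <= dot (u [-] v) (u [-] v)) by nra. nra.
Qed.

(* [p] is the product of the sides adjacent to the angle [A] and [S] is twice the area,
   so a p / (2 S) is the circumradius. *)
Lemma narrow_angle D A a p S alpha : 0 < D -> 0 < A < PI -> 0 <= a -> 0 < p -> sin A * p = S ->
  a * p < 2 * D * S -> 0 <= alpha <= PI / 2 -> 2 * D * sin alpha <= a -> alpha < A.
Proof.
  intros HD HA Ha Hp HS Hlt Hal Hch.
  destruct (Rlt_le_dec alpha A) as [h|h]; auto. exfalso.
  assert (sin A <= sin alpha) by (apply sin_incr_1; lra).
  assert (2 * D * sin A <= a) by nra.
  assert (2 * D * sin A * p <= a * p) by (apply Rmult_le_compat_r; lra).
  subst S. nra.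
Qed.

Section Triples.
Variables (g : curve) (T : R -> V3) (D : R).
Hypotheses (HT : turning g T (/ D)) (HD : 0 < D).

Lemma chord_lower_D s h : 0 <= h <= 2 * PI * D ->
  2 * D * sin (h / (2 * D)) <= vnorm (g (s + h) [-] g s).
Proof.
  intros Hh. assert (Hc : 0 < / D) by (now apply Rinv_0_lt_compat).
  pose proof (chord_lower g T (/ D) s h HT Hc ltac:(lra)) as H.
  replace (/ D * h / 2) with (h / (2 * D)) in H by (field; lra).
  apply (Rmult_le_reg_l (/ D)); auto.
  replace (/ D * (2 * D * sin (h / (2 * D)))) with (2 * sin (h / (2 * D))) by (field; lra).
  apply H. apply (Rmult_le_reg_l D); auto. rewrite <- Rmult_assoc, Rinv_r by lra. lra.
Qed.

Lemma half_angle_bound h : 0 <= h <= PI * D -> 0 <= h / (2 * D) <= PI / 2.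
Proof.
  intros Hh. split.
  - apply Rmult_le_pos; [lra|]. left. apply Rinv_0_lt_compat. lra.
  - apply (Rmult_le_reg_r (2 * D)); [lra|]. unfold Rdiv at 1. rewrite Rmult_assoc, Rinv_l by lra. lra.
Qed.

Lemma narrow_sides u v : 0 < gram u v -> ~ (4 * D * D * gram u v <= sides u v) ->
  let a := vnorm u in let b := vnorm v in let w := vnorm (v [-] u) in
  0 < a /\ 0 < b /\ 0 < w /\ a * b * w < 2 * D * sqrt (gram u v).
Proof.
  intros Hg Hn a b w.
  assert (Hs : 0 < sqrt (gram u v)) by (now apply sqrt_lt_R0).
  assert (Hss : sqrt (gram u v) * sqrt (gram u v) = gram u v) by (apply sqrt_sqrt; lra).
  destruct (triangle_angles u v Hg) as (A & B & C & _ & _ & _ & _ & _ & HA & HB & HC).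
  fold a b w in HA, HB, HC.
  assert (Pa : 0 < a) by (destruct (vnorm_nonneg u) as [h|h]; auto; unfold a in *; rewrite <- h in *; lra).
  assert (Pb : 0 < b) by (destruct (vnorm_nonneg v) as [h|h]; auto; unfold b in *; rewrite <- h in *; lra).
  assert (Pw : 0 < w) by (destruct (vnorm_nonneg (v [-] u)) as [h|h]; auto; unfold w in *; rewrite <- h in *; lra).
  repeat split; auto.
  assert (Esd : sides u v = (a * b * w) * (a * b * w)).
  { unfold sides, a, b, w. replace (dot (u [-] v) (u [-] v)) with (dot (v [-] u) (v [-] u)) by vring.
    rewrite <- !vnorm_sq. ring. }
  rewrite Esd, <- Hss in Hn.
  apply Rnot_le_lt in Hn.
  destruct (Rlt_le_dec (a * b * w) (2 * D * sqrt (gram u v))) as [h|h]; auto. exfalso.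
  assert (0 <= 2 * D * sqrt (gram u v)) by nra. nra.
Qed.

Lemma wide_local s1 s2 s3 : s1 < s2 -> s2 < s3 -> s3 - s1 <= PI * D -> wide D (g s1) (g s2) (g s3).
Proof.
  intros H12 H23 H13. unfold wide. set (u := g s1 [-] g s2). set (v := g s3 [-] g s2).
  destruct (gram_nonneg u v) as [Hg|Hg]; fold (gram u v) in Hg.
  2: { rewrite <- Hg. unfold sides. rewrite Rmult_0_r. repeat apply Rmult_le_pos; apply dot_nonneg. }
  apply NNPP. intros Hn.
  destruct (narrow_sides u v Hg Hn) as (Pa & Pb & Pw & Hlt).
  destruct (triangle_angles u v Hg) as (A & B & C & HA & HB & HC & Hsum & CB & SA & SB & SC).
  set (al := (s2 - s1) / (2 * D)). set (be := (s3 - s2) / (2 * D)).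
  pose proof (half_angle_bound (s2 - s1) ltac:(lra)) as Ba. fold al in Ba.
  pose proof (half_angle_bound (s3 - s2) ltac:(lra)) as Bb. fold be in Bb.
  (* C lies opposite the side u, whose length is at least the chord of the arc s2 - s1 on a circle
     of radius D; A lies opposite v in the same way. *)
  assert (HalC : al < C).
  { apply (narrow_angle D C (vnorm u) (vnorm v * vnorm (v [-] u)) (sqrt (gram u v))); auto; try nra.
    pose proof (chord_lower_D s1 (s2 - s1) ltac:(pose proof PI_RGT_0; nra)) as Hc.
    replace (s1 + (s2 - s1)) with s2 in Hc by ring. unfold u. rewrite vnorm_sub_sym. exact Hc. }
  assert (HbeA : be < A).
  { apply (narrow_angle D A (vnorm v) (vnorm u * vnorm (v [-] u)) (sqrt (gram u v))); auto; try nra.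
    pose proof (chord_lower_D s2 (s3 - s2) ltac:(pose proof PI_RGT_0; nra)) as Hc.
    replace (s2 + (s3 - s2)) with s3 in Hc by ring. exact Hc. }
  assert (Hab : al + be <= PI / 2).
  { replace (al + be) with ((s3 - s1) / (2 * D)) by (unfold al, be; field; lra).
    apply half_angle_bound; lra. }
  destruct HT as (_ & H1 & _).
  assert (Hc : 0 < / D) by (now apply Rinv_0_lt_compat).
  assert (Hcd : forall h, h <= PI * D -> / D * h <= PI).
  { intros h Hh. apply (Rmult_le_reg_l D); auto. rewrite <- Rmult_assoc, Rinv_r by lra. lra. }
  pose proof (chord_cone g T (/ D) s2 (s3 - s2) HT Hc ltac:(lra) (Hcd (s3 - s2) ltac:(lra))) as K1.
  pose proof (chord_cone_back g T (/ D) s2 (s2 - s1) HT Hc ltac:(lra) (Hcd (s2 - s1) ltac:(lra))) as K2.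
  replace (s2 + (s3 - s2)) with s3 in K1 by ring. replace (s2 - (s2 - s1)) with s1 in K2 by ring.
  replace (/ D * (s3 - s2) / 2) with be in K1 by (unfold be; field; lra).
  replace (/ D * (s2 - s1) / 2) with al in K2 by (unfold al; field; lra).
  fold v in K1. rewrite vnorm_sub_sym in K2. fold u in K2.
  replace (g s2 [-] g s1) with ((-1) [*] u) in K2 by (unfold u; vring).
  set (a := vnorm u) in *. set (b := vnorm v) in *.
  (* Unit chords arriving at and leaving the middle point. By the cone estimates they make angles at
     most al and be with the tangent there. *)
  set (eu := (- / a) [*] u). set (ev := (/ b) [*] v).
  assert (Nu : vnorm eu = 1).
  { unfold eu. rewrite vnorm_scal, Rabs_Ropp, Rabs_pos_eq by (left; now apply Rinv_0_lt_compat).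
    fold a. field. lra. }
  assert (Nv : vnorm ev = 1).
  { unfold ev. rewrite vnorm_scal, Rabs_pos_eq by (left; now apply Rinv_0_lt_compat).
    fold b. field. lra. }
  assert (L1 : ang (T s2) ev <= be).
  { apply ang_le; auto; [lra|]. unfold ev. dots. apply (Rmult_le_reg_r b); auto.
    replace (/ b * dot (T s2) v * b) with (dot (T s2) v) by (field; lra). exact K1. }
  assert (L2 : ang (T s2) eu <= al).
  { apply ang_le; auto; [lra|]. unfold eu. dots. apply (Rmult_le_reg_r a); auto.
    replace (- / a * dot (T s2) u * a) with (- dot (T s2) u) by (field; lra).
    revert K2. dots. lra. }
  (* The exterior angle PI - B = A + C is therefore at most al + be, which is less than C + A. *)
  pose proof (ang_triangle eu (T s2) ev Nu (H1 s2) Nv) as L3.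
  rewrite (ang_sym eu (T s2)) in L3.
  assert (E : dot eu ev = - cos B).
  { unfold eu, ev. dots. rewrite <- CB. field. lra. }
  assert (ang eu ev = PI - B).
  { apply cos_inj_0_PI; [apply ang_bound | lra|]. rewrite cos_ang, E, Rtrigo_facts.cos_pi_minus by auto. auto. }
  lra.
Qed.

Lemma wide_winding s1 s2 s3 : periodic1 g -> s1 < s2 -> s2 < s3 -> s3 < s1 + 1 ->
  s2 - s1 <= PI * D -> s3 - s2 <= PI * D -> s1 + 1 - s3 <= PI * D -> wide D (g s1) (g s2) (g s3).
Proof.
  intros Hp H12 H23 H31 G1 G2 G3. unfold wide. set (u := g s1 [-] g s2). set (v := g s3 [-] g s2).
  destruct (gram_nonneg u v) as [Hg|Hg]; fold (gram u v) in Hg.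
  2: { rewrite <- Hg. unfold sides. rewrite Rmult_0_r. repeat apply Rmult_le_pos; apply dot_nonneg. }
  apply NNPP. intros Hn.
  destruct (narrow_sides u v Hg Hn) as (Pa & Pb & Pw & Hlt).
  destruct (triangle_angles u v Hg) as (A & B & C & HA & HB & HC & Hsum & CB & SA & SB & SC).
  pose proof PI_RGT_0 as HPI.
  assert (HalC : (s2 - s1) / (2 * D) < C).
  { apply (narrow_angle D C (vnorm u) (vnorm v * vnorm (v [-] u)) (sqrt (gram u v))); auto; try lra; try nra.
    { apply half_angle_bound; lra. }
    pose proof (chord_lower_D s1 (s2 - s1) ltac:(nra)) as Hc.
    replace (s1 + (s2 - s1)) with s2 in Hc by ring. unfold u. rewrite vnorm_sub_sym. exact Hc. }
  assert (HbeA : (s3 - s2) / (2 * D) < A).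
  { apply (narrow_angle D A (vnorm v) (vnorm u * vnorm (v [-] u)) (sqrt (gram u v))); auto; try lra; try nra.
    { apply half_angle_bound; lra. }
    pose proof (chord_lower_D s2 (s3 - s2) ltac:(nra)) as Hc.
    replace (s2 + (s3 - s2)) with s3 in Hc by ring. exact Hc. }
  assert (HgaB : (s1 + 1 - s3) / (2 * D) < B).
  { apply (narrow_angle D B (vnorm (v [-] u)) (vnorm u * vnorm v) (sqrt (gram u v))); auto; try lra; try nra.
    { apply half_angle_bound; lra. }
    pose proof (chord_lower_D s3 (s1 + 1 - s3) ltac:(nra)) as Hc.
    replace (s3 + (s1 + 1 - s3)) with (s1 + 1) in Hc by ring. rewrite Hp in Hc.
    replace (v [-] u) with (g s3 [-] g s1) by (unfold u, v; vring).
    rewrite vnorm_sub_sym. exact Hc. }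
  (* The three half arcs add up to 1/(2D). Fenchel's bound makes this at least PI, yet each half arc
     is smaller than the opposite angle of the triangle. *)
  assert (Hc : 0 < / D) by (now apply Rinv_0_lt_compat).
  pose proof (fenchel g T (/ D) HT Hc Hp) as HF.
  assert (Es : (s2 - s1) / (2 * D) + (s3 - s2) / (2 * D) + (s1 + 1 - s3) / (2 * D) = / D / 2) by (field; lra).
  lra.
Qed.

Lemma wide_ordered s1 s2 s3 : periodic1 g ->
  (forall s h, PI * D <= h <= 1 - PI * D -> 2 * D <= vnorm (g (s + h) [-] g s)) ->
  s1 < s2 -> s2 < s3 -> s3 < s1 + 1 -> wide D (g s1) (g s2) (g s3).
Proof.
  intros Hp Hfar H12 H23 H31.
  (* An arc longer than PI D either joins points at distance at least 2D, so that the triangle has a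
     long side, or its complement has length at most PI D. In the second case the three points are
     taken in the cyclic order in which they span that complement, and [wide_local] applies. *)
  assert (Hshort : forall s h x, h > PI * D ->
    (1 - h <= PI * D -> wide D x (g s) (g (s + h))) -> wide D x (g s) (g (s + h))).
  { intros s h x Hh Hw. destruct (Rle_lt_dec h (1 - PI * D)) as [G|G]; [|apply Hw; lra].
    assert (W : wide D (g (s + h)) x (g s)) by (apply wide_long_side; [lra | apply Hfar; lra]).
    wide_perm W. }
  destruct (Rle_lt_dec (s2 - s1) (PI * D)) as [G1|G1].
  - destruct (Rle_lt_dec (s3 - s2) (PI * D)) as [G2|G2].
    + destruct (Rle_lt_dec (s1 + 1 - s3) (PI * D)) as [G3|G3].
      * now apply wide_winding.
      * assert (W : wide D (g s2) (g s3) (g (s3 + (s1 + 1 - s3)))).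
        { apply Hshort; [lra|]. intros Hs.
          assert (W : wide D (g s1) (g s2) (g s3)) by (apply wide_local; lra).
          replace (s3 + (s1 + 1 - s3)) with (s1 + 1) by ring. rewrite Hp. wide_perm W. }
        replace (s3 + (s1 + 1 - s3)) with (s1 + 1) in W by ring. rewrite Hp in W. wide_perm W.
    + assert (W : wide D (g s1) (g s2) (g (s2 + (s3 - s2)))).
      { apply Hshort; [lra|]. intros Hs.
        assert (W : wide D (g s3) (g (s1 + 1)) (g (s2 + 1))) by (apply wide_local; lra).
        rewrite !Hp in W. replace (s2 + (s3 - s2)) with s3 by ring. wide_perm W. }
      replace (s2 + (s3 - s2)) with s3 in W by ring. exact W.
  - assert (W : wide D (g s3) (g s1) (g (s1 + (s2 - s1)))).
    { apply Hshort; [lra|]. intros Hs.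
      assert (W : wide D (g s2) (g s3) (g (s1 + 1))) by (apply wide_local; lra).
      rewrite !Hp in W. replace (s1 + (s2 - s1)) with s2 by ring. wide_perm W. }
    replace (s1 + (s2 - s1)) with s2 in W by ring. wide_perm W.
Qed.

Lemma thick_of_turning : periodic1 g ->
  (forall s h, PI * D <= h <= 1 - PI * D -> 2 * D <= vnorm (g (s + h) [-] g s)) ->
  thick_at_least g D.
Proof.
  intros Hp Hfar x y z (t1 & ->) (t2 & ->) (t3 & ->) (n1 & n2 & n3).
  destruct (frac_exists t1) as (k1 & u1 & -> & B1). destruct (frac_exists t2) as (k2 & u2 & -> & B2).
  destruct (frac_exists t3) as (k3 & u3 & -> & B3).
  rewrite !(Rplus_comm (IZR _)), !(periodic_Z g Hp) in *.
  pose proof (wide_ordered) as W.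
  assert (u1 <> u2) by congruence. assert (u2 <> u3) by congruence. assert (u1 <> u3) by congruence.
  change (wide D (g u1) (g u2) (g u3)).
  destruct (Rlt_le_dec u1 u2), (Rlt_le_dec u2 u3), (Rlt_le_dec u1 u3); try lra.
  - specialize (W u1 u2 u3 Hp Hfar ltac:(lra) ltac:(lra) ltac:(lra)). wide_perm W.
  - specialize (W u1 u3 u2 Hp Hfar ltac:(lra) ltac:(lra) ltac:(lra)). wide_perm W.
  - specialize (W u3 u1 u2 Hp Hfar ltac:(lra) ltac:(lra) ltac:(lra)). wide_perm W.
  - specialize (W u2 u1 u3 Hp Hfar ltac:(lra) ltac:(lra) ltac:(lra)). wide_perm W.
  - specialize (W u2 u3 u1 Hp Hfar ltac:(lra) ltac:(lra) ltac:(lra)). wide_perm W.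
  - specialize (W u3 u2 u1 Hp Hfar ltac:(lra) ltac:(lra) ltac:(lra)). wide_perm W.
Qed.
End Triples.

(** * Discrete thickness of polygons *)

Lemma not_elt e c : ~ elt (Fin c) e <-> ele e (Fin c).
Proof. destruct e; simpl; split; try tauto; lra. Qed.

Lemma emax_le a b c : ele (emax a b) (Fin c) <-> ele a (Fin c) /\ ele b (Fin c).
Proof.
  destruct a as [x|], b as [y|]; simpl; try tauto. split.
  - intros H. pose proof (Rmax_l x y). pose proof (Rmax_r x y). lra.
  - intros []. now apply Rmax_lub.
Qed.

Lemma emin_ge a b c : ele (Fin c) (emin a b) <-> ele (Fin c) a /\ ele (Fin c) b.
Proof.
  destruct a as [x|], b as [y|]; simpl; try tauto. split.
  - intros H. pose proof (Rmin_l x y). pose proof (Rmin_r x y). lra.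
  - intros []. now apply Rmin_glb.
Qed.

Lemma emax_upto_le f n c : ele (emax_upto f n) (Fin c) <->
  0 <= c /\ forall i, (i < n)%nat -> ele (f i) (Fin c).
Proof.
  induction n as [|n IH]; simpl.
  - split; [|tauto]. intros; split; auto. lia.
  - rewrite emax_le, IH. split.
    + intros [[H1 H2] H3]. split; auto. intros i Hi.
      destruct (Nat.eq_dec i n) as [->|]; auto. apply H2. lia.
    + intros [H1 H2]. repeat split; auto.
Qed.

Lemma emax_upto_nonneg f n : ele (Fin 0) (emax_upto f n).
Proof.
  induction n as [|n IH]; simpl; [lra|].
  destruct (emax_upto f n) as [x|], (f n) as [y|]; simpl in *; auto.
  pose proof (Rmax_l x y). lra.
Qed.

Lemma einv_nonneg e : ele (Fin 0) e -> ele (Fin 0) (einv e).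
Proof.
  destruct e as [x|]; simpl; [|lra]. destruct (Req_EM_T x 0); simpl; auto.
  intros H. left. apply Rinv_0_lt_compat. lra.
Qed.

Lemma einv_le_iff e c : 0 < c -> ele (Fin 0) e -> ele (einv e) (Fin c) <-> ele (Fin (/ c)) e.
Proof.
  intros Hc. pose proof (Rinv_0_lt_compat _ Hc).
  destruct e as [x|]; simpl; [|intros; split; auto; lra].
  intros Hx. destruct (Req_EM_T x 0); simpl.
  - split; [tauto | lra].
  - split; intros H1.
    + rewrite <- (Rinv_inv x). apply Rinv_le_contravar; auto. apply Rinv_0_lt_compat. lra.
    + rewrite <- (Rinv_inv c). apply Rinv_le_contravar; auto.
Qed.

Lemma einv_ge_iff e c : 0 < c -> ele (Fin 0) e -> ele (Fin c) (einv e) <-> ele e (Fin (/ c)).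
Proof.
  intros Hc. pose proof (Rinv_0_lt_compat _ Hc).
  destruct e as [x|]; simpl; [|intros; split; auto; lra].
  intros Hx. destruct (Req_EM_T x 0); simpl.
  - split; auto. lra.
  - split; intros H1.
    + rewrite <- (Rinv_inv x). apply Rinv_le_contravar; auto.
    + rewrite <- (Rinv_inv c). apply Rinv_le_contravar; auto. lra.
Qed.

Lemma dcsd_glb p : is_eglb (fun e => exists a b, dcrit p a b /\ e = Fin (dist3 a b)) (dcsd p).
Proof. apply (einf_spec _ 0). intros e (a & b & _ & ->). apply vnorm_nonneg. Qed.

Lemma dcsd_nonneg p : ele (Fin 0) (dcsd p).
Proof. apply dcsd_glb. intros e (a & b & _ & ->). apply vnorm_nonneg. Qed.

Lemma dcsd_ge_iff p d : ele (Fin d) (ehalf (dcsd p)) <-> forall a b, dcrit p a b -> 2 * d <= dist3 a b.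
Proof.
  destruct (dcsd_glb p) as [H1 H2]. split.
  - intros H a b Hab. specialize (H1 (Fin (dist3 a b)) ltac:(eauto)).
    destruct (dcsd p); simpl in *; [lra | tauto].
  - intros H. specialize (H2 (Fin (2 * d))).
    assert (ele (Fin (2 * d)) (dcsd p)).
    { apply H2. intros e (a & b & Hab & ->). now apply H. }
    destruct (dcsd p); simpl in *; auto. lra.
Qed.

Lemma minRad_nonneg n x : ele (Fin 0) (minRad n x).
Proof. apply einv_nonneg, emax_upto_nonneg. Qed.

Lemma Delta_n_nonneg n p x : ele (Fin 0) (Delta_n n p x).
Proof.
  unfold Delta_n. destruct (excluded_middle_informative _); [|simpl; lra].
  apply emin_ge. split; [apply minRad_nonneg|].
  pose proof (dcsd_nonneg p). destruct (dcsd p); simpl in *; auto. lra.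
Qed.

Definition kappa_le (n : nat) (x : Z -> V3) (c : R) : Prop :=
  forall i, (i < n)%nat ->
    ele (kappa_d (x (Z.of_nat i - 1)%Z) (x (Z.of_nat i)) (x (Z.of_nat i + 1)%Z)) (Fin c).

(** For d > 0 the value 0 assigned to repeated vertices is excluded, so distinctness becomes one of
    three conditions. *)
Lemma Delta_n_ge_iff n p x d : 0 < d -> ele (Fin d) (Delta_n n p x) <->
  vertices_distinct n x /\
  kappa_le n x (/ d) /\
  (forall a b, dcrit p a b -> 2 * d <= dist3 a b).
Proof.
  intros Hd. unfold Delta_n. destruct (excluded_middle_informative _) as [h|h].
  - rewrite emin_ge, dcsd_ge_iff. unfold minRad, maxCurv. rewrite einv_ge_iff by (auto using emax_upto_nonneg).
    rewrite emax_upto_le. pose proof (Rinv_0_lt_compat _ Hd). intuition lra.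
  - simpl. split; [lra | tauto].
Qed.

Lemma Fn_nonneg n g : ele (Fin 0) (Fn n g).
Proof.
  unfold Fn. destruct (excluded_middle_informative _); simpl; auto.
  apply einv_nonneg, Delta_n_nonneg.
Qed.

Lemma Fn_le_inv n g c : 0 < c -> ele (Fn n g) (Fin c) -> exists s x, Pn_rep n g (s, x) /\
  kappa_le n x c /\
  (forall a b, dcrit g a b -> 2 * / c <= dist3 a b).
Proof.
  intros Hc. unfold Fn. destruct (excluded_middle_informative _) as [[HC HP]|h]; simpl; [|tauto].
  pose proof (epsilon_spec (inhabits (0, fun _ => (0, 0, 0))) (Pn_rep n g) HP) as Hs.
  set (sx := epsilon _ _) in *. destruct sx as [s x]. simpl.
  rewrite einv_le_iff by (auto using Delta_n_nonneg).
  rewrite Delta_n_ge_iff by (now apply Rinv_0_lt_compat). rewrite Rinv_inv.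
  intros (_ & H1 & H2). exists s, x. auto.
Qed.

(** [Fn] evaluates the curvature at a representation picked by choice, so the bounds have to be
    supplied for every representation of the polygon. *)
Lemma Fn_le_intro n g d : 0 < d -> in_Pn n g ->
  (forall s x, Pn_rep n g (s, x) -> vertices_distinct n x /\ kappa_le n x (/ d)) ->
  (forall a b, dcrit g a b -> 2 * d <= dist3 a b) -> ele (Fn n g) (Fin (/ d)).
Proof.
  intros Hd HP H1 H2. unfold Fn. destruct (excluded_middle_informative _) as [[HC HR]|h]; [|tauto].
  pose proof (epsilon_spec (inhabits (0, fun _ => (0, 0, 0))) (Pn_rep n g) HR) as Hs.
  set (sx := epsilon _ _) in *. destruct sx as [s x]. simpl. destruct (H1 s x Hs).
  apply einv_le_iff; [now apply Rinv_0_lt_compat | apply Delta_n_nonneg|].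
  rewrite Rinv_inv. apply Delta_n_ge_iff; auto.
Qed.

(** The factor n normalises: in an equilateral polygon of length 1 this is a unit vector and the
    velocity along the k-th edge. *)
Definition edge (n : nat) (x : Z -> V3) (k : Z) : V3 := INR n [*] (x (k + 1)%Z [-] x k).

Section Polygon.
Variables (n : nat) (g : curve) (s0 : R) (x : Z -> V3).
Hypotheses (Hn : (1 <= n)%nat) (Hrep : Pn_rep n g (s0, x)).

Lemma INR_pos : 0 < INR n.
Proof. apply lt_0_INR. lia. Qed.

Lemma edge_unit k : vnorm (edge n x k) = 1.
Proof.
  destruct Hrep as (_ & H & _). unfold edge. pose proof INR_pos.
  rewrite vnorm_scal, Rabs_pos_eq by lra. simpl in H. unfold dist3 in H. rewrite H. field. lra.
Qed.

Lemma vertex_at k : g (s0 + IZR k / INR n) = x k.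
Proof.
  destruct Hrep as (_ & _ & H). simpl in H. specialize (H k 0 ltac:(lra)).
  rewrite Rplus_0_r in H. rewrite H. vring.
Qed.

Lemma on_edge k u v : 0 <= u <= 1 -> 0 <= v <= 1 ->
  g (s0 + (IZR k + u) / INR n) [-] g (s0 + (IZR k + v) / INR n) = ((u - v) / INR n) [*] edge n x k.
Proof.
  intros Hu Hv. destruct Hrep as (_ & _ & H). simpl in H. rewrite !H by auto. unfold edge.
  pose proof INR_pos. vring.
Qed.

(** [k1] is the edge to the left of t and [k2] the one to the right; they can differ only if t is a
    vertex parameter. The two distance bounds let estimates on all edges near t be applied to
    them. *)
Lemma polygon_local t : exists k1 k2 eta, 0 < eta /\ (k1 = k2 \/ exists k, t = s0 + IZR k / INR n) /\
  Rabs (s0 + IZR k1 / INR n - t) <= / INR n /\ Rabs (s0 + IZR k2 / INR n - t) <= / INR n /\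
  (forall u, t <= u < t + eta -> g u [-] g t = (u - t) [*] edge n x k2) /\
  (forall u, t - eta < u <= t -> g u [-] g t = (u - t) [*] edge n x k1).
Proof.
  pose proof INR_pos as Hp. destruct (frac_exists (INR n * (t - s0))) as (k & f & E & Hf).
  assert (Et : t = s0 + (IZR k + f) / INR n) by (rewrite <- E; field; lra).
  assert (Hinv : 0 < / INR n) by (now apply Rinv_0_lt_compat).
  assert (Hdist : forall y, -1 <= y <= 1 -> forall z, z = y / INR n -> Rabs z <= / INR n).
  { intros y Hy z ->. unfold Rdiv. rewrite Rabs_mult, (Rabs_pos_eq (/ _)) by lra.
    rewrite <- (Rmult_1_l (/ INR n)) at 2. apply Rmult_le_compat_r; [lra|]. apply Rabs_le; lra. }
  assert (Hsmall : forall e d, d < e / INR n -> d * INR n < e).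
  { intros e d H. apply (Rmult_lt_reg_r (/ INR n)); auto. rewrite Rmult_assoc, Rinv_r by lra.
    rewrite Rmult_1_r. exact H. }
  assert (Fwd : forall u, t <= u < t + (1 - f) / INR n -> g u [-] g t = (u - t) [*] edge n x k).
  { intros u Hu. pose proof (Hsmall (1 - f) (u - t) ltac:(lra)).
    assert (0 <= (u - t) * INR n) by (apply Rmult_le_pos; lra).
    replace u with (s0 + (IZR k + (f + (u - t) * INR n)) / INR n) at 1 by (rewrite Et; field; lra).
    rewrite Et at 2. rewrite on_edge by lra. f_equal. field. lra. }
  destruct (Req_dec f 0) as [->|hf].
  - exists (k - 1)%Z, k, (1 / INR n). split; [unfold Rdiv; lra|].
    split; [right; exists k; rewrite Et; f_equal; f_equal; ring|].
    split; [apply (Hdist (-1)); [lra|]; rewrite Et, minus_IZR; field; lra|].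
    split; [apply (Hdist 0); [lra|]; rewrite Et; field; lra|].
    split.
    + intros u Hu. apply Fwd. rewrite Rminus_0_r. exact Hu.
    + intros u Hu. pose proof (Hsmall 1 (t - u) ltac:(lra)).
      assert (0 <= (t - u) * INR n) by (apply Rmult_le_pos; lra).
      replace u with (s0 + (IZR (k - 1) + (1 - (t - u) * INR n)) / INR n) at 1
        by (rewrite Et, minus_IZR; field; lra).
      rewrite Et at 2. replace (IZR k + 0) with (IZR (k - 1) + 1) by (rewrite minus_IZR; ring).
      rewrite on_edge by lra. f_equal. field. lra.
  - exists k, k, (Rmin (f / INR n) ((1 - f) / INR n)).
    split; [apply Rmin_glb_lt; apply Rdiv_lt_0_compat; lra|].
    split; [now left|].
    split; [apply (Hdist (- f)); [lra|]; rewrite Et; field; lra|].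
    split; [apply (Hdist (- f)); [lra|]; rewrite Et; field; lra|].
    split.
    + intros u Hu. apply Fwd. pose proof (Rmin_r (f / INR n) ((1 - f) / INR n)). lra.
    + intros u Hu. pose proof (Rmin_l (f / INR n) ((1 - f) / INR n)).
      pose proof (Hsmall f (t - u) ltac:(lra)).
      assert (0 <= (t - u) * INR n) by (apply Rmult_le_pos; lra).
      replace u with (s0 + (IZR k + (f - (t - u) * INR n)) / INR n) at 1
        by (rewrite Et; field; lra).
      rewrite Et at 2. rewrite on_edge by lra. f_equal. field. lra.
Qed.

(** After subtraction of the linear motion t V the one-sided velocities are the differences of edges
    and V, and the mean value inequality applies across the vertices. *)
Lemma polygon_near a b V eps : a <= b -> 0 <= eps ->
  (forall k t, a <= t <= b -> Rabs (s0 + IZR k / INR n - t) <= / INR n -> vnorm (edge n x k [-] V) <= eps) ->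
  vnorm (g b [-] g a [-] (b - a) [*] V) <= eps * (b - a).
Proof.
  intros Hab He H.
  replace (g b [-] g a [-] (b - a) [*] V) with ((g b [-] b [*] V) [-] (g a [-] a [*] V)) by vring.
  apply (mean_value_ineq (fun t => g t [-] t [*] V)); auto.
  intros t Ht del Hdel. destruct (polygon_local t) as (k1 & k2 & eta & Heta & _ & D1 & D2 & F2 & F1).
  exists eta. split; auto. intros y z Hy Hz h1 h2.
  replace (g z [-] z [*] V [-] (g y [-] y [*] V)) with
    ((g z [-] g t [-] (z - t) [*] V) [-] (g y [-] g t [-] (y - t) [*] V)) by vring.
  rewrite (F1 y), (F2 z) by lra.
  replace ((z - t) [*] edge n x k2 [-] (z - t) [*] V) with ((z - t) [*] (edge n x k2 [-] V)) by vring.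
  replace ((y - t) [*] edge n x k1 [-] (y - t) [*] V) with ((y - t) [*] (edge n x k1 [-] V)) by vring.
  eapply Rle_trans; [apply vnorm_sub|]. rewrite !vnorm_scal, (Rabs_pos_eq (z - t)), (Rabs_left1 (y - t)) by lra.
  pose proof (H k1 t Ht D1). pose proof (H k2 t Ht D2). nra.
Qed.

Lemma kappa_edge k : kappa_d (x (k - 1)%Z) (x k) (x (k + 1)%Z) =
  let phi := ang (edge n x (k - 1)) (edge n x k) in
  if Req_EM_T phi PI then PInf else Fin (2 * INR n * tan (phi / 2)).
Proof.
  destruct Hrep as (_ & H & _). simpl in H. pose proof INR_pos as Hp.
  assert (E : ext_angle (x (k - 1)%Z) (x k) (x (k + 1)%Z) = ang (edge n x (k - 1)) (edge n x k)).
  { unfold ext_angle, ang, edge. replace (k - 1 + 1)%Z with k by ring. f_equal.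
    pose proof (H k) as H1. pose proof (H (k - 1)%Z) as H2. replace (k - 1 + 1)%Z with k in H2 by ring.
    unfold dist3 in *. rewrite H1, H2. dots. field. lra. }
  unfold kappa_d. rewrite E. simpl. destruct (Req_EM_T _ PI); auto. f_equal.
  pose proof (H k) as H1. pose proof (H (k - 1)%Z) as H2. replace (k - 1 + 1)%Z with k in H2 by ring.
  rewrite H1. unfold dist3 in *. rewrite (vnorm_sub_sym (x (k - 1)%Z)), H2. field. lra.
Qed.

Lemma kappa_periodic k : kappa_d (x (k + Z.of_nat n - 1)%Z) (x (k + Z.of_nat n)%Z) (x (k + Z.of_nat n + 1)%Z)
  = kappa_d (x (k - 1)%Z) (x k) (x (k + 1)%Z).
Proof.
  destruct Hrep as (H & _). simpl in H.
  replace (k + Z.of_nat n - 1)%Z with (k - 1 + Z.of_nat n)%Z by ring.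
  replace (k + Z.of_nat n + 1)%Z with (k + 1 + Z.of_nat n)%Z by ring. now rewrite !H.
Qed.
End Polygon.

Lemma periodic_nat_to_Z (P : Z -> Prop) n : (1 <= n)%nat ->
  (forall k, P (k + Z.of_nat n)%Z <-> P k) -> (forall i, (i < n)%nat -> P (Z.of_nat i)) -> forall k, P k.
Proof.
  intros Hn HP H.
  assert (G : forall j k, P (k + Z.of_nat j * Z.of_nat n)%Z <-> P k).
  { induction j as [|j IH]; intros k.
    - now rewrite Z.mul_0_l, Z.add_0_r.
    - replace (k + Z.of_nat (S j) * Z.of_nat n)%Z with (k + Z.of_nat j * Z.of_nat n + Z.of_nat n)%Z by lia.
      now rewrite HP. }
  intros k. set (j := Z.to_nat (Z.abs k)).
  apply (G j). set (k' := (k + Z.of_nat j * Z.of_nat n)%Z).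
  assert (0 <= k')%Z by (unfold k', j; rewrite Z2Nat.id by lia; nia).
  rewrite (Z.div_mod k' (Z.of_nat n)) by lia.
  assert (0 <= k' / Z.of_nat n)%Z by (apply Z.div_pos; lia).
  replace (Z.of_nat n * (k' / Z.of_nat n) + k' mod Z.of_nat n)%Z with
    (k' mod Z.of_nat n + Z.of_nat (Z.to_nat (k' / Z.of_nat n)) * Z.of_nat n)%Z by (rewrite Z2Nat.id by lia; ring).
  apply G. pose proof (Z.mod_pos_bound k' (Z.of_nat n) ltac:(lia)).
  rewrite <- (Z2Nat.id (k' mod Z.of_nat n)) by lia. apply H. lia.
Qed.

Lemma le_tan y : 0 <= y < PI / 2 -> y <= tan y.
Proof.
  intros Hy. assert (0 < cos y) by (apply cos_gt_0; lra).
  assert (sin 0 - 0 * cos 0 <= sin y - y * cos y).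
  { apply (derivable_incr (fun y => sin y - y * cos y) (fun y => cos y - (1 * cos y + y * - sin y))); [lra| |].
    - intros t _. apply (derivable_pt_lim_minus sin (fun y => y * cos y)); [apply derivable_pt_lim_sin|].
      apply (derivable_pt_lim_mult (fun y => y) cos); [apply derivable_pt_lim_id | apply derivable_pt_lim_cos].
    - intros t Ht. pose proof (sin_ge_0 t ltac:(lra) ltac:(lra)). nra. }
  rewrite sin_0 in H0. unfold tan. apply (Rmult_le_reg_r (cos y)); auto.
  unfold Rdiv. rewrite Rmult_assoc, Rinv_l by lra. lra.
Qed.

Lemma cos_lip x y : Rabs (cos x - cos y) <= Rabs (x - y).
Proof.
  assert (G : forall a b, a < b -> Rabs (cos b - cos a) <= b - a).
  { intros a b Hab. destruct (MVT_cor2 cos (fun t => - sin t) a b Hab) as (t & E & _).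
    { intros t _. apply derivable_pt_lim_cos. }
    rewrite E, Rabs_mult, (Rabs_pos_eq (b - a)) by lra.
    rewrite <- (Rmult_1_l (b - a)) at 2. apply Rmult_le_compat_r; [lra|].
    rewrite Rabs_Ropp. pose proof (SIN_bound t). apply Rabs_le; lra. }
  destruct (Rtotal_order x y) as [h|[->|h]].
  - rewrite Rabs_minus_sym, (Rabs_minus_sym x). rewrite (Rabs_pos_eq (y - x)) by lra. auto.
  - rewrite !Rminus_diag, Rabs_R0. lra.
  - rewrite (Rabs_pos_eq (x - y)) by lra. auto.
Qed.

Lemma chord_le_ang u v : vnorm u = 1 -> vnorm v = 1 -> vnorm (u [-] v) <= ang u v.
Proof.
  intros Hu Hv. pose proof (ang_bound u v). apply vnorm_le; [lra|].
  dots. rewrite (dot_sym v u), !unit_dot, <- (cos_ang u v) by auto.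
  set (w := ang u v) in *.
  assert (E : cos w = 1 - 2 * sin (w / 2) * sin (w / 2)).
  { rewrite <- cos_2a_sin. f_equal. field. }
  rewrite E. assert (0 <= sin (w / 2)) by (apply sin_ge_0; lra).
  assert (sin (w / 2) <= w / 2).
  { destruct (Req_dec w 0) as [->|]; [replace (0 / 2) with 0 by field; rewrite sin_0; lra|].
    left. apply sin_lt_x. lra. }
  nra.
Qed.

(** * Polygons of bounded discrete curvature *)

Section Curved.
Variables (n : nat) (g : curve) (s0 : R) (x : Z -> V3) (c : R).
Hypotheses (Hn : (1 <= n)%nat) (Hrep : Pn_rep n g (s0, x)) (Hc : 0 < c)
  (Hk : kappa_le n x c).

(** The discrete curvature is 2 n tan(phi/2), which is at least n phi. *)
Lemma edge_turn k : ang (edge n x (k - 1)) (edge n x k) <= c / INR n.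
Proof.
  pose proof (INR_pos n Hn) as Hp.
  assert (H : ele (kappa_d (x (k - 1)%Z) (x k) (x (k + 1)%Z)) (Fin c)).
  { revert k. apply (periodic_nat_to_Z _ n Hn); auto.
    intros k. now rewrite (kappa_periodic n g s0 x Hrep). }
  rewrite (kappa_edge n g s0 x Hn Hrep) in H. simpl in H.
  set (phi := ang _ _) in *. pose proof (ang_bound (edge n x (k - 1)) (edge n x k)) as Hb. fold phi in Hb.
  destruct (Req_EM_T phi PI); [contradiction|]. simpl in H.
  pose proof (le_tan (phi / 2) ltac:(lra)).
  apply (Rmult_le_reg_r (INR n)); auto. unfold Rdiv. rewrite Rmult_assoc, Rinv_l by lra. nra.
Qed.

Lemma edge_turn_nat k (j : nat) : ang (edge n x k) (edge n x (k + Z.of_nat j)) <= c * INR j / INR n.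
Proof.
  induction j as [|j IH].
  - rewrite Z.add_0_r. simpl. apply ang_le; try apply (edge_unit n g s0 x Hn Hrep).
    + pose proof PI_RGT_0. replace (c * 0 / INR n) with 0 by (field; pose proof (INR_pos n Hn); lra). lra.
    + rewrite unit_dot by apply (edge_unit n g s0 x Hn Hrep). apply COS_bound.
  - pose proof (edge_turn (k + Z.of_nat (S j))) as H.
    replace (k + Z.of_nat (S j) - 1)%Z with (k + Z.of_nat j)%Z in H by lia.
    pose proof (ang_triangle (edge n x k) (edge n x (k + Z.of_nat j)) (edge n x (k + Z.of_nat (S j)))) as Ht.
    rewrite !(edge_unit n g s0 x Hn Hrep) in Ht. specialize (Ht eq_refl eq_refl eq_refl).
    replace (c * INR (S j) / INR n) with (c * INR j / INR n + c / INR n)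
      by (rewrite S_INR; field; pose proof (INR_pos n Hn); lra). lra.
Qed.

Lemma edge_turn_Z j k : ang (edge n x j) (edge n x k) <= c * Rabs (IZR j / INR n - IZR k / INR n).
Proof.
  pose proof (INR_pos n Hn) as Hp. pose proof (Rinv_0_lt_compat _ Hp) as Hi.
  assert (G : forall j k, (j <= k)%Z -> ang (edge n x j) (edge n x k) <= c * Rabs (IZR j / INR n - IZR k / INR n)).
  { clear j k. intros j k H. pose proof (edge_turn_nat j (Z.to_nat (k - j))) as K.
    rewrite Z2Nat.id in K by lia. replace (j + (k - j))%Z with k in K by ring.
    eapply Rle_trans; [apply K|]. right.
    rewrite INR_IZR_INZ, Z2Nat.id, minus_IZR by lia.
    replace (IZR j / INR n - IZR k / INR n) with (- ((IZR k - IZR j) / INR n)) by (field; lra).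
    rewrite Rabs_Ropp, Rabs_pos_eq.
    - field; lra.
    - apply Rmult_le_pos; [|lra]. apply IZR_le in H. lra. }
  destruct (Z_le_gt_dec j k) as [h|h]; auto.
  rewrite ang_sym, Rabs_minus_sym. apply G. lia.
Qed.

(** Edges met between s and u turn by at most c (|u - s| + 2/n) from the edge at s, since either
    edge index determines a parameter only up to 1/n. The excess is the additive error 2c/n. *)
Lemma polygon_tangent s : exists k, Rabs (s0 + IZR k / INR n - s) <= / INR n /\
  forall u, Rabs (u - s) <= 1 ->
   vnorm (g u [-] g s [-] (u - s) [*] edge n x k) <= c * (u - s) ^ 2 + 2 * c / INR n.
Proof.
  pose proof (INR_pos n Hn) as Hp. pose proof (Rinv_0_lt_compat _ Hp) as Hi.
  destruct (polygon_local n g s0 x Hn Hrep s) as (k & _ & _ & _ & _ & Dk & _).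
  exists k. split; auto. intros u Hu.
  assert (N : forall a b, a <= s <= b -> vnorm (g b [-] g a [-] (b - a) [*] edge n x k)
     <= c * (b - a + 2 / INR n) * (b - a)).
  { intros a b Hs. assert (0 <= c * (b - a + 2 / INR n)).
    { apply Rmult_le_pos; [lra|]. unfold Rdiv. nra. }
    apply (polygon_near n g s0 x Hn Hrep); auto; [lra|].
    intros j t Ht Dj. eapply Rle_trans; [apply chord_le_ang; apply (edge_unit n g s0 x Hn Hrep)|].
    eapply Rle_trans; [apply edge_turn_Z|].
    apply Rmult_le_compat_l; [lra|]. apply Rabs_le_inv in Dk, Dj. unfold Rdiv in *. apply Rabs_le. lra. }
  assert (Hfin : forall d, 0 <= d <= 1 -> c * (d + 2 / INR n) * d <= c * d ^ 2 + 2 * c / INR n).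
  { intros d Hd. replace (c * (d + 2 / INR n) * d) with (c * d ^ 2 + 2 * c / INR n * d) by (field; lra).
    assert (0 <= 2 * c / INR n) by (unfold Rdiv; nra). nra. }
  apply Rabs_le_inv in Hu. destruct (Rle_lt_dec s u) as [h|h].
  - eapply Rle_trans; [apply N; lra|]. apply Hfin. lra.
  - replace (g u [-] g s [-] (u - s) [*] edge n x k) with
      ((-1) [*] (g s [-] g u [-] (s - u) [*] edge n x k)) by vring.
    rewrite vnorm_scal, Rabs_left by lra. replace (- -1) with 1 by ring. rewrite Rmult_1_l.
    replace ((u - s) ^ 2) with ((s - u) ^ 2) by ring.
    eapply Rle_trans; [apply N; lra|]. apply Hfin. lra.
Qed.
End Curved.

(** * The liminf inequality *)

Lemma in_C_lipschitz g : in_C g -> exists L, lipschitz L g.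
Proof. intros ((_ & L & HL) & _). exists L. exact HL. Qed.

Lemma csub_lipschitz f g L M : lipschitz L f -> lipschitz M g -> lipschitz (L + M) (csub f g).
Proof.
  intros Hf Hg s t. unfold csub.
  replace (f s [-] g s [-] (f t [-] g t)) with ((f s [-] f t) [-] (g s [-] g t)) by vring.
  eapply Rle_trans; [apply vnorm_sub|]. pose proof (Hf s t). pose proof (Hg s t). lra.
Qed.

Lemma lipschitz_bounded_unit h L : lipschitz L h -> forall t, 0 <= t < 1 -> vnorm (h t) <= vnorm (h 0) + L.
Proof.
  intros H t Ht. pose proof (H t 0) as H1. rewrite Rminus_0_r, Rabs_pos_eq in H1 by lra.
  pose proof (vnorm_sub_ge (h t) (h 0)). pose proof (lip_nonneg _ _ H). nra.
Qed.

Lemma Linf_norm_glb h L : lipschitz L h ->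
  is_glb (fun M => 0 <= M /\ ae_S1 (fun t => vnorm (h t) <= M)) (Linf_norm h).
Proof.
  intros H. apply (Rinf_spec _ 0 (vnorm (h 0) + L)).
  - tauto.
  - split; [pose proof (vnorm_nonneg (h 0)); pose proof (lip_nonneg _ _ H); lra|].
    eapply null_subset; [|apply null_empty]. intros t [Ht Hn]. apply Hn.
    now apply lipschitz_bounded_unit.
Qed.

Lemma has_deriv_sub f g t V W : has_deriv f t V -> has_deriv g t W -> has_deriv (csub f g) t (V [-] W).
Proof.
  intros (a1 & a2 & a3) (b1 & b2 & b3). repeat split.
  - apply (derivable_pt_lim_minus (fun s => c1 (f s)) (fun s => c1 (g s))); auto.
  - apply (derivable_pt_lim_minus (fun s => c2 (f s)) (fun s => c2 (g s))); auto.
  - apply (derivable_pt_lim_minus (fun s => c3 (f s)) (fun s => c3 (g s))); auto.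
Qed.

(** The number 2 bounds the difference of two unit velocities, so the set whose infimum is chosen is
    not empty. *)
Lemma Linf_norm_deriv_glb f g : in_C f -> in_C g ->
  is_glb (fun M => 0 <= M /\ ae_S1 (fun t => exists v, has_deriv (csub f g) t v /\ vnorm v <= M))
    (Linf_norm_deriv (csub f g)).
Proof.
  intros [_ Hf] [_ Hg]. apply (Rinf_spec _ 0 2).
  - tauto.
  - split; [lra|]. eapply null_subset; [|apply (null_union _ _ Hf Hg)].
    intros t [Ht Hn].
    destruct (classic (exists v, has_deriv f t v /\ vnorm v = 1)) as [(v & Hv & Nv)|h]; [|tauto].
    destruct (classic (exists v, has_deriv g t v /\ vnorm v = 1)) as [(w & Hw & Nw)|h]; [|tauto].
    exfalso. apply Hn. exists (v [-] w). split; [now apply has_deriv_sub|].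
    pose proof (vnorm_sub v w). lra.
Qed.

Lemma csub_periodic f g : periodic1 f -> periodic1 g -> periodic1 (csub f g).
Proof. intros Hf Hg t. unfold csub. now rewrite Hf, Hg. Qed.

(** An essential bound on a Lipschitz curve holds everywhere: a violation at u would persist on an
    interval to the right of u, which is not a null set. Uniform closeness is all that the liminf
    inequality takes from the norm. *)
Lemma W1inf_norm_uniform f g eps : in_C f -> in_C g -> W1inf_norm (csub f g) < eps ->
  forall t, vnorm (f t [-] g t) <= eps.
Proof.
  intros Hf Hg H. destruct (in_C_lipschitz f Hf) as (L & HL). destruct (in_C_lipschitz g Hg) as (L' & HL').
  pose proof (csub_lipschitz _ _ _ _ HL HL') as Hh.
  destruct (Linf_norm_glb _ _ Hh) as [_ G1]. destruct (Linf_norm_deriv_glb f g Hf Hg) as [_ G2].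
  assert (0 <= Linf_norm_deriv (csub f g)) by (apply G2; tauto).
  unfold W1inf_norm in H.
  assert (exists M, M < eps /\ ae_S1 (fun t => vnorm (csub f g t) <= M)) as (M & HM & Hae).
  { apply NNPP. intros Hn. assert (eps <= Linf_norm (csub f g)); [|lra].
    apply G1. intros M [_ HM]. destruct (Rlt_le_dec M eps); auto. exfalso; eauto. }
  intros t. destruct (frac_exists t) as (k & u & -> & Hu).
  destruct Hf as [[Pf _] _]. destruct Hg as [[Pg _] _].
  rewrite Rplus_comm, !periodic_Z by auto. change (vnorm (csub f g u) <= eps).
  destruct (Rle_lt_dec (vnorm (csub f g u)) eps) as [h|h]; auto. exfalso.
  set (K := L + L') in *. pose proof (lip_nonneg _ _ Hh) as HK.
  destruct (small_positive (1 - u) (vnorm (csub f g u) - eps) (K + 1)) as (d & Hd & Hd1 & Hd2); try lra.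
  destruct (null_no_interval _ u (u + d) ltac:(lra) Hae) as (t & Ht & Hnt).
  apply Hnt. split; [lra|]. intros Hle.
  pose proof (Hh u t) as Hut. rewrite Rabs_left1 in Hut by lra.
  pose proof (vnorm_sub_ge (csub f g u) (csub f g t)).
  nra.
Qed.

Lemma turning_limit (g : curve) c : 0 < c ->
  (forall eps, 0 < eps -> exists n p s0 x, / INR n < eps /\ (1 <= n)%nat /\ Pn_rep n p (s0, x) /\
     kappa_le n x c /\
     (forall t, vnorm (p t [-] g t) <= eps)) ->
  exists T, turning g T c.
Proof.
  intros Hc H.
  assert (A : forall eps, 0 < eps -> exists (Ee : R -> V3), (forall s, vnorm (Ee s) = 1 /\ forall u, Rabs (u - s) <= 1 ->
     vnorm (g u [-] g s [-] (u - s) [*] Ee s) <= c * (u - s) ^ 2 + eps) /\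
     (forall s u, ang (Ee s) (Ee u) <= c * Rabs (s - u) + eps)).
  { intros eps Heps. destruct (small_positive (eps / 4) (eps / 4) c) as (d & Hd & Hd1 & Hd2); try lra.
    destruct (H d Hd) as (n & p & s0 & x & Hnd & Hn & Hrep & Hk & Hu).
    pose proof (polygon_tangent n p s0 x c Hn Hrep Hc Hk) as Htan.
    destruct (choose_fun _ Htan) as (ks & Hks).
    assert (Hcn : c / INR n <= eps / 4) by (unfold Rdiv at 1; nra).
    exists (fun s => edge n x (ks s)). split.
    - intros s. split; [apply (edge_unit n p s0 x Hn Hrep)|]. intros u Hus.
      pose proof (proj2 (Hks s) u Hus) as K.
      replace (g u [-] g s [-] (u - s) [*] edge n x (ks s)) with
        ((p u [-] p s [-] (u - s) [*] edge n x (ks s)) [-] ((p u [-] g u) [-] (p s [-] g s))) by vring.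
      pose proof (Hu u). pose proof (Hu s).
      eapply Rle_trans; [apply vnorm_sub|].
      pose proof (vnorm_sub (p u [-] g u) (p s [-] g s)).
      replace (2 * c / INR n) with (2 * (c / INR n)) in K by (unfold Rdiv; ring). lra.
    - intros s u. eapply Rle_trans; [apply (edge_turn_Z n p s0 x c Hn Hrep Hk)|].
      pose proof (proj1 (Hks s)) as K1. pose proof (proj1 (Hks u)) as K2.
      apply Rabs_le_inv in K1, K2.
      assert (Rabs (IZR (ks s) / INR n - IZR (ks u) / INR n) <= Rabs (s - u) + 2 * d).
      { pose proof (Rle_abs (s - u)). pose proof (Rle_abs (u - s)). rewrite (Rabs_minus_sym u s) in *.
        apply Rabs_le. lra. }
      nra. }
  assert (Hex : forall s, exists V, vnorm V = 1 /\ forall u, Rabs (u - s) <= 1 ->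
     vnorm (g u [-] g s [-] (u - s) [*] V) <= c * (u - s) ^ 2).
  { intros s. apply tangent_exists; [lra|].
    intros eps Heps. destruct (A eps Heps) as (E & HE & _). exists (E s). apply HE. }
  destruct (choose_fun _ Hex) as (T & HT).
  exists T. split; [|split].
  - intros s. apply (quad_has_deriv g s (T s) c). apply HT.
  - intros s. apply HT.
  - intros s u. set (X := c * Rabs (s - u)).
    assert (HX : 0 <= X) by (apply Rmult_le_pos; [lra | apply Rabs_pos]).
    destruct (Rle_lt_dec PI X) as [h|h]; [pose proof (ang_bound (T s) (T u)); lra|].
    apply ang_le; try apply HT; [lra|].
    apply le_epsilon. intros eps Heps.
    (* An approximation of g with error r^2 determines tangents up to (2c + 1) r, and the total loss
       r^2 + 2 (2c + 1) r is below eps. The limit is taken for cosines, since arccos is not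
       Lipschitz at 1; the bound by PI - X keeps X + r^2 in [0, PI]. *)
    set (r := Rmin (PI - X) (Rmin 1 (eps / (4 * c + 5)))).
    assert (Hr : 0 < r).
    { repeat apply Rmin_glb_lt; try lra. apply Rdiv_lt_0_compat; lra. }
    assert (Hr1 : r <= PI - X) by apply Rmin_l.
    assert (Hr2 : r <= 1) by (eapply Rle_trans; [apply Rmin_r | apply Rmin_l]).
    assert (Hr3 : (4 * c + 5) * r <= eps).
    { replace eps with ((4 * c + 5) * (eps / (4 * c + 5))) by (field; lra).
      apply Rmult_le_compat_l; [lra|]. eapply Rle_trans; [apply Rmin_r | apply Rmin_r]. }
    destruct (A (r * r) ltac:(nra)) as (E & HE & HA).
    assert (Hcl : forall z, vnorm (E z [-] T z) <= (2 * c + 1) * r).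
    { intros z. replace ((2 * c + 1) * r) with (2 * c * r + r * r / r) by (field; lra).
      apply (unit_close g z c (E z) (T z) (r * r) r); auto; [apply HE | apply HT]. }
    pose proof (HA s u) as Ha. fold X in Ha.
    pose proof (ang_le_cos (E s) (E u) (X + r * r) (proj1 (HE s)) (proj1 (HE u)) Ha ltac:(nra)) as Hcos.
    pose proof (cos_lip (X + r * r) X) as Hl. replace (X + r * r - X) with (r * r) in Hl by ring.
    rewrite (Rabs_pos_eq (r * r)) in Hl by nra. apply Rabs_le_inv in Hl.
    pose proof (dot_le (E s [-] T s) (E u)) as D1. rewrite (proj1 (HE u)) in D1.
    pose proof (dot_le (T s) (E u [-] T u)) as D2. rewrite (proj1 (HT s)) in D2.
    rewrite dot_subl in D1. rewrite dot_subr in D2.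
    pose proof (Hcl s). pose proof (Hcl u). nra.
Qed.

Lemma vnorm_diff_le a b a' b' e : vnorm (a [-] a') <= e -> vnorm (b [-] b') <= e ->
  vnorm (a [-] b) <= vnorm (a' [-] b') + 2 * e.
Proof.
  intros H1 H2. pose proof (vnorm_sub_lip a b a' b') as H. apply Rabs_le_inv in H. lra.
Qed.

Lemma far_apart (g : curve) T D : 0 < D -> turning g T (/ D) -> periodic1 g ->
  (forall eps, 0 < eps -> exists p, in_C p /\ injective_S1 p /\ (forall t, vnorm (p t [-] g t) <= eps) /\
     (forall a b, dcrit p a b -> 2 * D <= dist3 a b)) ->
  forall s h, PI * D <= h <= 1 - PI * D -> 2 * D <= vnorm (g (s + h) [-] g s).
Proof.
  intros HD HT Hp H s h Hh.
  destruct (Rle_lt_dec (2 * D) (vnorm (g (s + h) [-] g s))) as [G|G]; auto. exfalso.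
  pose proof PI_RGT_0 as HPI.
  (* With a fifth of the deficit the minimal distance of p is at most 2D - 3e, while at the ends of
     the range it is at least 2D - 2e. *)
  set (e := (2 * D - vnorm (g (s + h) [-] g s)) / 5).
  assert (He : 0 < e) by (unfold e; lra).
  destruct (H e He) as (p & HC & Hinj & Hu & Hcrit).
  destruct (in_C_lipschitz p HC) as (L & HL). destruct HC as [[Pp _] _].
  destruct (min_chord p L (PI * D) (1 - PI * D) Pp HL ltac:(lra)) as (s1 & h1 & Hh1 & Hmin).
  assert (Hus : forall t, vnorm (g t [-] p t) <= e) by (intros t; rewrite vnorm_sub_sym; apply Hu).
  assert (Hval : vnorm (p (s1 + h1) [-] p s1) < 2 * D - 2 * e).
  { pose proof (Hmin s h Hh). pose proof (vnorm_diff_le _ _ _ _ e (Hu (s + h)) (Hu s)). unfold e in *. lra. }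
  (* Half a circle: the chord bound at h = PI D is 2D sin(PI/2). By periodicity it also covers the
     end h = 1 - PI D. *)
  assert (Hpi : forall s, 2 * D <= vnorm (g (s + PI * D) [-] g s)).
  { intros s'. pose proof (chord_lower_D g T D HT HD s' (PI * D) ltac:(nra)) as K.
    replace (PI * D / (2 * D)) with (PI / 2) in K by (field; lra). rewrite sin_PI2 in K. lra. }
  assert (Hlo : PI * D < h1).
  { destruct (Req_dec h1 (PI * D)) as [E|]; [|lra]. exfalso.
    pose proof (vnorm_diff_le _ _ _ _ e (Hus (s1 + h1)) (Hus s1)). pose proof (Hpi s1). rewrite E in *. lra. }
  assert (Hhi : h1 < 1 - PI * D).
  { destruct (Req_dec h1 (1 - PI * D)) as [E|]; [|lra]. exfalso.
    pose proof (vnorm_diff_le _ _ _ _ e (Hus (s1 + h1)) (Hus s1)).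
    pose proof (Hpi (s1 - PI * D)) as K. replace (s1 - PI * D + PI * D) with s1 in K by ring.
    rewrite E in *. replace (s1 + (1 - PI * D)) with (s1 - PI * D + 1) in * by ring.
    rewrite !Hp in *. rewrite (vnorm_sub_sym (g s1)) in K. lra. }
  (* The minimum over both parameters lies in the interior, so either parameter may be varied alone.
     If v moves while s1 + h1 stays fixed, the arc changes to s1 + h1 - v. *)
  assert (Hd : dcrit p (p s1) (p (s1 + h1))).
  { set (del := Rmin (h1 - PI * D) (1 - PI * D - h1)).
    assert (Hdel : 0 < del) by (apply Rmin_glb_lt; lra).
    assert (Hd1 : del <= h1 - PI * D) by apply Rmin_l.
    assert (Hd2 : del <= 1 - PI * D - h1) by apply Rmin_r.
    split.
    - intros E. destruct (Hinj _ _ E) as (k & Hk).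
      assert (0 < IZR (- k) < 1) as [K1 K2] by (rewrite opp_IZR; nra).
      apply lt_IZR in K1. apply lt_IZR in K2. lia.
    - exists s1, (s1 + h1). split; [|split]; auto. split.
      + exists del. split; auto. right. intros u Hu'. apply Rabs_def2 in Hu'.
        apply pow_incr. split; [apply vnorm_nonneg|]. unfold dist3.
        rewrite (vnorm_sub_sym (p s1)), (vnorm_sub_sym (p s1)).
        replace u with (s1 + (u - s1)) by ring. apply Hmin. lra.
      + exists del. split; auto. right. intros v Hv. apply Rabs_def2 in Hv.
        apply pow_incr. split; [apply vnorm_nonneg|]. unfold dist3.
        rewrite (vnorm_sub_sym (p s1)), (vnorm_sub_sym (p v)).
        replace (p (s1 + h1)) with (p (v + (s1 + h1 - v))) at 2 by (f_equal; ring). apply Hmin. lra. }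
  apply Hcrit in Hd. unfold dist3 in Hd. rewrite vnorm_sub_sym in Hd. lra.
Qed.

Lemma thick_limit (g : curve) c : 0 < c -> periodic1 g ->
  (forall eps, 0 < eps -> exists n p, / INR n < eps /\ (1 <= n)%nat /\ in_C p /\ injective_S1 p /\
     (forall t, vnorm (p t [-] g t) <= eps) /\ ele (Fn n p) (Fin c)) ->
  thick_at_least g (/ c).
Proof.
  intros Hc Hp H. pose proof (Rinv_0_lt_compat _ Hc).
  destruct (turning_limit g c Hc) as (T & HT).
  { intros eps Heps. destruct (H eps Heps) as (n & p & H1 & H2 & H3 & H4 & H5 & H6).
    destruct (Fn_le_inv n p c Hc H6) as (s & x & R1 & R2 & R3). exists n, p, s, x. auto. }
  assert (HT' : turning g T (/ / c)) by (now rewrite Rinv_inv).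
  apply (thick_of_turning g T (/ c)); auto.
  apply (far_apart g T (/ c)); auto.
  intros eps Heps. destruct (H eps Heps) as (n & p & H1 & H2 & H3 & H4 & H5 & H6).
  destruct (Fn_le_inv n p c Hc H6) as (s & x & R1 & R2 & R3). exists p. auto.
Qed.

Lemma inv_INR_small eps : 0 < eps -> exists N, forall n, (N <= n)%nat -> (1 <= n)%nat /\ / INR n < eps.
Proof.
  intros Heps. destruct (INR_unbounded (/ eps)) as (N & HN). pose proof (Rinv_0_lt_compat _ Heps).
  exists (S N). intros n Hn. split; [lia|].
  assert (INR N < INR n) by (apply lt_INR; lia).
  rewrite <- (Rinv_inv eps). apply Rinv_lt_contravar; [|lra]. apply Rmult_lt_0_compat; lra.
Qed.

Lemma elt_dense c e : 0 <= c -> elt (Fin c) e -> exists c', 0 < c' /\ c <= c' /\ elt (Fin c') e.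
Proof.
  intros Hc. destruct e as [x|]; simpl; intros H.
  - exists ((c + x) / 2). lra.
  - exists (c + 1). lra.
Qed.

Lemma elt_trans_le c c' e : c <= c' -> elt (Fin c') e -> elt (Fin c) e.
Proof. destruct e; simpl; lra. Qed.

Lemma liminf_ineq K0 (gs : nat -> curve) (g : curve) :
  (forall n, in_CK K0 (gs n)) -> in_CK K0 g -> W1inf_conv gs g ->
  le_liminf (F g) (fun n => Fn n (gs n)).
Proof.
  intros Hgs (HC & _) Hconv c Hc.
  destruct (Rlt_le_dec c 0) as [Hc0|Hc0].
  { exists 0%nat. intros n _. pose proof (Fn_nonneg n (gs n)). destruct (Fn n (gs n)); simpl in *; auto. lra. }
  (* c may be 0, and a positive bound d is needed for the radius 1/d. *)
  destruct (elt_dense c _ Hc0 Hc) as (d & Hd & Hcd & HdF).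
  apply NNPP. intros Hn.
  (* If the claim fails, F_n is at most d for arbitrarily large n. A finite value makes these curves
     polygons, and they come arbitrarily close to g. *)
  assert (HT : thick_at_least g (/ d)).
  { apply thick_limit; auto; [apply HC|]. intros eps Heps.
    destruct (inv_INR_small eps Heps) as (N1 & HN1).
    destruct (Hconv eps Heps) as (N2 & HN2).
    apply NNPP. intros Hn2. apply Hn. exists (Nat.max N1 N2). intros n Hnn.
    apply elt_trans_le with d; auto. apply NNPP. intros Hn3. apply not_elt in Hn3.
    apply Hn2. destruct (HN1 n ltac:(lia)). exists n, (gs n).
    destruct (Hgs n) as (Cn & In & _). repeat (split; auto).
    apply W1inf_norm_uniform; auto. apply HN2. lia. }
  apply thickness_ge_iff in HT; [|left; now apply Rinv_0_lt_compat].
  apply einv_le_iff in HT; auto; [|apply thickness_nonneg].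
  apply not_elt in HT. auto.
Qed.

(** * Regularity of curves of positive thickness *)

Definition vec_cv (q : nat -> V3) (V : V3) : Prop :=
  Un_cv (fun k => c1 (q k)) (c1 V) /\ Un_cv (fun k => c2 (q k)) (c2 V) /\ Un_cv (fun k => c3 (q k)) (c3 V).

Lemma Un_cv_const c : Un_cv (fun _ => c) c.
Proof. intros eps Heps. exists 0%nat. intros. unfold Rdist. rewrite Rminus_diag, Rabs_R0. lra. Qed.

Lemma vec_cv_const V : vec_cv (fun _ => V) V.
Proof. repeat split; apply Un_cv_const. Qed.

Lemma vec_cv_sub p q U V : vec_cv p U -> vec_cv q V -> vec_cv (fun k => p k [-] q k) (U [-] V).
Proof.
  intros (a1 & a2 & a3) (b1 & b2 & b3). repeat split.
  - apply (CV_minus (fun k => c1 (p k)) (fun k => c1 (q k))); auto.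
  - apply (CV_minus (fun k => c2 (p k)) (fun k => c2 (q k))); auto.
  - apply (CV_minus (fun k => c3 (p k)) (fun k => c3 (q k))); auto.
Qed.

Lemma vec_cv_scal h q a V : Un_cv h a -> vec_cv q V -> vec_cv (fun k => h k [*] q k) (a [*] V).
Proof.
  intros Hh (b1 & b2 & b3). repeat split.
  - apply (CV_mult h (fun k => c1 (q k))); auto.
  - apply (CV_mult h (fun k => c2 (q k))); auto.
  - apply (CV_mult h (fun k => c3 (q k))); auto.
Qed.

Lemma vec_cv_dot p q U V : vec_cv p U -> vec_cv q V -> Un_cv (fun k => dot (p k) (q k)) (dot U V).
Proof.
  intros (a1 & a2 & a3) (b1 & b2 & b3). unfold dot.
  apply (CV_plus (fun k => c1 (p k) * c1 (q k) + c2 (p k) * c2 (q k)) (fun k => c3 (p k) * c3 (q k))).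
  - apply (CV_plus (fun k => c1 (p k) * c1 (q k)) (fun k => c2 (p k) * c2 (q k))).
    + apply (CV_mult (fun k => c1 (p k)) (fun k => c1 (q k))); auto.
    + apply (CV_mult (fun k => c2 (p k)) (fun k => c2 (q k))); auto.
  - apply (CV_mult (fun k => c3 (p k)) (fun k => c3 (q k))); auto.
Qed.

Lemma Un_cv_le a b A B : (forall k, a k <= b k) -> Un_cv a A -> Un_cv b B -> A <= B.
Proof.
  intros H HA HB. apply le_epsilon. intros eps Heps.
  destruct (HA (eps / 2) ltac:(lra)) as (N1 & H1). destruct (HB (eps / 2) ltac:(lra)) as (N2 & H2).
  specialize (H1 (Nat.max N1 N2) ltac:(lia)). specialize (H2 (Nat.max N1 N2) ltac:(lia)).
  specialize (H (Nat.max N1 N2)). unfold Rdist in *. apply Rabs_def2 in H1, H2. lra.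
Qed.

Lemma diff_quotient_cv g s V : has_deriv g s V ->
  vec_cv (fun k => INR (S k) [*] (g (s + / INR (S k)) [-] g s)) V.
Proof.
  intros (a1 & a2 & a3).
  assert (G : forall phi l, derivable_pt_lim phi s l ->
    Un_cv (fun k => INR (S k) * (phi (s + / INR (S k)) - phi s)) l).
  { intros phi l H eps Heps. destruct (H eps Heps) as (del & Hdel).
    destruct (inv_INR_small del (cond_pos del)) as (N & HN).
    exists N. intros n Hn. unfold Rdist. destruct (HN (S n) ltac:(lia)) as [_ Hs].
    assert (0 < INR (S n)) by (apply lt_0_INR; lia).
    pose proof (Rinv_0_lt_compat _ H0).
    specialize (Hdel (/ INR (S n)) ltac:(lra)). rewrite Rabs_pos_eq in Hdel by lra.
    specialize (Hdel Hs). replace (INR (S n) * (phi (s + / INR (S n)) - phi s)) with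
      ((phi (s + / INR (S n)) - phi s) / / INR (S n)) by (field; lra). exact Hdel. }
  repeat split.
  - exact (G (fun t => c1 (g t)) _ a1).
  - exact (G (fun t => c2 (g t)) _ a2).
  - exact (G (fun t => c3 (g t)) _ a3).
Qed.

(** Coinciding points make the Gram determinant vanish. Without a distinctness condition the
    inequality can be passed to the limit of merging points. *)
Lemma thick_all g D : thick_at_least g D -> forall r s t,
  4 * D * D * gram (g r [-] g s) (g t [-] g s) <= sides (g r [-] g s) (g t [-] g s).
Proof.
  intros H r s t.
  assert (Hs : 0 <= sides (g r [-] g s) (g t [-] g s))
    by (unfold sides; repeat apply Rmult_le_pos; apply dot_nonneg).
  assert (Hz : gram (g r [-] g s) (g t [-] g s) = 0 -> 
     4 * D * D * gram (g r [-] g s) (g t [-] g s) <= sides (g r [-] g s) (g t [-] g s)).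
  { intros E. rewrite E, Rmult_0_r. exact Hs. }
  destruct (excluded_middle_informative (g r = g s)) as [E|n1].
  { apply Hz. rewrite E. unfold gram. vring. }
  destruct (excluded_middle_informative (g s = g t)) as [E|n2].
  { apply Hz. rewrite E. unfold gram. vring. }
  destruct (excluded_middle_informative (g r = g t)) as [E|n3].
  { apply Hz. rewrite E. unfold gram. vring. }
  apply H; repeat split; auto; eexists; reflexivity.
Qed.

(* The circle through g(u) tangent to g at g(s) has radius |W|^2 / (2 |W - <W,V>V|). *)
Lemma tangent_circle g D s V u : thick_at_least g D -> has_deriv g s V -> vnorm V = 1 ->
  let W := g u [-] g s in 4 * D * D * (dot W W - dot W V * dot W V) <= dot W W * dot W W.
Proof.
  intros HD HV H1 W. pose proof (unit_dot _ H1) as HVV.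
  set (q := fun k => INR (S k) [*] (g (s + / INR (S k)) [-] g s)).
  pose proof (diff_quotient_cv g s V HV) as Hq. fold q in Hq.
  assert (Hh : Un_cv (fun k => / INR (S k)) 0).
  { pose proof (inv_succ_cv 1) as H. eapply Un_cv_ext; [|apply H]. intros k. unfold Rdiv. simpl. ring. }
  pose proof (vec_cv_dot _ _ _ _ Hq Hq) as Cqq. pose proof (vec_cv_dot _ _ _ _ (vec_cv_const W) Hq) as CWq.
  assert (CS : vec_cv (fun k => W [-] / INR (S k) [*] q k) (W [-] 0 [*] V)).
  { apply vec_cv_sub; [apply vec_cv_const | apply vec_cv_scal; auto]. }
  replace (W [-] 0 [*] V) with W in CS by (clearbody W; vring).
  pose proof (vec_cv_dot _ _ _ _ CS CS) as CSS.
  (* In the inequality for g(u), g(s), g(s + h) both sides carry a factor h^2; dividing by it leaves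
     difference quotients, and h tends to 0. *)
  assert (L : 4 * D * D * (dot W W * dot V V - dot W V * dot W V) <= dot W W * dot V V * dot W W).
  { apply (Un_cv_le (fun k => 4 * D * D * (dot W W * dot (q k) (q k) - dot W (q k) * dot W (q k)))
      (fun k => dot W W * dot (q k) (q k) * dot (W [-] / INR (S k) [*] q k) (W [-] / INR (S k) [*] q k))).
    - intros k. pose proof (thick_all g D HD u s (s + / INR (S k))) as Ht. fold W in Ht.
      assert (Hn : 0 < INR (S k)) by (apply lt_0_INR; lia).
      assert (E : g (s + / INR (S k)) [-] g s = / INR (S k) [*] q k).
      { unfold q. vring. }
      rewrite E in Ht. unfold gram, sides in Ht. 
      replace (dot (/ INR (S k) [*] q k) (/ INR (S k) [*] q k)) with (/ INR (S k) * (/ INR (S k) * dot (q k) (q k))) in Ht by (dots; ring).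
      replace (dot W (/ INR (S k) [*] q k)) with (/ INR (S k) * dot W (q k)) in Ht by (dots; ring).
      pose proof (Rinv_0_lt_compat _ Hn). set (h := / INR (S k)) in *.
      apply (Rmult_le_reg_l (h * h)); [nra|].
      eapply Rle_trans; [|eapply Rle_trans; [apply Ht|]]; right; ring.
    - apply (CV_mult (fun _ => 4 * D * D)); [apply Un_cv_const|].
      apply (CV_minus (fun k => dot W W * dot (q k) (q k)) (fun k => dot W (q k) * dot W (q k))).
      + apply (CV_mult (fun _ => dot W W) (fun k => dot (q k) (q k))); auto. apply Un_cv_const.
      + apply (CV_mult (fun k => dot W (q k)) (fun k => dot W (q k))); auto.
    - apply (CV_mult (fun k => dot W W * dot (q k) (q k)) 
        (fun k => dot (W [-] / INR (S k) [*] q k) (W [-] / INR (S k) [*] q k))); auto.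
      apply (CV_mult (fun _ => dot W W) (fun k => dot (q k) (q k))); auto. apply Un_cv_const. }
  rewrite HVV, !Rmult_1_r in L. exact L.
Qed.

(** [ae_S1] controls the parameters in [0, 1) only; each induction step adds one translate at either
    end. *)
Lemma null_periodic (P : R -> Prop) : (forall t, P (t + 1) <-> P t) -> ae_S1 P ->
  forall m : nat, null_set (fun t => - INR m <= t < INR m /\ ~ P t).
Proof.
  intros HP H. 
  assert (G : forall k t, P (t + INR k) <-> P t).
  { induction k as [|k IH]; intros t; [simpl; now rewrite Rplus_0_r|].
    rewrite S_INR. replace (t + (INR k + 1)) with (t + INR k + 1) by ring. now rewrite HP. }
  induction m as [|m IH].
  - eapply null_subset; [|apply null_empty]. simpl. intros t [Ht _]. lra.
  - pose proof (null_shift _ (INR (S m)) H) as N1. pose proof (null_shift _ (- INR m) H) as N2.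
    eapply null_subset; [|apply (null_union _ _ IH (null_union _ _ N1 N2))].
    intros t [Ht Hn]. rewrite S_INR in *.
    destruct (Rlt_le_dec t (- INR m)) as [h1|h1]; [right; left | destruct (Rlt_le_dec t (INR m)) as [h2|h2]; [left|right; right]].
    + split; [lra|]. intros Hc. apply Hn. apply (G (S m)). rewrite S_INR. exact Hc.
    + split; [lra|auto].
    + split; [lra|]. intros Hc. apply Hn. apply (G m) in Hc.
      replace (t + - INR m + INR m) with t in Hc by ring. exact Hc.
Qed.

Definition unit_speed (g : curve) (t : R) : Prop := exists v, has_deriv g t v /\ vnorm v = 1.

Lemma unit_speed_periodic g : periodic1 g -> forall t, unit_speed g (t + 1) <-> unit_speed g t.
Proof.
  intros Hp t. split; intros (v & Hv & Nv); exists v; split; auto.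
  - apply has_deriv_ext with (fun s => g (s + 1)); [apply Hp|]. now apply has_deriv_shift.
  - apply has_deriv_ext with (fun s => g (s + -1)).
    + intros s. rewrite <- (Hp (s + -1)). f_equal. ring.
    + apply has_deriv_shift. replace (t + 1 + -1) with t by ring. exact Hv.
Qed.

(** A quantitative form of C^{1,1}: second order Taylor bound and Lipschitz tangent. K need not be
    sharp, as the sharp constant D is kept separately in [thick_at_least]. *)
Definition c11 (g : curve) (T : R -> V3) (K : R) : Prop :=
  0 <= K /\ (forall s, vnorm (T s) = 1) /\
  (forall s u, Rabs (u - s) <= 1 -> vnorm (g u [-] g s [-] (u - s) [*] T s) <= K * (u - s) ^ 2) /\
  (forall s u, vnorm (T s [-] T u) <= K * Rabs (s - u)).

(** The increment from s + h to s + 2h is expanded at s + h and, as a difference of two increments,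
    at s. The errors K h^2, 4K h^2 and K h^2 add up to 6K h^2. For h > 1/2 the bound 4h exceeds 2,
    the largest distance of unit vectors. *)
Lemma c11_of_quad g T K : 0 <= K -> (forall s, vnorm (T s) = 1) ->
  (forall s u, Rabs (u - s) <= 1 -> vnorm (g u [-] g s [-] (u - s) [*] T s) <= K * (u - s) ^ 2) ->
  c11 g T (6 * K + 4).
Proof.
  intros HK H1 Hq. split; [lra|split; [auto|split]].
  - intros s u Hu. eapply Rle_trans; [apply Hq; auto|]. pose proof (pow2_ge_0 (u - s)); nra.
  - assert (G : forall s h, 0 < h -> vnorm (T s [-] T (s + h)) <= (6 * K + 4) * h).
    { intros s h Hh. destruct (Rle_lt_dec h (1 / 2)) as [h2|h2].
      - pose proof (Hq s (s + h) ltac:(apply Rabs_le; lra)) as Q1.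
        pose proof (Hq s (s + 2 * h) ltac:(apply Rabs_le; lra)) as Q2.
        pose proof (Hq (s + h) (s + 2 * h) ltac:(apply Rabs_le; lra)) as Q3.
        replace (s + h - s) with h in Q1 by ring. replace (s + 2 * h - s) with (2 * h) in Q2 by ring.
        replace (s + 2 * h - (s + h)) with h in Q3 by ring.
        apply (Rmult_le_reg_l h); auto.
        rewrite <- (Rabs_pos_eq h) at 1 by lra. rewrite <- vnorm_scal.
        replace (h [*] (T s [-] T (s + h))) with
          ((g (s + 2 * h) [-] g (s + h) [-] h [*] T (s + h)) [-]
           ((g (s + 2 * h) [-] g s [-] (2 * h) [*] T s) [-] (g (s + h) [-] g s [-] h [*] T s)))
          by vring.
        eapply Rle_trans; [apply vnorm_sub|].
        pose proof (vnorm_sub (g (s + 2 * h) [-] g s [-] (2 * h) [*] T s) (g (s + h) [-] g s [-] h [*] T s)).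
        nra.
      - pose proof (vnorm_sub (T s) (T (s + h))) as Hs. rewrite !H1 in Hs. nra. }
    apply lipschitz_of_le. intros a b [Hab| ->]; [|rewrite vsub_self, vnorm_zero; lra].
    pose proof (G a (b - a) ltac:(lra)) as E. rewrite vnorm_sub_sym.
    replace (a + (b - a)) with b in E by ring. exact E.
Qed.

Section Regularity.
Variables (g : curve) (L D : R).
Hypotheses (HL : lipschitz L g) (HD : 0 < D) (Hthick : thick_at_least g D)
  (Hinj : injective_S1 g) (Hper : periodic1 g) (Hae : ae_S1 (unit_speed g)).

(** The bound 1/2 keeps chords nonzero by injectivity modulo 1. The bound D/(L + 1) keeps chord
    lengths w at most D, so that (w/(2D))^2 <= 1/4. *)
Let h0 : R := Rmin (1 / 2) (D / (L + 1)).

Lemma h0_spec : 0 < h0 /\ h0 <= 1 / 2 /\ L * h0 <= D.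
Proof.
  pose proof (lip_nonneg _ _ HL). unfold h0. repeat split.
  - apply Rmin_glb_lt; [lra | apply Rdiv_lt_0_compat; lra].
  - apply Rmin_l.
  - apply Rle_trans with ((L + 1) * (D / (L + 1))); [|right; field; lra].
    pose proof (Rmin_r (1 / 2) (D / (L + 1))). pose proof (Rmin_l (1 / 2) (D / (L + 1))).
    assert (0 <= Rmin (1 / 2) (D / (L + 1))).
    { apply Rmin_glb; [lra | left; apply Rdiv_lt_0_compat; lra]. }
    nra.
Qed.

(* The tangential component of the chord cannot vanish on (0, h0] by [tangent_circle],
   so it keeps the sign it has near 0. *)
Lemma chord_forward s V sg h : has_deriv g s V -> vnorm V = 1 -> sg = 1 \/ sg = -1 -> 0 < h <= h0 ->
  let W := g (s + sg * h) [-] g s in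
  0 < vnorm W /\ vnorm W <= L * h /\ vnorm W * (1 - (vnorm W / (2 * D)) ^ 2) <= sg * dot W V.
Proof.
  intros HV H1 Hsg Hh. destruct h0_spec as (P0 & P1 & P2).
  pose proof (lip_nonneg _ _ HL) as HL0.
  assert (Hsq : sg * sg = 1) by (destruct Hsg as [-> | ->]; ring).
  assert (Hab : Rabs sg = 1) by (destruct Hsg as [-> | ->]; [apply Rabs_R1 | rewrite Rabs_left; lra]).
  set (d := fun h => sg * dot (g (s + sg * h) [-] g s) V).
  assert (Hw : forall h, 0 < h <= h0 -> 0 < vnorm (g (s + sg * h) [-] g s) /\
     vnorm (g (s + sg * h) [-] g s) <= L * h).
  { intros k Hk. split.
    - apply dist3_pos. intros E. destruct (Hinj _ _ E) as (z & Hz).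
      assert (Hz1 : sg * k = IZR z) by lra.
      destruct Hsg as [-> | ->].
      + assert (0 < IZR z < 1) as [K1 K2] by lra. apply lt_IZR in K1. apply lt_IZR in K2. lia.
      + assert (-1 < IZR z < 0) as [K1 K2] by lra. apply lt_IZR in K1. apply lt_IZR in K2. lia.
    - pose proof (HL (s + sg * k) s) as K. replace (s + sg * k - s) with (sg * k) in K by ring.
      rewrite Rabs_mult, Hab, (Rabs_pos_eq k) in K by lra. lra. }
  assert (Hd2 : forall h, 0 < h <= h0 -> let w := vnorm (g (s + sg * h) [-] g s) in
     w * w * (1 - (w / (2 * D)) ^ 2) <= d h * d h).
  { intros k Hk w. pose proof (tangent_circle g D s V (s + sg * k) Hthick HV H1) as K. cbv zeta in K.
    rewrite <- vnorm_sq in K. fold w in K. set (z := dot _ V) in K.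
    replace (d k * d k) with (sg * sg * (z * z)) by (unfold d, z; ring). rewrite Hsq, Rmult_1_l.
    apply (Rmult_le_reg_l (4 * D * D)); [nra|].
    replace (4 * D * D * (w * w * (1 - (w / (2 * D)) ^ 2))) with (4 * D * D * (w * w) - w * w * (w * w)) by (field; lra).
    lra. }
  assert (Hq : forall h, 0 < h <= h0 -> let w := vnorm (g (s + sg * h) [-] g s) in 0 < w * w * (1 - (w / (2 * D)) ^ 2)
     /\ 3 / 4 <= 1 - (w / (2 * D)) ^ 2 <= 1).
  { intros k Hk w. destruct (Hw k Hk) as [w0 w1]. fold w in w0, w1.
    assert (0 <= w / (2 * D) <= 1 / 2).
    { split; [left; apply Rdiv_lt_0_compat; lra|]. apply (Rmult_le_reg_r (2 * D)); [lra|].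
      unfold Rdiv at 1. rewrite Rmult_assoc, Rinv_l by lra. nra. }
    assert (3 / 4 <= 1 - (w / (2 * D)) ^ 2 <= 1) by nra. split; auto. nra. }
  assert (Hcont : forall x, continuity_pt d x).
  { intros x. apply lip_continuity_pt with L. intros a b. unfold d.
    replace (sg * dot (g (s + sg * a) [-] g s) V - sg * dot (g (s + sg * b) [-] g s) V)
      with (sg * dot (g (s + sg * a) [-] g (s + sg * b)) V) by (dots; ring).
    rewrite Rabs_mult, Hab, Rmult_1_l.
    eapply Rle_trans; [apply dot_abs_le|]. rewrite H1, Rmult_1_r.
    eapply Rle_trans; [apply HL|]. right. f_equal.
    replace (s + sg * a - (s + sg * b)) with (sg * (a - b)) by ring. rewrite Rabs_mult, Hab. ring. }
  assert (Hsmall : exists k, 0 < k /\ k < h /\ 0 < d k).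
  { destruct (local_lip_derivable g s V (1 / 2) HV ltac:(lra)) as (eta & He & Hloc).
    set (k := Rmin (eta / 2) (h / 2)).
    assert (0 < k) by (apply Rmin_glb_lt; lra).
    assert (k <= eta / 2) by apply Rmin_l. assert (k <= h / 2) by apply Rmin_r.
    exists k. split; [auto|split; [lra|]].
    pose proof (Hloc (s + sg * k)) as K. replace (s + sg * k - s) with (sg * k) in K by ring.
    rewrite Rabs_mult, Hab, (Rabs_pos_eq k) in K by lra. specialize (K ltac:(lra)).
    pose proof (dot_ge (g (s + sg * k) [-] g s [-] (sg * k) [*] V) (sg [*] V)) as E.
    rewrite vnorm_scal, Hab, H1 in E. revert E. unfold d. dots. rewrite (unit_dot V H1). intros E.
    replace (sg * k * (sg * 1)) with (sg * sg * k) in E by ring. rewrite Hsq in E. lra. }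
  intros W. destruct (Hw h Hh) as [w0 w1]. fold W in w0, w1. split; [auto|split; [auto|]].
  change (sg * dot W V) with (d h).
  assert (Hpos : 0 < d h).
  { destruct (Rlt_le_dec 0 (d h)) as [E|E]; auto. exfalso.
    destruct Hsmall as (k & k0 & k1 & k2).
    destruct (IVT_cor d k h) as (z & Hz & Ez); [intros x; apply Hcont | lra | nra|].
    pose proof (Hd2 z ltac:(lra)). destruct (Hq z ltac:(lra)). rewrite Ez in H. simpl in *. lra. }
  pose proof (Hd2 h Hh) as E2. destruct (Hq h Hh) as [_ E3]. cbv zeta in E2, E3. fold W in E2, E3.
  set (w := vnorm W) in *. set (q := 1 - (w / (2 * D)) ^ 2) in *.
  (* Since 0 < q <= 1, the bound d^2 >= w^2 q yields d >= w q without a square root. *)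
  apply Rnot_lt_le. intros Hlt. assert (d h * d h < (w * q) * (w * q)) by nra.
  assert (w * w * q * q <= w * w * q) by nra. nra.
Qed.

(** The squared distance of the two unit vectors is 2 - 2 sg <W,V>/w, which [chord_forward] bounds
    by 2 (w/(2D))^2. *)
Lemma chord_direction s V sg h : has_deriv g s V -> vnorm V = 1 -> sg = 1 \/ sg = -1 -> 0 < h <= h0 ->
  let W := g (s + sg * h) [-] g s in vnorm (V [-] (sg / vnorm W) [*] W) <= L / D * h.
Proof.
  intros HV H1 Hsg Hh W. destruct (chord_forward s V sg h HV H1 Hsg Hh) as (w0 & w1 & w2).
  fold W in w0, w1, w2. set (w := vnorm W) in *.
  assert (Hsq : sg * sg = 1) by (destruct Hsg as [-> | ->]; ring).
  apply Rle_trans with (w / D).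
  2: { replace (L / D * h) with (L * h / D) by (unfold Rdiv; ring).
       apply Rmult_le_compat_r; [left; now apply Rinv_0_lt_compat | auto]. }
  apply vnorm_le; [left; now apply Rdiv_lt_0_compat|].
  dots. rewrite (unit_dot V H1), (dot_sym V W), <- (vnorm_sq W). fold w.
  replace (1 - sg / w * dot W V - (sg / w * dot W V - sg / w * (sg / w * (w * w)))) with
    (1 - 2 * (sg * dot W V) / w + sg * sg) by (field; lra).
  rewrite Hsq.
  assert (1 - (w / (2 * D)) ^ 2 <= sg * dot W V / w).
  { apply (Rmult_le_reg_l w); auto. replace (w * (sg * dot W V / w)) with (sg * dot W V) by (field; lra). auto. }
  replace (w / D * (w / D)) with (4 * (w / (2 * D)) ^ 2) by (field; lra).
  replace (2 * (sg * dot W V) / w) with (2 * (sg * dot W V / w)) by (field; lra).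
  pose proof (pow2_ge_0 (w / (2 * D))). lra.
Qed.

(** Both velocities are close to the unit vector of their common chord, seen forwards from one end
    and backwards from the other. *)
Lemma velocity_lipschitz s t V U : has_deriv g s V -> vnorm V = 1 -> has_deriv g t U -> vnorm U = 1 ->
  Rabs (s - t) <= h0 -> vnorm (V [-] U) <= 2 * L / D * Rabs (s - t).
Proof.
  assert (G : forall s t V U, has_deriv g s V -> vnorm V = 1 -> has_deriv g t U -> vnorm U = 1 ->
    s < t -> t - s <= h0 -> vnorm (V [-] U) <= 2 * L / D * (t - s)).
  { clear s t V U. intros s t V U HV NV HU NU Hst Hle.
    pose proof (chord_direction s V 1 (t - s) HV NV ltac:(auto) ltac:(lra)) as K1.
    pose proof (chord_direction t U (-1) (t - s) HU NU ltac:(auto) ltac:(lra)) as K2.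
    cbv zeta in K1, K2. replace (s + 1 * (t - s)) with t in K1 by ring.
    replace (t + -1 * (t - s)) with s in K2 by ring.
    replace ((-1 / vnorm (g s [-] g t)) [*] (g s [-] g t)) with ((1 / vnorm (g t [-] g s)) [*] (g t [-] g s)) in K2.
    2: { rewrite (vnorm_sub_sym (g s)). unfold Rdiv. set (iv := / vnorm _). clearbody iv. vring. }
    eapply Rle_trans; [apply vnorm_sub3 with (v := (1 / vnorm (g t [-] g s)) [*] (g t [-] g s))|].
    rewrite (vnorm_sub_sym _ U). replace (2 * L / D * (t - s)) with (L / D * (t - s) + L / D * (t - s)) by (field; lra). lra. }
  intros HV NV HU NU. destruct (Rtotal_order s t) as [h|[->|h]]; intros Hle.
  - rewrite Rabs_left in * by lra. replace (- (s - t)) with (t - s) in * by ring. auto.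
  - rewrite (has_deriv_unique g t V U) by auto. rewrite vsub_self, vnorm_zero, Rminus_diag, Rabs_R0. lra.
  - rewrite Rabs_pos_eq in * by lra. rewrite vnorm_sub_sym. auto.
Qed.

Lemma bad_null a b : null_set (fun t => a <= t <= b /\ ~ unit_speed g t).
Proof.
  destruct (INR_unbounded (Rmax (Rabs a) (Rabs b))) as (m & Hm).
  pose proof (null_periodic _ (unit_speed_periodic g Hper) Hae m) as N.
  eapply null_subset; [|apply N]. intros t [Ht Hn]. split; auto.
  pose proof (Rmax_l (Rabs a) (Rabs b)). pose proof (Rmax_r (Rabs a) (Rabs b)).
  pose proof (Rle_abs b). pose proof (Rle_abs (- a)). rewrite Rabs_Ropp in *. lra.
Qed.

(** Here [sg] is a parameter with unit velocity V, not a sign. All velocities that exist within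
    distance r of it are close to V, and the remaining parameters form a null set for the mean value
    inequality. *)
Lemma near_good sg V r u v : has_deriv g sg V -> vnorm V = 1 -> r <= h0 ->
  sg - r <= u -> u <= v -> v <= sg + r ->
  vnorm (g v [-] g u [-] (v - u) [*] V) <= 2 * L / D * r * (v - u).
Proof.
  intros HV NV Hr H1 H2 H3. pose proof (lip_nonneg _ _ HL).
  replace (g v [-] g u [-] (v - u) [*] V) with ((g v [-] v [*] V) [-] (g u [-] u [*] V)) by vring.
  assert (0 <= r) by lra.
  assert (HK : 0 <= 2 * L / D) by (apply Rmult_le_pos; [lra | left; now apply Rinv_0_lt_compat]).
  apply (mean_value_ineq_ae (fun t => g t [-] t [*] V) (fun t => u <= t <= v /\ ~ unit_speed g t) u v (L + 1));
    auto; try lra; [nra | apply bad_null | |].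
  - intros t Ht. exists 1. split; [lra|]. intros x y Hx Hy _ _.
    replace (g y [-] y [*] V [-] (g x [-] x [*] V)) with ((g y [-] g x) [-] (y - x) [*] V) by vring.
    eapply Rle_trans; [apply vnorm_sub|]. rewrite vnorm_scal, NV.
    pose proof (HL y x) as K. rewrite Rabs_pos_eq in * by lra. lra.
  - intros t Ht Hn del Hdel.
    assert (unit_speed g t) as (U & HU & NU) by (apply NNPP; intros E; apply Hn; split; auto).
    destruct (derivable_straddle g t U del HU Hdel) as (eta & He & Hloc).
    exists eta. split; auto. intros x y Hx Hy h1 h2.
    replace (g y [-] y [*] V [-] (g x [-] x [*] V)) with ((g y [-] g x [-] (y - x) [*] U) [-] (y - x) [*] (V [-] U)) by vring.
    eapply Rle_trans; [apply vnorm_sub|]. rewrite vnorm_scal, (Rabs_pos_eq (y - x)) by lra.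
    pose proof (Hloc x y ltac:(lra) ltac:(lra) h1 h2).
    assert (Hd : Rabs (sg - t) <= r) by (apply Rabs_le; lra).
    pose proof (velocity_lipschitz sg t V U HV NV HU NU ltac:(lra)).
    assert (vnorm (V [-] U) <= 2 * L / D * r) by nra. nra.
Qed.

Lemma regularity : exists T K, c11 g T K.
Proof.
  destruct h0_spec as (P0 & P1 & P2). pose proof (lip_nonneg _ _ HL) as HL0.
  set (K1 := 2 * L / D).
  assert (HK1 : 0 <= K1) by (apply Rmult_le_pos; [lra | left; now apply Rinv_0_lt_compat]).
  (* For |u - s| > h0/2 the crude bound (L + 1)|u - s| is absorbed into a quadratic one with this
     constant. *)
  set (K2 := (L + 1) * (2 / h0)).
  assert (HK2 : 0 <= K2) by (apply Rmult_le_pos; [lra | left; apply Rdiv_lt_0_compat; lra]).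
  set (K := K1 + K2).
  assert (A : forall s eps, 0 < eps -> exists e, vnorm e = 1 /\ forall u, Rabs (u - s) <= 1 ->
     vnorm (g u [-] g s [-] (u - s) [*] e) <= K * (u - s) ^ 2 + eps).
  { intros s eps Heps.
    (* There may be no velocity at s itself. A good parameter within d of s is used instead, at the
       cost K1 d |u - s| <= eps. *)
    destruct (small_positive (h0 / 2) eps (K1 + 1)) as (d & Hd & Hd1 & Hd2); try lra.
    destruct (null_no_interval _ s (s + d) ltac:(lra) (bad_null s (s + d))) as (sg & Hsg & Hn).
    assert (unit_speed g sg) as (V & HV & NV) by (apply NNPP; intros E; apply Hn; split; auto; lra).
    exists V. split; auto. intros u Hu.
    destruct (Rle_lt_dec (Rabs (u - s)) (h0 / 2)) as [hs|hs].
    - assert (Q : vnorm (g u [-] g s [-] (u - s) [*] V) <= K1 * (Rabs (u - s) + d) * Rabs (u - s)).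
      { destruct (Rle_lt_dec s u) as [h|h].
        - rewrite Rabs_pos_eq in * by lra. eapply Rle_trans; [apply (near_good sg V (u - s + d) s u); auto; lra | unfold K1; lra].
        - rewrite Rabs_left in * by lra.
          replace (g u [-] g s [-] (u - s) [*] V) with ((-1) [*] (g s [-] g u [-] (s - u) [*] V))
            by vring.
          rewrite vnorm_scal, Rabs_left by lra. replace (- -1) with 1 by ring. rewrite Rmult_1_l.
          replace (- (u - s)) with (s - u) in * by ring.
          eapply Rle_trans; [apply (near_good sg V (s - u + d) u s); auto; lra | unfold K1; lra]. }
      rewrite <- (pow2_abs (u - s)).
      pose proof (Rabs_pos (u - s)). set (a := Rabs (u - s)) in *. replace (a ^ 2) with (a * a) by ring.
      assert (K1 * d * a <= eps) by nra. assert (0 <= K2 * (a * a)) by (apply Rmult_le_pos; nra).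
      unfold K. nra.
    - eapply Rle_trans; [apply vnorm_sub|]. rewrite vnorm_scal, NV. pose proof (HL u s) as Hl.
      rewrite <- (pow2_abs (u - s)).
      set (a := Rabs (u - s)) in *. replace (a ^ 2) with (a * a) by ring.
      assert ((L + 1) * a <= K2 * (a * a)).
      { unfold K2. assert (1 <= 2 / h0 * a).
        { apply (Rmult_le_reg_l h0); auto. replace (h0 * (2 / h0 * a)) with (2 * a) by (field; lra). lra. }
        assert (0 <= (L + 1) * a) by nra.
        replace ((L + 1) * (2 / h0) * (a * a)) with ((L + 1) * a * (2 / h0 * a)) by ring. nra. }
      assert (0 <= K1 * (a * a)) by (apply Rmult_le_pos; nra). unfold K. nra. }
  assert (Hex : forall s, exists V, vnorm V = 1 /\ forall u, Rabs (u - s) <= 1 ->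
     vnorm (g u [-] g s [-] (u - s) [*] V) <= K * (u - s) ^ 2).
  { intros s. apply tangent_exists; [unfold K; lra | apply A]. }
  destruct (choose_fun _ Hex) as (T & HT).
  exists T, (6 * K + 4). apply c11_of_quad; [unfold K; lra | apply HT | intros s u; apply HT].
Qed.
End Regularity.

(** * Inscribed equilateral polygons *)

Section Inscribed.
Variables (g : curve) (T : R -> V3) (K : R).
Hypotheses (HT : c11 g T K) (Hper : periodic1 g).

Lemma c11_near s r a b : 2 * r <= 1 -> s - r <= a -> a <= b -> b <= s + r ->
  vnorm (g b [-] g a [-] (b - a) [*] T s) <= 3 * K * r * (b - a).
Proof.
  intros Hr H1 H2 H3. destruct HT as (HK & N1 & Hq & Hl).
  replace (g b [-] g a [-] (b - a) [*] T s) with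
    ((g b [-] g a [-] (b - a) [*] T a) [+] (b - a) [*] (T a [-] T s)) by vring.
  eapply Rle_trans; [apply vnorm_add|]. rewrite vnorm_scal, (Rabs_pos_eq (b - a)) by lra.
  pose proof (Hq a b ltac:(apply Rabs_le; lra)) as Q. pose proof (Hl a s) as L.
  assert (Rabs (a - s) <= r) by (apply Rabs_le; lra).
  assert (vnorm (T a [-] T s) <= K * r) by nra.
  assert (K * (b - a) ^ 2 <= K * (2 * r) * (b - a)).
  { replace (K * (b - a) ^ 2) with (K * (b - a) * (b - a)) by ring.
    apply Rmult_le_compat_r; [lra|]. apply Rmult_le_compat_l; lra. }
  nra.
Qed.

Lemma c11_lip : lipschitz 1 g.
Proof.
  apply lipschitz_of_le. intros a b Hab. apply mean_value_ineq; auto; [lra|].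
  intros t Ht del Hdel. destruct HT as (HK & N1 & _).
  destruct (small_positive (1 / 2) del (3 * K + 1)) as (r & Hr & Hr1 & Hr2); try lra.
  exists r. split; auto. intros x y Hx Hy h1 h2.
  pose proof (c11_near t r x y ltac:(lra) ltac:(lra) ltac:(lra) ltac:(lra)) as E.
  pose proof (vnorm_sub_ge (g y [-] g x) ((y - x) [*] T t)) as F.
  rewrite vnorm_scal, N1, Rabs_pos_eq in F by lra. nra.
Qed.

Lemma chord_short s h : 0 <= h <= 1 -> h - K * h ^ 2 <= vnorm (g (s + h) [-] g s).
Proof.
  intros Hh. destruct HT as (HK & N1 & Hq & _).
  pose proof (Hq s (s + h) ltac:(apply Rabs_le; lra)) as E. replace (s + h - s) with h in E by ring.
  pose proof (vnorm_sub_ge (h [*] T s) (g (s + h) [-] g s)) as F.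
  rewrite vnorm_scal, N1, Rabs_pos_eq, vnorm_sub_sym in F by lra.
  rewrite vnorm_sub_sym in F. rewrite vnorm_sub_sym in E. lra.
Qed.

(** Short chords are at least half as long as the arc by the Taylor bound; the others have a
    positive minimum by compactness and injectivity. Modulo 1 any two parameters differ by at most
    1/2. *)
Lemma bilipschitz : injective_S1 g ->
  exists lam, 0 < lam /\ forall s h, Rabs h <= 1 / 2 -> lam * Rabs h <= vnorm (g (s + h) [-] g s).
Proof.
  intros Hinj. pose proof HT as (HK & _).
  destruct (small_positive (1 / 2) (1 / 2) (K + 1)) as (d & Hd & Hd1 & Hd2); try lra.
  destruct (min_chord g 1 d (1 / 2) Hper c11_lip Hd1) as (s1 & h1 & Hh1 & Hmin).
  set (m := vnorm (g (s1 + h1) [-] g s1)) in *.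
  assert (Hm : 0 < m).
  { apply dist3_pos. intros E. destruct (Hinj _ _ E) as (z & Hz).
    assert (0 < IZR z < 1) as [K1 K2] by lra. apply lt_IZR in K1. apply lt_IZR in K2. lia. }
  set (lam := Rmin (1 / 2) m).
  assert (Hl1 : lam <= 1 / 2) by apply Rmin_l. assert (Hl2 : lam <= m) by apply Rmin_r.
  assert (Hl : 0 < lam) by (apply Rmin_glb_lt; lra).
  exists lam. split; auto.
  assert (G : forall s h, 0 <= h <= 1 / 2 -> lam * h <= vnorm (g (s + h) [-] g s)).
  { intros s h Hh. destruct (Rle_lt_dec h d).
    - pose proof (chord_short s h ltac:(lra)). assert (K * h <= 1 / 2) by nra. nra.
    - pose proof (Hmin s h ltac:(lra)). nra. }
  intros s h Hh. destruct (Rle_lt_dec 0 h).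
  - rewrite Rabs_pos_eq in * by lra. apply G. lra.
  - rewrite Rabs_left in * by lra. rewrite vnorm_sub_sym.
    pose proof (G (s + h) (- h) ltac:(lra)) as E. replace (s + h + - h) with s in E by ring. exact E.
Qed.

(** With 24 K h0 <= 1 every increment deviates from the direction T t by at most 1/8 of its
    parameter length. Hence the added piece v points forwards relative to w, and the chord grows at
    rate at least 1/2. *)
Lemma chord_increasing t h0 h1 h2 : 2 * h0 <= 1 -> 24 * K * h0 <= 1 -> 0 <= h1 -> h1 <= h2 -> h2 <= h0 ->
  (h2 - h1) / 2 <= vnorm (g (t + h2) [-] g t) - vnorm (g (t + h1) [-] g t).
Proof.
  intros A1 A2 A3 A4 A5. pose proof HT as (HK & N1 & _).
  pose proof (c11_near t h0 t (t + h1) A1 ltac:(lra) ltac:(lra) ltac:(lra)) as E1.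
  pose proof (c11_near t h0 (t + h1) (t + h2) A1 ltac:(lra) ltac:(lra) ltac:(lra)) as E2.
  replace (t + h1 - t) with h1 in E1 by ring. replace (t + h2 - (t + h1)) with (h2 - h1) in E2 by ring.
  set (a := h2 - h1) in *. set (w := g (t + h1) [-] g t) in *. set (v := g (t + h2) [-] g (t + h1)) in *.
  replace (g (t + h2) [-] g t) with (w [+] v) by (unfold w, v; vring).
  set (e1 := w [-] h1 [*] T t) in *. set (e2 := v [-] a [*] T t) in *.
  assert (F1 : vnorm e1 <= h1 / 8) by nra.
  assert (Ha : 0 <= a) by (unfold a; lra).
  assert (F2 : vnorm e2 <= a / 8) by nra.
  assert (Nw : vnorm w <= 9 / 8 * h1).
  { replace w with (e1 [+] h1 [*] T t) by (unfold e1; clearbody w; vring).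
    eapply Rle_trans; [apply vnorm_add|]. rewrite vnorm_scal, N1, Rabs_pos_eq by lra. lra. }
  assert (Nv : a / 2 <= vnorm v).
  { pose proof (vnorm_sub_ge (a [*] T t) v) as G. rewrite vnorm_sub_sym in G. fold e2 in G.
    rewrite vnorm_scal, N1, Rabs_pos_eq in G by lra. lra. }
  assert (Dvw : a * h1 * (1 - 2 / 8 - 1 / 64) <= dot v w).
  { replace (dot v w) with (a * h1 * dot (T t) (T t) + a * dot (T t) e1 + h1 * dot e2 (T t) + dot e2 e1).
    2: { unfold e1, e2. clearbody w v. vring. }
    rewrite (unit_dot _ (N1 t)).
    pose proof (dot_ge (T t) e1) as G1. pose proof (dot_ge e2 (T t)) as G2. pose proof (dot_ge e2 e1) as G3.
    rewrite N1 in G1, G2. pose proof (vnorm_nonneg e1). pose proof (vnorm_nonneg e2).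
    assert (vnorm e2 * vnorm e1 <= a / 8 * (h1 / 8)) by (apply Rmult_le_compat; auto).
    nra. }
  assert (vnorm w + a / 2 <= vnorm (w [+] v)); [|lra].
  apply vnorm_ge. dots. rewrite (dot_sym w v), <- (vnorm_sq w), <- (vnorm_sq v).
  assert (a * vnorm w <= 2 * dot v w) by nra.
  nra.
Qed.

(** For a chord length l, chords are laid off n times along g starting at parameter 0. The final
    parameter depends continuously on l, and the intermediate value theorem picks the l for which it
    equals 1, so that the polygon closes up. *)
Lemma inscribed_equilateral del : 0 < del -> exists N, (1 <= N)%nat /\ forall n, (N <= n)%nat ->
  exists l (t : nat -> R), 0 < l /\ t 0%nat = 0 /\ t n = 1 /\
    forall k, vnorm (g (t (S k)) [-] g (t k)) = l /\ l <= t (S k) - t k /\ t (S k) - t k <= del /\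
      t (S k) - t k <= l + K * (t (S k) - t k) ^ 2.
Proof.
  intros Hdel. pose proof HT as (HK & N1 & _). pose proof c11_lip as HL.
  set (h0 := Rmin del (Rmin (1 / 2) (1 / (24 * K + 1)))).
  assert (H0 : 0 < h0) by (repeat apply Rmin_glb_lt; try lra; apply Rdiv_lt_0_compat; lra).
  assert (H1 : h0 <= del) by apply Rmin_l.
  assert (H2 : h0 <= 1 / 2) by (eapply Rle_trans; [apply Rmin_r | apply Rmin_l]).
  assert (H3 : 24 * K * h0 <= 1).
  { assert ((24 * K + 1) * h0 <= 1); [|lra].
    apply mul_le_of_le_div; [lra|]. eapply Rle_trans; [apply Rmin_r | apply Rmin_r]. }
  set (Dc := fun t h => vnorm (g (t + h) [-] g t)).
  assert (HD0 : forall t, Dc t 0 = 0).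
  { intros t. unfold Dc. rewrite Rplus_0_r, vsub_self. apply vnorm_zero. }
  assert (Hinc : forall t a b, 0 <= a -> a <= b -> b <= h0 -> (b - a) / 2 <= Dc t b - Dc t a).
  { intros. apply chord_increasing with h0; auto; lra. }
  set (l0 := h0 / 2).
  (* [H t l] is the parameter step from t that produces a chord of length l. It is unique and
     Lipschitz in both arguments, as chords grow at rate at least 1/2. *)
  assert (exists H : R -> R -> R, forall t l, 0 <= l <= l0 -> 0 <= H t l <= h0 /\ Dc t (H t l) = l) as (H & HH).
  { exists (fun t l => epsilon (inhabits 0) (fun h => 0 <= h <= h0 /\ Dc t h = l)).
    intros t l Hl. apply epsilon_spec.
    destruct (IVT_cor (fun h => Dc t h - l) 0 h0) as (z & Hz & Ez).
    - intros x. apply lip_continuity_pt with 1. intros a b. unfold Dc.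
      replace (_ - l - _) with (vnorm (g (t + a) [-] g t) - vnorm (g (t + b) [-] g t)) by ring.
      eapply Rle_trans; [apply vnorm_sub_lip|]. rewrite vsub_self, vnorm_zero, Rplus_0_r.
      eapply Rle_trans; [apply HL|]. right. f_equal. f_equal. ring.
    - lra.
    - rewrite HD0. pose proof (Hinc t 0 h0 ltac:(lra) ltac:(lra) ltac:(lra)) as E. rewrite HD0 in E.
      unfold l0 in Hl. nra.
    - exists z. split; auto. lra. }
  assert (Hlip : forall t t' l l', 0 <= l <= l0 -> 0 <= l' <= l0 ->
     Rabs (H t l - H t' l') <= 2 * (Rabs (l - l') + 2 * Rabs (t - t'))).
  { intros t t' l l' Hl Hl'. destruct (HH t l Hl) as [B1 E1]. destruct (HH t' l' Hl') as [B2 E2].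
    assert (P : Rabs (H t l - H t' l') <= 2 * Rabs (Dc t (H t l) - Dc t (H t' l'))).
    { destruct (Rle_lt_dec (H t l) (H t' l')) as [h|h].
      - pose proof (Hinc t _ _ ltac:(apply B1) h ltac:(apply B2)). rewrite !Rabs_left1 by lra. lra.
      - pose proof (Hinc t _ _ ltac:(apply B2) (Rlt_le _ _ h) ltac:(apply B1)). rewrite !Rabs_pos_eq by lra. lra. }
    eapply Rle_trans; [apply P|]. apply Rmult_le_compat_l; [lra|].
    replace (Dc t (H t l) - Dc t (H t' l')) with ((l - l') + (Dc t' (H t' l') - Dc t (H t' l'))) by lra.
    eapply Rle_trans; [apply Rabs_triang|]. apply Rplus_le_compat_l.
    unfold Dc. eapply Rle_trans; [apply vnorm_sub_lip|].
    pose proof (HL (t' + H t' l') (t + H t' l')) as L1. pose proof (HL t' t) as L2.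
    replace (t' + H t' l' - (t + H t' l')) with (t' - t) in L1 by ring.
    rewrite (Rabs_minus_sym t' t) in *. lra. }
  (* Clamping to [0, l0] makes the construction Lipschitz on the whole line, as [IVT_cor] asks for
     continuity everywhere. *)
  set (cl := fun l => Rmax 0 (Rmin l l0)).
  assert (Hcl : forall l, 0 <= cl l <= l0).
  { intros l. unfold cl. split; [apply Rmax_l|]. apply Rmax_lub; [unfold l0; lra | apply Rmin_r]. }
  assert (Hcll : forall a b, Rabs (cl a - cl b) <= Rabs (a - b)).
  { intros a b. unfold cl, Rmax, Rmin.
    destruct (Rle_dec a l0), (Rle_dec b l0);
    repeat match goal with |- context [Rle_dec ?x ?y] => destruct (Rle_dec x y) end;
    unfold Rabs; repeat match goal with |- context [Rcase_abs ?x] => destruct (Rcase_abs x) end;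
    unfold l0 in *; lra. }
  (* The parameter reached after k chords of length l. The name shadows the functional [F] inside
     this proof. *)
  set (F := fix F (k : nat) (l : R) : R := match k with O => 0 | S k => F k l + H (F k l) (cl l) end).
  assert (HF : forall k, exists C, forall a b, Rabs (F k a - F k b) <= C * Rabs (a - b)).
  { induction k as [|k [C HC]].
    - exists 0. intros. simpl. rewrite Rminus_diag, Rabs_R0. lra.
    - exists (C + 2 * (1 + 2 * C)). intros a b. simpl.
      replace (_ - _) with ((F k a - F k b) + (H (F k a) (cl a) - H (F k b) (cl b))) by ring.
      eapply Rle_trans; [apply Rabs_triang|].
      pose proof (Hlip (F k a) (F k b) (cl a) (cl b) (Hcl a) (Hcl b)). pose proof (Hcll a b).
      specialize (HC a b). lra. }
  assert (Hl0 : 0 < l0) by (unfold l0; lra).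
  (* A parameter step is at least as long as its chord, so n l0 >= 1 ensures that chords of length
     l0 reach at least parameter 1. *)
  destruct (INR_unbounded (/ l0)) as (N & HN).
  exists (S N). split; [lia|]. intros n Hn.
  assert (Hnl : 1 <= INR n * l0).
  { assert (INR N < INR n) by (apply lt_INR; lia).
    apply Rmult_le_reg_r with (/ l0); [now apply Rinv_0_lt_compat|].
    rewrite Rmult_assoc, Rinv_r by lra. lra. }
  assert (Hstep : forall t l, 0 <= l <= l0 -> l <= H t l).
  { intros t l Hl. destruct (HH t l Hl) as [B E]. rewrite <- E at 1. unfold Dc.
    eapply Rle_trans; [apply HL|]. rewrite Rmult_1_l.
    replace (t + H t l - t) with (H t l) by ring. rewrite Rabs_pos_eq; lra. }
  destruct (HF n) as (C & HC).
  destruct (IVT_cor (fun l => F n l - 1) 0 l0) as (l & Hl & El).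
  - intros x. apply lip_continuity_pt with C. intros a b. replace (_ - 1 - _) with (F n a - F n b) by ring. auto.
  - lra.
  - assert (E0 : F n 0 = 0).
    { clear - HH Hinc HD0 Hl0 H0. assert (cl 0 = 0) as Ec.
      { unfold cl. rewrite Rmin_left by lra. apply Rmax_left. lra. }
      assert (HZ : forall t, H t 0 = 0).
      { intros t. destruct (HH t 0 ltac:(lra)) as [B E].
        pose proof (Hinc t 0 (H t 0) ltac:(lra) ltac:(lra) ltac:(lra)) as I. rewrite HD0, E in I. lra. }
      induction n as [|n IH]; simpl; auto. rewrite IH, Ec, HZ. ring. }
    assert (E1 : INR n * l0 <= F n l0).
    { assert (cl l0 = l0) as Ec.
      { unfold cl. rewrite Rmin_left by lra. apply Rmax_right. lra. }
      clear - Hstep Ec Hl0. induction n as [|n IH]; [simpl; lra|].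
      rewrite S_INR. cbn [F]. fold F. rewrite Ec. pose proof (Hstep (F n l0) l0 ltac:(lra)). lra. }
    rewrite E0. nra.
  - assert (Ec : cl l = l).
    { unfold cl. rewrite Rmin_left by lra. apply Rmax_right. lra. }
    assert (Hpos : 0 < l).
    { destruct Hl as [[h|h] _]; auto. exfalso. subst l.
      assert (HZ : forall t, H t 0 = 0).
      { intros t. destruct (HH t 0 ltac:(lra)) as [B E].
        pose proof (Hinc t 0 (H t 0) ltac:(lra) ltac:(lra) ltac:(lra)) as I. rewrite HD0, E in I. lra. }
      assert (F n 0 = 0); [|lra]. clear - Ec HZ. induction n as [|n IH]; simpl; auto. rewrite IH, Ec, HZ. ring. }
    exists l, (fun k => F k l). split; [auto|split; [reflexivity|split; [lra|]]].
    intros k. cbn [F]. fold F. rewrite Ec. destruct (HH (F k l) l ltac:(lra)) as [B E].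
    replace (F k l + H (F k l) l - F k l) with (H (F k l) l) by ring.
    split; [exact E|split; [apply Hstep; lra|split; [lra|]]].
    pose proof (chord_short (F k l) (H (F k l) l) ltac:(lra)) as G. unfold Dc in E. lra.
Qed.
End Inscribed.

(** * Isotopies *)

Lemma homeo_comp f g : homeo f -> homeo g -> homeo (fun x => g (f x)).
Proof.
  assert (C : forall f g, cont_map f -> cont_map g -> cont_map (fun x => g (f x))).
  { intros u v Hu Hv x eps Heps. destruct (Hv (u x) eps Heps) as (d1 & Hd1 & K1).
    destruct (Hu x d1 Hd1) as (d2 & Hd2 & K2). exists d2. auto. }
  intros (Cf & f' & Cf' & Lf & Rf) (Cg & g' & Cg' & Lg & Rg). split; [auto|].
  exists (fun x => f' (g' x)). split; [auto|split].
  - intros x. now rewrite Lg, Lf.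
  - intros y. now rewrite Rf, Rg.
Qed.

Lemma ambient_isotopic_trans K1 K2 K3 :
  ambient_isotopic K1 K2 -> ambient_isotopic K2 K3 -> ambient_isotopic K1 K3.
Proof.
  intros (H & CH & HH & H0 & H1) (G & CG & HG & G0 & G1).
  exists (fun t x => G t (H t x)). repeat split.
  - intros t x eps Ht Heps. destruct (CG t (H t x) eps Ht Heps) as (d1 & Hd1 & E1).
    destruct (CH t x d1 Ht Hd1) as (d2 & Hd2 & E2).
    exists (Rmin d1 d2). split; [now apply Rmin_glb_lt|]. intros s y Hs h1 h2.
    pose proof (Rmin_l d1 d2). pose proof (Rmin_r d1 d2).
    apply E1; auto; [lra|]. apply E2; auto; lra.
  - intros x eps Heps. apply (homeo_comp (H t) (G t)); auto.
  - destruct (homeo_comp (H t) (G t) (HH t H2) (HG t H2)) as (_ & h). exact h.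
  - intros x. now rewrite H0, G0.
  - intros Hy. apply G1 in Hy. destruct Hy as (x' & Hx' & ->). apply H1 in Hx'.
    destruct Hx' as (x & Hx & ->). eauto.
  - intros (x & Hx & ->). apply G1. exists (H 1 x). split; auto. apply H1. eauto.
Qed.

Lemma pow_half_cv C : Un_cv (fun k => (1 / 2) ^ k * C) 0.
Proof.
  replace 0 with (0 * C) by ring. apply (CV_mult (fun k => (1 / 2) ^ k) (fun _ => C)); [|apply Un_cv_const].
  intros eps Heps. destruct (pow_lt_1_zero (1 / 2) ltac:(rewrite Rabs_pos_eq; lra) eps Heps) as (N & HN).
  exists N. intros n Hn. unfold Rdist. rewrite Rminus_0_r. apply HN. lia.
Qed.

(** Banach iteration for the contraction that maps x to y - Phi x. *)
Lemma contraction_solve (Phi : V3 -> V3) :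
  (forall x y, vnorm (Phi x [-] Phi y) <= 1 / 2 * vnorm (x [-] y)) ->
  forall y, exists x, x [+] Phi x = y.
Proof.
  intros HPhi y. set (X := fix X (k : nat) : V3 := match k with O => y | S k => y [-] Phi (X k) end).
  set (C := vnorm (Phi y)).
  assert (Hs : forall k, vnorm (X (S k) [-] X k) <= (1 / 2) ^ k * C).
  { induction k as [|k IH].
    - simpl. replace (y [-] Phi y [-] y) with ((-1) [*] Phi y) by vring.
      rewrite vnorm_scal, Rabs_left by lra. unfold C. lra.
    - change (X (S (S k))) with (y [-] Phi (X (S k))). change (X (S k)) with (y [-] Phi (X k)) at 2.
      replace (y [-] Phi (X (S k)) [-] (y [-] Phi (X k))) with (Phi (X k) [-] Phi (X (S k))) by vring.
      eapply Rle_trans; [apply HPhi|]. rewrite vnorm_sub_sym. simpl pow. lra. }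
  assert (HC : 0 <= C) by apply vnorm_nonneg.
  assert (Hkl : forall k j, vnorm (X k [-] X (k + j)%nat) <= ((1 / 2) ^ k * 2 - (1 / 2) ^ (k + j) * 2) * C).
  { intros k. induction j as [|j IH].
    - rewrite Nat.add_0_r, vsub_self, vnorm_zero. lra.
    - rewrite <- plus_n_Sm. pose proof (vnorm_sub3 (X k) (X (k + j)%nat) (X (S (k + j)))) as T.
      pose proof (Hs (k + j)%nat) as H1. rewrite vnorm_sub_sym in H1.
      change ((1 / 2) ^ S (k + j)) with (1 / 2 * (1 / 2) ^ (k + j)). nra. }
  destruct (vec_cauchy_rate X (fun k => (1 / 2) ^ k * (2 * C))) as (x & Hx).
  { apply pow_half_cv. }
  { intros k l H. replace l with (k + (l - k))%nat by lia. eapply Rle_trans; [apply Hkl|].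
    pose proof (pow_le (1 / 2) (k + (l - k)) ltac:(lra)). nra. }
  exists x. apply vsub_zero_inv. apply Rle_antisym; [|apply vnorm_nonneg].
  apply le_epsilon. intros eps Heps. destruct (pow_half_cv (4 * C) (eps / 2) ltac:(lra)) as (k & Hk).
  pose proof (Hk k ltac:(lia)) as K1. pose proof (Hk (S k) ltac:(lia)) as K2. unfold Rdist in K1, K2.
  rewrite Rminus_0_r in K1, K2. apply Rabs_def2 in K1, K2.
  pose proof (Hx k) as X1. pose proof (Hx (S k)) as X2.
  replace (x [+] Phi x [-] y) with ((Phi x [-] Phi (X k)) [-] (X (S k) [-] x)).
  2: { change (X (S k)) with (y [-] Phi (X k)). vring. }
  eapply Rle_trans; [apply vnorm_sub|]. pose proof (HPhi x (X k)) as P. rewrite (vnorm_sub_sym x) in P. lra.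
Qed.

(** The map shrinks distances at most by the factor 1/2, hence it is injective with a 2-Lipschitz
    inverse; surjectivity is [contraction_solve]. *)
Lemma perturbation_homeo (Phi : V3 -> V3) :
  (forall x y, vnorm (Phi x [-] Phi y) <= 1 / 2 * vnorm (x [-] y)) -> homeo (fun x => x [+] Phi x).
Proof.
  intros HPhi. split.
  - intros x eps Heps. exists (eps / 2). split; [lra|]. intros y Hy. unfold dist3 in *.
    replace (y [+] Phi y [-] (x [+] Phi x)) with ((y [-] x) [+] (Phi y [-] Phi x)) by vring.
    eapply Rle_lt_trans; [apply vnorm_add|]. pose proof (HPhi y x). lra.
  - pose proof (contraction_solve Phi HPhi) as HS.
    destruct (choose_fun _ HS) as (G & HG).
    assert (Hexp : forall x y, vnorm (x [-] y) <= 2 * vnorm (x [+] Phi x [-] (y [+] Phi y))).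
    { intros x y. pose proof (vnorm_sub_ge (x [-] y) (Phi y [-] Phi x)) as H.
      replace (x [-] y [-] (Phi y [-] Phi x)) with (x [+] Phi x [-] (y [+] Phi y)) in H by vring.
      pose proof (HPhi y x). rewrite (vnorm_sub_sym y x) in *. lra. }
    exists G. split; [|split].
    + intros x eps Heps. exists (eps / 2). split; [lra|]. intros y Hy. unfold dist3 in *.
      pose proof (Hexp (G y) (G x)) as H. rewrite !HG in H. lra.
    + intros x. apply vsub_zero_inv. apply Rle_antisym; [|apply vnorm_nonneg].
      pose proof (Hexp (G (x [+] Phi x)) x) as H. rewrite HG, vsub_self, vnorm_zero in H. lra.
    + exact HG.
Qed.

(** McShane's extension, the infimum over s of h(s) + L|x - g(s)|. The data are indexed by the
    parameter; the hypothesis makes them a well-defined function on the image of g. *)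
Lemma mcshane (g : curve) (h : R -> R) L : 0 <= L ->
  (forall s t, Rabs (h s - h t) <= L * vnorm (g s [-] g t)) ->
  exists phi : V3 -> R, (forall s, phi (g s) = h s) /\
    (forall x y, Rabs (phi x - phi y) <= L * vnorm (x [-] y)).
Proof.
  intros HL Hh. set (S := fun x r => exists s, r = h s + L * vnorm (x [-] g s)).
  assert (HS : forall x, is_glb (S x) (Rinf (S x))).
  { intros x. apply (Rinf_spec _ (h 0 - L * vnorm (x [-] g 0)) (h 0 + L * vnorm (x [-] g 0))).
    - intros r (s & ->). pose proof (Hh 0 s) as E. pose proof (Rle_abs (h 0 - h s)).
      pose proof (vnorm_sub3 (g 0) x (g s)). rewrite (vnorm_sub_sym (g 0) x) in *. nra.
    - exists 0. reflexivity. }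
  exists (fun x => Rinf (S x)). split.
  - intros s. destruct (HS (g s)) as [H1 H2]. apply Rle_antisym.
    + apply H1. exists s. rewrite vsub_self, vnorm_zero. ring.
    + apply H2. intros r (t & ->). pose proof (Hh s t). pose proof (Rle_abs (h s - h t)). lra.
  - assert (G : forall x y, Rinf (S x) - Rinf (S y) <= L * vnorm (x [-] y)).
    { intros x y. destruct (HS x) as [H1 _]. destruct (HS y) as [_ H2].
      assert (Rinf (S x) - L * vnorm (x [-] y) <= Rinf (S y)); [|lra].
      apply H2. intros r (s & ->). pose proof (H1 (h s + L * vnorm (x [-] g s)) ltac:(exists s; auto)).
      pose proof (vnorm_sub3 x y (g s)). nra. }
    intros x y. apply Rabs_le. pose proof (G x y). pose proof (G y x). rewrite (vnorm_sub_sym y x) in *. lra.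
Qed.

(** The displacement is extended coordinate by coordinate with constant 1/4, which the passage to
    vectors turns into the 1/2 needed for a homeomorphism at every time t in [0, 1]. *)
Lemma isotopic_of_close (g p : curve) :
  (forall s t, vnorm ((p s [-] g s) [-] (p t [-] g t)) <= 1 / 4 * vnorm (g s [-] g t)) ->
  ambient_isotopic (image g) (image p).
Proof.
  intros H.
  destruct (mcshane g (fun s => c1 (p s [-] g s)) (1 / 4) ltac:(lra)) as (f1 & E1 & L1).
  { intros s t. eapply Rle_trans; [|apply H]. apply (comp_le_vnorm ((p s [-] g s) [-] (p t [-] g t))). }
  destruct (mcshane g (fun s => c2 (p s [-] g s)) (1 / 4) ltac:(lra)) as (f2 & E2 & L2).
  { intros s t. eapply Rle_trans; [|apply H]. apply (comp_le_vnorm ((p s [-] g s) [-] (p t [-] g t))). }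
  destruct (mcshane g (fun s => c3 (p s [-] g s)) (1 / 4) ltac:(lra)) as (f3 & E3 & L3).
  { intros s t. eapply Rle_trans; [|apply H]. apply (comp_le_vnorm ((p s [-] g s) [-] (p t [-] g t))). }
  set (Phi := fun x => (f1 x, f2 x, f3 x) : V3).
  assert (HE : forall s, g s [+] Phi (g s) = p s).
  { intros s. unfold Phi. rewrite E1, E2, E3. vring. }
  assert (HPhi : forall x y, vnorm (Phi x [-] Phi y) <= 1 / 2 * vnorm (x [-] y)).
  { intros x y. replace (1 / 2 * vnorm (x [-] y)) with (2 * (1 / 4 * vnorm (x [-] y))) by field.
    apply vnorm_le_comp; [apply L1 | apply L2 | apply L3]. }
  clearbody Phi.
  exists (fun t x => x [+] t [*] Phi x). split; [|split; [|split]].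
  - intros t x eps Ht Heps. pose proof (vnorm_nonneg (Phi x)).
    exists (Rmin (eps / 4) (eps / (4 * (vnorm (Phi x) + 1)))). split.
    { apply Rmin_glb_lt; [lra | apply Rdiv_lt_0_compat; lra]. }
    intros s y Hs Hst Hxy. unfold dist3 in *.
    assert (A1 : vnorm (y [-] x) < eps / 4) by (eapply Rlt_le_trans; [apply Hxy | apply Rmin_l]).
    assert (A2 : (4 * (vnorm (Phi x) + 1)) * Rabs (s - t) <= eps).
    { apply mul_le_of_le_div; [lra|]. left. eapply Rlt_le_trans; [apply Hst | apply Rmin_r]. }
    replace (y [+] s [*] Phi y [-] (x [+] t [*] Phi x)) with
      ((y [-] x) [+] (s [*] (Phi y [-] Phi x) [+] (s - t) [*] Phi x)) by vring.
    eapply Rle_lt_trans; [apply vnorm_add|].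
    pose proof (vnorm_add (s [*] (Phi y [-] Phi x)) ((s - t) [*] Phi x)) as A3.
    rewrite !vnorm_scal, (Rabs_pos_eq s) in A3 by lra.
    pose proof (HPhi y x). pose proof (vnorm_nonneg (Phi y [-] Phi x)). pose proof (Rabs_pos (s - t)). nra.
  - intros t Ht. apply (perturbation_homeo (fun x => t [*] Phi x)). intros x y.
    replace (t [*] Phi x [-] t [*] Phi y) with (t [*] (Phi x [-] Phi y)) by vring.
    rewrite vnorm_scal, Rabs_pos_eq by lra. pose proof (HPhi x y). pose proof (vnorm_nonneg (Phi x [-] Phi y)). nra.
  - intros x. vring.
  - assert (H1 : forall s, g s [+] 1 [*] Phi (g s) = p s).
    { intros s. rewrite <- HE. vring. }
    intros y. split.
    + intros (s & ->). exists (g s). split; [now exists s | now rewrite H1].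
    + intros (x & (s & ->) & ->). exists s. apply H1.
Qed.

(** * The recovery sequence *)

Lemma polygon_exists n (x : Z -> V3) : (1 <= n)%nat -> (forall k, x (k + Z.of_nat n)%Z = x k) ->
  exists p : curve, periodic1 p /\ forall (k : Z) (u : R), 0 <= u <= 1 ->
    p (0 + (IZR k + u) / INR n) = x k [+] u [*] (x (k + 1)%Z [-] x k).
Proof.
  intros Hn Hx. assert (Hp : 0 < INR n) by (apply lt_0_INR; lia).
  set (p := fun t => let k := Int_part (INR n * t) in x k [+] (INR n * t - IZR k) [*] (x (k + 1)%Z [-] x k)).
  assert (Hpk : forall t k u, INR n * t = IZR k + u -> 0 <= u < 1 -> p t = x k [+] u [*] (x (k + 1)%Z [-] x k)).
  { intros t k u E Hu. unfold p. rewrite <- (Int_part_spec (INR n * t) k) by lra.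
    replace (INR n * t - IZR k) with u by lra. reflexivity. }
  exists p. split.
  - intros t. destruct (frac_exists (INR n * t)) as (k & u & E & Hu).
    rewrite (Hpk t k u E Hu). rewrite (Hpk (t + 1) (k + Z.of_nat n)%Z u); auto.
    + replace (k + Z.of_nat n + 1)%Z with (k + 1 + Z.of_nat n)%Z by ring. now rewrite !Hx.
    + rewrite plus_IZR, <- INR_IZR_INZ. lra.
  - intros k u Hu. destruct (Req_dec u 1) as [->|h].
    + rewrite (Hpk _ (k + 1)%Z 0); [|rewrite plus_IZR; field; lra | lra].
      vring.
    + apply Hpk; [field; lra | lra].
Qed.

Lemma round_exists t : exists k h, t = IZR k + h /\ Rabs h <= 1 / 2.
Proof.
  destruct (frac_exists t) as (k & u & -> & Hu). destruct (Rle_lt_dec u (1 / 2)).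
  - exists k, u. split; auto. rewrite Rabs_pos_eq; lra.
  - exists (k + 1)%Z, (u - 1). split; [rewrite plus_IZR; ring|]. rewrite Rabs_left1; lra.
Qed.

Lemma has_deriv_linear g t V eta : 0 < eta ->
  (forall u, t - eta < u < t + eta -> g u [-] g t = (u - t) [*] V) -> has_deriv g t V.
Proof.
  intros He H.
  assert (G : forall (phi : R -> R) l, (forall u, t - eta < u < t + eta -> phi u - phi t = (u - t) * l) ->
     derivable_pt_lim phi t l).
  { intros phi l Hl eps Heps. exists (mkposreal eta He). intros h Hh Hlt. simpl in Hlt.
    apply Rabs_def2 in Hlt. rewrite Hl by lra. replace ((t + h - t) * l / h - l) with 0 by (field; auto).
    rewrite Rabs_R0. auto. }
  repeat split; apply G; intros u Hu; specialize (H u Hu).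
  - apply (f_equal c1) in H. exact H.
  - apply (f_equal c2) in H. exact H.
  - apply (f_equal c3) in H. exact H.
Qed.

Section Recovery.
Variables (g : curve) (T : R -> V3) (K : R).
Hypotheses (HT : c11 g T K) (Hper : periodic1 g).

(** The nodes on one period are continued to all integers by t(k mod n) + k div n, and a single
    small number kap replaces all error terms. *)
Lemma inscribed_Z kap : 0 < kap -> kap <= 1 / 2 -> exists N, (1 <= N)%nat /\ forall n, (N <= n)%nat ->
  / INR n <= kap /\ exists l (tt : Z -> R), 0 < l /\ INR n * l <= 1 /\ tt 0%Z = 0 /\
    (forall k, tt (k + Z.of_nat n)%Z = tt k + 1) /\
    forall k, vnorm (g (tt (k + 1)%Z) [-] g (tt k)) = l /\ l <= tt (k + 1)%Z - tt k <= kap /\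
      (1 - kap) * (tt (k + 1)%Z - tt k) <= l /\ K * (tt (k + 1)%Z - tt k) <= kap /\
      Rabs (tt k - IZR k / INR n) <= kap.
Proof.
  intros Hk Hk2. pose proof HT as (HK & _).
  destruct (small_positive kap kap (K + 1)) as (del & Hdel & Hd1 & Hd2); try lra.
  destruct (inscribed_equilateral g T K HT del Hdel) as (N & HN1 & HN).
  destruct (inv_INR_small kap Hk) as (N2 & HN2).
  exists (Nat.max N N2). split; [lia|]. intros n Hn.
  destruct (HN2 n ltac:(lia)) as [Hn1 Hn2]. split; [lra|].
  destruct (HN n ltac:(lia)) as (l & t & Hl & t0 & tn & Ht).
  assert (Hp : 0 < INR n) by (apply lt_0_INR; lia).
  assert (Hst : forall k, (1 - kap) * (t (S k) - t k) <= l /\ K * (t (S k) - t k) <= kap).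
  { intros k. destruct (Ht k) as (_ & B1 & B2 & B3). set (h := t (S k) - t k) in *.
    assert (K * h <= kap) by nra. split; auto. replace (K * h ^ 2) with (K * h * h) in B3 by ring. nra. }
  assert (Hlow : forall k, INR k * l <= t k /\ (1 - kap) * t k <= INR k * l).
  { induction k as [|k [IH1 IH2]]; [rewrite t0; simpl; lra|]. rewrite S_INR.
    destruct (Ht k) as (_ & B1 & _). destruct (Hst k). lra. }
  assert (Hmono : forall k j, t k <= t (k + j)%nat).
  { intros k. induction j as [|j IH]; [rewrite Nat.add_0_r; lra|]. rewrite <- plus_n_Sm.
    destruct (Ht (k + j)%nat) as (_ & B1 & _). lra. }
  assert (Hnl : INR n * l <= 1) by (destruct (Hlow n); lra).
  assert (Hnl2 : 1 - kap <= INR n * l) by (destruct (Hlow n); rewrite tn in *; lra).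
  (* Every parameter step lies between l and l/(1 - kap), and n of them add up to 1, so the nodes
     are nearly equidistant. *)
  assert (Hclose : forall k, (k <= n)%nat -> Rabs (t k - INR k / INR n) <= kap).
  { intros k Hkn. destruct (Hlow k) as [B1 B2]. pose proof (Hmono k (n - k)%nat) as B3.
    replace (k + (n - k))%nat with n in B3 by lia. rewrite tn in B3.
    assert (0 <= INR k / INR n <= 1) as [B4 B5].
    { assert (INR k <= INR n) by (now apply le_INR). pose proof (pos_INR k).
      split; [apply Rmult_le_pos; [lra | left; now apply Rinv_0_lt_compat]|].
      apply (Rmult_le_reg_r (INR n)); auto. unfold Rdiv. rewrite Rmult_assoc, Rinv_l by lra. lra. }
    assert (E : INR k * l = INR k / INR n * (INR n * l)) by (field; lra).
    rewrite E in *. pose proof (Hmono 0%nat k) as B6. rewrite t0 in B6. simpl in B6.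
    set (a := INR k / INR n) in *. set (b := INR n * l) in *. apply Rabs_le. split; nra. }
  set (nz := Z.of_nat n).
  set (kk := fun k : Z => Z.to_nat (k mod nz)).
  set (tt := fun k : Z => t (kk k) + IZR (k / nz)).
  assert (Hkk : forall k, (kk k < n)%nat).
  { intros k. pose proof (Z.mod_pos_bound k nz ltac:(unfold nz; lia)). unfold kk, nz in *. lia. }
  assert (Hk_eq : forall k, IZR k = INR (kk k) + INR n * IZR (k / nz)).
  { intros k. pose proof (Z.mod_pos_bound k nz ltac:(unfold nz; lia)).
    unfold kk. rewrite !INR_IZR_INZ, Z2Nat.id by lia. fold nz. rewrite <- mult_IZR, <- plus_IZR. f_equal.
    rewrite (Z.div_mod k nz) at 1 by (unfold nz; lia). ring. }
  (* At the last index of a period the successor wraps around, with t n = 1 in place of t 0 + 1. *)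
  assert (Hsucc : forall k, tt (k + 1)%Z = t (S (kk k)) + IZR (k / nz)).
  { intros k. pose proof (Z.mod_pos_bound k nz ltac:(unfold nz; lia)) as B.
    pose proof (Z.div_mod k nz ltac:(unfold nz; lia)) as E. unfold tt.
    destruct (Z.eq_dec (k mod nz + 1) nz) as [e|e].
    - assert (E1 : ((k + 1) / nz = k / nz + 1)%Z).
      { symmetry. apply Z.div_unique with 0%Z; [lia|]. nia. }
      assert (E2 : ((k + 1) mod nz = 0)%Z).
      { symmetry. apply Z.mod_unique with (k / nz + 1)%Z; [lia|]. nia. }
      unfold kk. rewrite E1, E2. replace (S (Z.to_nat (k mod nz))) with n by (unfold nz in *; lia).
      simpl Z.to_nat. rewrite t0, tn, plus_IZR. ring.
    - assert (E1 : ((k + 1) / nz = k / nz)%Z).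
      { symmetry. apply Z.div_unique with (k mod nz + 1)%Z; [lia|]. nia. }
      assert (E2 : ((k + 1) mod nz = k mod nz + 1)%Z).
      { symmetry. apply Z.mod_unique with (k / nz)%Z; [lia|]. nia. }
      unfold kk. rewrite E1, E2. f_equal. f_equal. lia. }
  exists l, tt. split; [auto|split; [auto|split; [|split]]].
  - unfold tt, kk. rewrite Z.mod_0_l, Z.div_0_l by (unfold nz; lia). simpl. rewrite t0. ring.
  - intros k. unfold tt, kk. fold nz. replace (k + nz)%Z with (k + 1 * nz)%Z by ring.
    rewrite Z.mod_add, Z.div_add by (unfold nz; lia). rewrite plus_IZR. ring.
  - intros k. destruct (Ht (kk k)) as (B0 & B1 & B2 & _). destruct (Hst (kk k)) as [B3 B4].
    rewrite Hsucc. unfold tt. rewrite !(periodic_Z g Hper).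
    replace (t (S (kk k)) + IZR (k / nz) - (t (kk k) + IZR (k / nz))) with (t (S (kk k)) - t (kk k)) by ring.
    repeat split; auto; [lra|].
    rewrite (Hk_eq k). replace (t (kk k) + IZR (k / nz) - (INR (kk k) + INR n * IZR (k / nz)) / INR n) with
      (t (kk k) - INR (kk k) / INR n) by (field; lra).
    apply Hclose. specialize (Hkk k). lia.
Qed.

(** The inscribed polygon is enlarged by the ratio 1/(n l) >= 1 about g 0, which gives length 1 and
    leaves the edge directions equal to the unit chords of g. Because the nodes are nearly
    equidistant, the k-th edge is compared with the tangent at parameters near k/n. *)
Lemma recovery_polygon eps : 0 < eps -> exists N, (1 <= N)%nat /\ forall n, (N <= n)%nat ->
  exists (p : curve) (x : Z -> V3) (l : R) (tt : Z -> R),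
    Pn_rep n p (0, x) /\ periodic1 p /\ p 0 = g 0 /\ 0 < l /\ INR n * l <= 1 /\ l <= eps /\
    (forall k, edge n x k = / l [*] (g (tt (k + 1)%Z) [-] g (tt k))) /\
    (forall k t, Rabs (0 + IZR k / INR n - t) <= / INR n -> vnorm (edge n x k [-] T t) <= eps).
Proof.
  intros Heps. pose proof HT as (HK & N1 & Hq & HTl).
  destruct (small_positive (1 / 2) eps (2 * K + 4)) as (kap & Hk & Hk1 & Hk2); try lra.
  destruct (inscribed_Z kap Hk Hk1) as (N & HN1 & HN).
  exists N. split; auto. intros n Hn. destruct (HN n Hn) as (Hinv & l & tt & Hl & Hnl & tt0 & ttp & Htt).
  assert (Hn1 : (1 <= n)%nat) by lia.
  assert (Hp : 0 < INR n) by (apply lt_0_INR; lia).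
  set (lam := / (INR n * l)).
  set (x := fun k => g 0 [+] lam [*] (g (tt k) [-] g 0)).
  assert (Hxp : forall k, x (k + Z.of_nat n)%Z = x k).
  { intros k. unfold x. now rewrite ttp, Hper. }
  destruct (polygon_exists n x Hn1 Hxp) as (p & Pp & Hpx).
  assert (Hedge : forall k, edge n x k = / l [*] (g (tt (k + 1)%Z) [-] g (tt k))).
  { intros k. unfold edge, x, lam. vring. }
  assert (Hedist : forall k, vnorm (edge n x k) = 1).
  { intros k. rewrite Hedge, vnorm_scal, (proj1 (Htt k)), Rabs_pos_eq; [field; lra|].
    left. now apply Rinv_0_lt_compat. }
  exists p, x, l, tt. repeat apply conj; auto.
  - intros k. simpl. unfold dist3. pose proof (Hedist k) as E. unfold edge in E.
    rewrite vnorm_scal, Rabs_pos_eq in E by lra. apply (Rmult_eq_reg_l (INR n)); [|lra].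
    rewrite E. field. lra.
  - replace 0 with (0 + (IZR 0 + 0) / INR n) at 1 by (field; lra). rewrite Hpx by lra.
    unfold x. rewrite tt0. simpl. vring.
  - destruct (Htt 0%Z) as (_ & B & _). assert (kap <= eps) by nra. lra.
  - intros k t Ht. destruct (Htt k) as (B0 & [B1 B2] & B3 & B4 & B5).
    set (h := tt (k + 1)%Z - tt k) in *.
    eapply Rle_trans; [apply vnorm_sub3 with (v := T (tt k))|].
    (* The Taylor error K h^2 and the length defect h - l are each at most kap h, and h <= 2 l. *)
    assert (E1 : vnorm (edge n x k [-] T (tt k)) <= 4 * kap).
    { rewrite Hedge. 
      replace (/ l [*] (g (tt (k + 1)%Z) [-] g (tt k)) [-] T (tt k)) with
        (/ l [*] ((g (tt (k + 1)%Z) [-] g (tt k) [-] h [*] T (tt k)) [+] (h - l) [*] T (tt k))) by vring.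
      rewrite vnorm_scal, Rabs_pos_eq by (left; now apply Rinv_0_lt_compat).
      pose proof (vnorm_add (g (tt (k + 1)%Z) [-] g (tt k) [-] h [*] T (tt k)) ((h - l) [*] T (tt k))) as A.
      rewrite vnorm_scal, N1, (Rabs_pos_eq (h - l)) in A by lra.
      pose proof (Hq (tt k) (tt (k + 1)%Z) ltac:(fold h; apply Rabs_le; lra)) as Q. fold h in Q.
      apply (Rmult_le_reg_l l); auto. rewrite <- Rmult_assoc, Rinv_r, Rmult_1_l by lra.
      eapply Rle_trans; [apply A|].
      assert (h <= 2 * l) by nra. replace (K * h ^ 2) with (K * h * h) in Q by ring.
      assert (K * h * h <= kap * h) by nra. nra. }
    assert (E2 : vnorm (T (tt k) [-] T t) <= 2 * K * kap).
    { eapply Rle_trans; [apply HTl|].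
      assert (Rabs (tt k - t) <= 2 * kap).
      { apply Rabs_le_inv in Ht, B5. apply Rabs_le. lra. }
      nra. }
    nra.
Qed.
End Recovery.

Lemma vertices_distinct_of_injective n p s y : (1 <= n)%nat -> injective_S1 p -> Pn_rep n p (s, y) ->
  vertices_distinct n y.
Proof.
  intros Hn Hinj Hy i j Hi Hj Hij E. assert (Hp : 0 < INR n) by (apply lt_0_INR; lia).
  rewrite <- (vertex_at n p s y Hy i), <- (vertex_at n p s y Hy j) in E.
  destruct (Hinj _ _ E) as (k & Hk).
  assert (E2 : IZR (i - j) = IZR (k * Z.of_nat n)).
  { rewrite mult_IZR, minus_IZR, <- INR_IZR_INZ, <- Hk. field. lra. }
  apply eq_IZR in E2. assert (k = 0)%Z by nia. subst k. lia.
Qed.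

(** * Polygons whose edges follow the tangent *)

Section Close.
Variables (g : curve) (T : R -> V3) (K : R) (n : nat) (p : curve) (x : Z -> V3) (eps : R).
Hypotheses (HT : c11 g T K) (Hper : periodic1 g) (Hn : (1 <= n)%nat) (Hrep : Pn_rep n p (0, x))
  (Pp : periodic1 p) (P0 : p 0 = g 0) (Heps : 0 < eps)
  (Hedge : forall k t, Rabs (0 + IZR k / INR n - t) <= / INR n -> vnorm (edge n x k [-] T t) <= eps).

(** The difference p - g has velocities bounded by eps. Uniform closeness, the norm estimate,
    injectivity and the isotopy all follow from this one Lipschitz bound. *)
Lemma polygon_error_lip : lipschitz eps (csub p g).
Proof.
  apply lipschitz_of_le. intros a b Hab. apply mean_value_ineq; [auto | lra|].
  intros t Ht del Hdel. pose proof HT as (HK & N1 & _ & HTl).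
  destruct (small_positive (1 / 2) del (4 * K + 1)) as (r & Hr & Hr1 & Hr2); try lra.
  exists r. split; auto. intros y z Hy Hz h1 h2.
  pose proof (c11_near g T K HT t r y z ltac:(lra) ltac:(lra) ltac:(lra) ltac:(lra)) as E1.
  assert (E2 : vnorm (p z [-] p y [-] (z - y) [*] T t) <= (eps + K * r) * (z - y)).
  { apply (polygon_near n p 0 x Hn Hrep); [lra | nra |]. intros k s Hs Hks.
    eapply Rle_trans; [apply vnorm_sub3 with (v := T s)|]. pose proof (Hedge k s Hks).
    pose proof (HTl s t). assert (Rabs (s - t) <= r) by (apply Rabs_le; lra). nra. }
  unfold csub.
  replace (p z [-] g z [-] (p y [-] g y)) with ((p z [-] p y [-] (z - y) [*] T t) [-] (g z [-] g y [-] (z - y) [*] T t)) by vring.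
  eapply Rle_trans; [apply vnorm_sub|]. nra.
Qed.

Lemma polygon_error_uniform t : vnorm (csub p g t) <= eps.
Proof.
  destruct (frac_exists t) as (k & u & -> & Hu).
  rewrite Rplus_comm, (periodic_Z (csub p g)) by (now apply csub_periodic).
  pose proof (polygon_error_lip u 0) as E. rewrite Rminus_0_r, Rabs_pos_eq in E by lra.
  pose proof (vnorm_sub_ge (csub p g u) (csub p g 0)) as F.
  replace (csub p g 0) with vzero in * by (unfold csub; rewrite P0, vsub_self; auto).
  rewrite vnorm_zero in F. nra.
Qed.

Lemma polygon_lip : lipschitz (1 + eps) p.
Proof.
  intros s t. replace (p s [-] p t) with ((g s [-] g t) [+] (csub p g s [-] csub p g t))
    by (unfold csub; vring).
  eapply Rle_trans; [apply vnorm_add|]. pose proof (polygon_error_lip s t). pose proof (c11_lip g T K HT s t). lra.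
Qed.

Lemma vertices_null (P : R -> Prop) :
  (forall t, (forall k, t <> 0 + IZR k / INR n) -> P t) -> ae_S1 P.
Proof.
  intros H. eapply null_subset; [|apply (null_countable (fun k => INR k / INR n))].
  intros t [Ht Hnt]. apply NNPP. intros Hk. apply Hnt, H. intros k E. apply Hk.
  assert (Hp : 0 < INR n) by (apply lt_0_INR; lia).
  exists (Z.to_nat k). rewrite INR_IZR_INZ, Z2Nat.id; [lra|].
  destruct (Z_le_gt_dec 0 k) as [h|h]; auto. exfalso.
  assert (IZR k < 0) by (apply IZR_lt; lia).
  assert (IZR k / INR n < 0); [|lra]. unfold Rdiv. pose proof (Rinv_0_lt_compat _ Hp). nra.
Qed.

Lemma polygon_deriv t : (forall k, t <> 0 + IZR k / INR n) ->
  exists k, has_deriv p t (edge n x k) /\ vnorm (edge n x k [-] T t) <= eps.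
Proof.
  intros Ht. destruct (polygon_local n p 0 x Hn Hrep t) as (k1 & k2 & eta & He & [<- |(k & E)] & D1 & _ & F2 & F1).
  - exists k1. split; [|now apply Hedge]. apply has_deriv_linear with eta; auto.
    intros u Hu. destruct (Rle_lt_dec t u); [apply F2; lra | apply F1; lra].
  - exfalso. apply (Ht k E).
Qed.

Lemma polygon_in_C : in_C p.
Proof.
  split; [split; [auto|exists (1 + eps); exact polygon_lip]|].
  apply vertices_null. intros t Ht. destruct (polygon_deriv t Ht) as (k & Hd & _).
  exists (edge n x k). split; auto. apply (edge_unit n p 0 x Hn Hrep).
Qed.

Lemma polygon_W1inf : in_C g -> W1inf_norm (csub p g) <= 2 * eps.
Proof.
  intros HC. destruct (Linf_norm_glb _ _ polygon_error_lip) as [H1 _].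
  destruct (Linf_norm_deriv_glb p g polygon_in_C HC) as [H2 _].
  assert (Linf_norm (csub p g) <= eps).
  { apply H1. split; [lra|]. apply vertices_null. intros t _. apply polygon_error_uniform. }
  assert (Linf_norm_deriv (csub p g) <= eps).
  { apply H2. split; [lra|]. apply vertices_null. intros t Ht.
    destruct (polygon_deriv t Ht) as (k & Hd & He). exists (edge n x k [-] T t). split; auto.
    apply has_deriv_sub; auto. pose proof HT as (_ & _ & Hq & _). apply (quad_has_deriv g t (T t) K). apply Hq. }
  unfold W1inf_norm. lra.
Qed.

Variable lam : R.
Hypotheses (Hlam : 0 < lam) (Hbi : forall s h, Rabs h <= 1 / 2 -> lam * Rabs h <= vnorm (g (s + h) [-] g s))
  (Hel : eps <= lam / 4).

Lemma polygon_bilip s h : Rabs h <= 1 / 2 -> lam / 2 * Rabs h <= vnorm (p (s + h) [-] p s).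
Proof.
  intros Hh. pose proof (Hbi s h Hh). pose proof (polygon_error_lip (s + h) s) as E.
  replace (s + h - s) with h in E by ring.
  pose proof (vnorm_sub_ge (g (s + h) [-] g s) (p (s + h) [-] p s)) as F.
  replace (g (s + h) [-] g s [-] (p (s + h) [-] p s)) with ((-1) [*] (csub p g (s + h) [-] csub p g s)) in F
    by (unfold csub; vring).
  rewrite vnorm_scal, Rabs_left in F by lra. pose proof (Rabs_pos h). nra.
Qed.

Lemma polygon_injective : injective_S1 p.
Proof.
  intros s t E. destruct (round_exists (s - t)) as (k & h & Hst & Hh). exists k.
  assert (Hs : s = t + h + IZR k) by lra.
  rewrite Hs, periodic_Z in E by auto. pose proof (polygon_bilip t h Hh) as B.
  rewrite E, vsub_self, vnorm_zero in B.
  assert (h = 0); [|lra]. destruct (Req_dec h 0) as [|hn]; auto. exfalso. pose proof (Rabs_pos_lt h hn). nra.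
Qed.

Lemma polygon_isotopic : ambient_isotopic (image g) (image p).
Proof.
  apply isotopic_of_close. intros s t. destruct (round_exists (s - t)) as (k & h & Hst & Hh).
  assert (Hs : s = t + h + IZR k) by lra.
  rewrite Hs, !periodic_Z by auto. pose proof (Hbi t h Hh). pose proof (polygon_error_lip (t + h) t) as E.
  replace (t + h - t) with h in E by ring. unfold csub in E. pose proof (Rabs_pos h). nra.
Qed.

(** Curvature is estimated for the vertices x, but [Fn] may have chosen another representation of p;
    it can only be an index shift. Otherwise all edges would agree and p could not be closed. *)
Lemma polygon_rep_unique s y : Pn_rep n p (s, y) -> exists j : Z, forall k, y k = x (k + j)%Z.
Proof.
  intros Hy. assert (Hp : 0 < INR n) by (apply lt_0_INR; lia).
  destruct (frac_exists (INR n * s)) as (j & f & E & Hf).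
  assert (Es : s = (IZR j + f) / INR n) by (rewrite <- E; field; lra).
  destruct (Req_dec f 0) as [->|hf].
  - exists j. intros k. rewrite <- (vertex_at n p s y Hy), <- (vertex_at n p 0 x Hrep).
    f_equal. rewrite Es, plus_IZR. field. lra.
  - exfalso.
    (* Every vertex of one polygon is interior to an edge of the other, so all edges agree. *)
    assert (Hsame : forall k, edge n x k = edge n x (k - 1)).
    { intros k. set (d := Rmin f (1 - f)).
      assert (Hd : 0 < d) by (apply Rmin_glb_lt; lra).
      assert (Hd1 : d <= f) by apply Rmin_l. assert (Hd2 : d <= 1 - f) by apply Rmin_r.
      set (m := (k - j - 1)%Z).
      pose proof (on_edge n p 0 x Hn Hrep k d 0 ltac:(lra) ltac:(lra)) as A1.
      pose proof (on_edge n p 0 x Hn Hrep (k - 1) 1 (1 - d) ltac:(lra) ltac:(lra)) as A2.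
      pose proof (on_edge n p s y Hn Hy m (1 - f + d) (1 - f) ltac:(lra) ltac:(lra)) as B1.
      pose proof (on_edge n p s y Hn Hy m (1 - f) (1 - f - d) ltac:(lra) ltac:(lra)) as B2.
      assert (Em : IZR m = IZR k - IZR j - 1) by (unfold m; rewrite !minus_IZR; ring).
      replace (s + (IZR m + (1 - f + d)) / INR n) with (0 + (IZR k + d) / INR n) in B1 by (rewrite Es, Em; field; lra).
      replace (s + (IZR m + (1 - f)) / INR n) with (0 + (IZR k + 0) / INR n) in B1, B2 by (rewrite Es, Em; field; lra).
      replace (s + (IZR m + (1 - f - d)) / INR n) with (0 + (IZR (k - 1) + (1 - d)) / INR n) in B2
        by (rewrite Es, Em, minus_IZR; field; lra).
      replace (0 + (IZR (k - 1) + 1) / INR n) with (0 + (IZR k + 0) / INR n) in A2 by (rewrite minus_IZR; field; lra).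
      rewrite A1 in B1. rewrite A2 in B2.
      replace (1 - f + d - (1 - f)) with d in B1 by ring. replace (1 - f - (1 - f - d)) with d in B2 by ring.
      replace (1 - (1 - d)) with d in B2 by ring. rewrite Rminus_0_r in B1.
      assert (Hc : forall u v : V3, (d / INR n) [*] u = (d / INR n) [*] v -> u = v).
      { intros u v Huv. apply (f_equal (fun w => (INR n / d) [*] w)) in Huv.
        replace ((INR n / d) [*] ((d / INR n) [*] u)) with u in Huv
          by (apply vext; destruct u as [[? ?] ?]; vunf; field; lra).
        replace ((INR n / d) [*] ((d / INR n) [*] v)) with v in Huv
          by (apply vext; destruct v as [[? ?] ?]; vunf; field; lra). auto. }
      rewrite (Hc _ _ B1), (Hc _ _ B2). auto. }
    assert (Hall : forall k, edge n x k = edge n x 0).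
    { intros k. destruct (Z_le_gt_dec 0 k) as [h|h].
      - rewrite <- (Z2Nat.id k h). induction (Z.to_nat k) as [|i IH]; auto.
        rewrite Hsame. replace (Z.of_nat (S i) - 1)%Z with (Z.of_nat i) by lia. auto.
      - replace k with (- Z.of_nat (Z.to_nat (- k)))%Z by lia. induction (Z.to_nat (- k)) as [|i IH]; auto.
        rewrite <- IH. rewrite (Hsame (- Z.of_nat i)%Z). f_equal. lia. }
    pose proof (polygon_near n p 0 x Hn Hrep 0 1 (edge n x 0) 0 ltac:(lra) ltac:(lra)) as Hz.
    assert (Hz0 : vnorm (p 1 [-] p 0 [-] (1 - 0) [*] edge n x 0) <= 0 * (1 - 0)).
    { apply Hz. intros k t _ _. rewrite Hall, vsub_self, vnorm_zero. lra. }
    replace 1 with (0 + 1) in Hz0 at 1 by ring. rewrite Pp in Hz0.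
    replace (p 0 [-] p 0 [-] (1 - 0) [*] edge n x 0) with ((-1) [*] edge n x 0) in Hz0 by vring.
    rewrite vnorm_scal, Rabs_left, (edge_unit n p 0 x Hn Hrep) in Hz0 by lra. lra.
Qed.

(** * Discrete thickness of the recovery polygons *)

Variables (D l : R) (tt : Z -> R).
Hypotheses (HD : 0 < D) (Hthick : thick_at_least g D) (Hl : 0 < l) (Hnl : INR n * l <= 1)
  (Hlen : forall k, edge n x k = / l [*] (g (tt (k + 1)%Z) [-] g (tt k))) (Heps1 : eps < 1 / 2).

(* For an isosceles triangle with legs l and exterior angle phi the circumradius is
   l / (2 sin (phi/2)), so the discrete curvature is 1 / (r cos (phi/2)). *)
Lemma polygon_kappa k q : l <= 2 * D * q -> 0 < q < 1 ->
  ele (kappa_d (x (k - 1)%Z) (x k) (x (k + 1)%Z)) (Fin (/ (D * (1 - q ^ 2)))).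
Proof.
  intros Hlq Hq. assert (Hp : 0 < INR n) by (apply lt_0_INR; lia).
  rewrite (kappa_edge n p 0 x Hn Hrep). cbv zeta.
  set (e1 := edge n x (k - 1)). set (e2 := edge n x k).
  assert (U1 : vnorm e1 = 1) by apply (edge_unit n p 0 x Hn Hrep).
  assert (U2 : vnorm e2 = 1) by apply (edge_unit n p 0 x Hn Hrep).
  (* Consecutive edges differ by less than 1, so cos phi > 1/2, which excludes phi = PI and allows 1
     + cos phi to be cancelled. *)
  assert (Hclose : vnorm (e1 [-] e2) <= 2 * eps).
  { eapply Rle_trans; [apply vnorm_sub3 with (v := T (0 + IZR k / INR n))|].
    assert (0 < / INR n) by (now apply Rinv_0_lt_compat).
    pose proof (Hedge (k - 1) (0 + IZR k / INR n)) as A1. pose proof (Hedge k (0 + IZR k / INR n)) as A2.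
    fold e1 in A1. fold e2 in A2. rewrite (vnorm_sub_sym (T _) e2).
    assert (vnorm (e1 [-] T (0 + IZR k / INR n)) <= eps).
    { apply A1. rewrite minus_IZR. replace (0 + (IZR k - 1) / INR n - (0 + IZR k / INR n)) with (- / INR n) by (field; lra).
      rewrite Rabs_Ropp, Rabs_pos_eq; lra. }
    assert (vnorm (e2 [-] T (0 + IZR k / INR n)) <= eps).
    { apply A2. rewrite Rminus_diag, Rabs_R0. lra. }
    lra. }
  set (phi := ang e1 e2). pose proof (ang_bound e1 e2) as Bphi. fold phi in Bphi.
  pose proof (cos_ang e1 e2 U1 U2) as Ec. fold phi in Ec.
  assert (Hcos : 1 / 2 < cos phi).
  { pose proof (vnorm_sq (e1 [-] e2)) as Hs. revert Hs. dots. rewrite (dot_sym e2 e1), !unit_dot, <- Ec by auto.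
    pose proof (vnorm_nonneg (e1 [-] e2)). nra. }
  (* The thickness inequality at three consecutive vertices before rescaling, with 2 l^4 (1 + cos
     phi) cancelled. *)
  assert (HS : 2 * D * D * (1 - cos phi) <= l * l).
  { pose proof (thick_all g D Hthick (tt (k - 1)%Z) (tt k) (tt (k + 1)%Z)) as H.
    assert (Eu : g (tt (k - 1)%Z) [-] g (tt k) = (- l) [*] e1).
    { unfold e1. rewrite Hlen. replace (k - 1 + 1)%Z with k by ring.
      vring. }
    assert (Ev : g (tt (k + 1)%Z) [-] g (tt k) = l [*] e2).
    { unfold e2. rewrite Hlen. vring. }
    rewrite Eu, Ev in H. unfold gram, sides in H. revert H. dots.
    rewrite (dot_sym e2 e1), !unit_dot, <- Ec by auto. intros H.
    apply (Rmult_le_reg_l (2 * (l * l * l * l) * (1 + cos phi))).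
    - assert (0 < l * l * l * l) by (repeat apply Rmult_lt_0_compat; auto). nra.
    - eapply Rle_trans; [|eapply Rle_trans; [apply H|]]; right; ring. }
  destruct (Req_EM_T phi PI) as [E|_]; [rewrite E, cos_PI in Hcos; lra|]. simpl.
  set (S := sin (phi / 2)). set (C := cos (phi / 2)).
  assert (E2 : cos phi = 1 - 2 * S * S).
  { unfold S. rewrite <- cos_2a_sin. f_equal. field. }
  assert (HS0 : 0 <= S) by (apply sin_ge_0; lra).
  assert (HC0 : 0 < C).
  { pose proof PI_RGT_0. apply cos_gt_0; try lra. destruct Bphi as [_ [h|h]]; [lra|]. rewrite h, cos_PI in Hcos. lra. }
  assert (HSC : S * S + C * C = 1) by (pose proof (sin2_cos2 (phi / 2)) as E; exact E).
  assert (HSq : 2 * D * S <= l).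
  { apply Rnot_lt_le. intros h. assert (l * l < (2 * D * S) * (2 * D * S)) by nra. rewrite E2 in HS. nra. }
  assert (HSq2 : S <= q) by nra.
  (* C is at least C^2 = 1 - S^2, and S <= l/(2D) <= q. *)
  assert (HC1 : 1 - q ^ 2 <= C).
  { assert (C <= 1) by nra. assert (C * C <= C) by nra. nra. }
  assert (Hq2 : 0 < 1 - q ^ 2) by nra.
  unfold tan. fold S C.
  (* The curvature 2 n S/C times D C is n (2 D S) <= n l <= 1; rescaling from length n l to 1 does
     not spoil the bound. *)
  apply Rle_trans with (/ (D * C)).
  - apply (Rmult_le_reg_r (D * C)); [now apply Rmult_lt_0_compat|].
    rewrite Rinv_l by (apply Rgt_not_eq; now apply Rmult_lt_0_compat).
    replace (2 * INR n * (S / C) * (D * C)) with (INR n * (2 * D * S)) by (field; lra). nra.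
  - apply Rinv_le_contravar; [now apply Rmult_lt_0_compat|]. apply Rmult_le_compat_l; lra.
Qed.

(** The right and left derivatives at s of the squared distance are -2<w,e2> and -2<w,e1>. At an
    extremum the two products do not have the same strict sign, and both differ from <w, T s> by at
    most eps |w|. *)
Lemma critical_orthogonal t s : loc_extremum (fun u => (dist3 (p t) (p u)) ^ 2) s ->
  Rabs (dot (p t [-] p s) (T s)) <= eps * vnorm (p t [-] p s).
Proof.
  intros (del & Hdel & Hext). set (w := p t [-] p s).
  destruct (polygon_local n p 0 x Hn Hrep s) as (k1 & k2 & eta & He & _ & D1 & D2 & F2 & F1).
  pose proof (Hedge k1 s D1) as E1. pose proof (Hedge k2 s D2) as E2.
  pose proof (edge_unit n p 0 x Hn Hrep k1) as U1. pose proof (edge_unit n p 0 x Hn Hrep k2) as U2.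
  set (e1 := edge n x k1) in *. set (e2 := edge n x k2) in *.
  pose proof (dot_abs_le w (e1 [-] T s)) as A1. pose proof (dot_abs_le w (e2 [-] T s)) as A2.
  rewrite dot_subr in A1, A2. apply Rabs_le_inv in A1, A2. pose proof (vnorm_nonneg w) as Pw.
  assert (Hsq : forall u, dist3 (p t) (p u) ^ 2 = dot (w [-] (p u [-] p s)) (w [-] (p u [-] p s))).
  { intros u. unfold dist3. replace (w [-] (p u [-] p s)) with (p t [-] p u)
      by (unfold w; vring).
    rewrite <- vnorm_sq. ring. }
  assert (H0 : dist3 (p t) (p s) ^ 2 = dot w w).
  { rewrite Hsq, vsub_self. f_equal; vring. }
  set (m := Rmin (del / 2) (eta / 2)).
  assert (Hm : 0 < m) by (apply Rmin_glb_lt; lra).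
  assert (Hm1 : m <= del / 2) by apply Rmin_l. assert (Hm2 : m <= eta / 2) by apply Rmin_r.
  assert (R2 : forall r, 0 < r <= m -> dist3 (p t) (p (s + r)) ^ 2 = dot w w - 2 * r * dot w e2 + r * r).
  { intros r Hr. rewrite Hsq, F2 by lra. replace (s + r - s) with r by ring. fold e2. dots.
    rewrite (dot_sym e2 w), (unit_dot e2 U2). ring. }
  assert (R1 : forall r, 0 < r <= m -> dist3 (p t) (p (s - r)) ^ 2 = dot w w + 2 * r * dot w e1 + r * r).
  { intros r Hr. rewrite Hsq, F1 by lra. replace (s - r - s) with (- r) by ring. fold e1. dots.
    rewrite (dot_sym e1 w), (unit_dot e1 U1). ring. }
  assert (Hsides : (0 <= dot w e2 /\ dot w e1 <= 0) \/ (dot w e2 <= 0 /\ 0 <= dot w e1)).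
  { destruct Hext as [Hmax|Hmin]; [left|right].
    - pose proof (Hmax (s + m) ltac:(rewrite Rabs_pos_eq; lra)) as B2.
      pose proof (Hmax (s - m) ltac:(rewrite Rabs_left; lra)) as B1.
      rewrite R2, H0 in B2 by lra. rewrite R1, H0 in B1 by lra. split; nra.
    - split.
      (* The step r is at most <w,e2>, so the quadratic term r^2 cannot compensate the decrease 2 r
         <w,e2>. *)
      + apply Rnot_lt_le. intros h. set (r := Rmin m (dot w e2)).
        assert (0 < r) by (apply Rmin_glb_lt; lra).
        assert (r <= m) by apply Rmin_l. assert (r <= dot w e2) by apply Rmin_r.
        pose proof (Hmin (s + r) ltac:(rewrite Rabs_pos_eq; lra)) as B2. rewrite R2, H0 in B2 by lra. nra.
      + apply Rnot_lt_le. intros h. set (r := Rmin m (- dot w e1)).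
        assert (0 < r) by (apply Rmin_glb_lt; lra).
        assert (r <= m) by apply Rmin_l. assert (r <= - dot w e1) by apply Rmin_r.
        pose proof (Hmin (s - r) ltac:(rewrite Rabs_left; lra)) as B1. rewrite R1, H0 in B1 by lra. nra. }
  assert (vnorm w * vnorm (e1 [-] T s) <= eps * vnorm w) by nra.
  assert (vnorm w * vnorm (e2 [-] T s) <= eps * vnorm w) by nra.
  apply Rabs_le. destruct Hsides; lra.
Qed.

(* The error is measured relative to |w|, so that pairs close to each other along the curve
   need no separate treatment. *)
Lemma polygon_dcrit eta a b : eps * (1 + 2 / lam) <= eta -> eta <= 1 / 4 -> dcrit p a b ->
  2 * (D * (1 - 2 * eta)) <= dist3 a b.
Proof.
  intros He1 He2 (Hab & t & s & Ha & Hb & Hcrit & _). subst a b. unfold dist3.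
  pose proof (critical_orthogonal t s Hcrit) as Horth.
  destruct (round_exists (t - s)) as (k & h & Hts & Hh).
  assert (Et : t = s + h + IZR k) by lra.
  rewrite Et, (periodic_Z p Pp) in *. set (w := p (s + h) [-] p s) in *.
  assert (Hw : 0 < vnorm w) by (now apply dist3_pos).
  pose proof HT as (_ & N1 & Hq & _).
  assert (Hder : has_deriv g s (T s)) by (apply (quad_has_deriv g s (T s) K); apply Hq).
  pose proof (tangent_circle g D s (T s) (s + h) Hthick Hder (N1 s)) as Htc. cbv zeta in Htc.
  set (W := g (s + h) [-] g s) in *.
  pose proof (polygon_error_lip (s + h) s) as Herr. replace (s + h - s) with h in Herr by ring.
  replace (csub p g (s + h) [-] csub p g s) with (w [-] W) in Herr
    by (unfold csub, w, W; vring).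
  pose proof (polygon_bilip s h Hh) as Hbl. fold w in Hbl.
  (* The error eps |h| is converted to a relative one by |h| <= (2/lam)|w|. *)
  assert (Hrel : vnorm (w [-] W) <= eps * (2 / lam) * vnorm w).
  { eapply Rle_trans; [apply Herr|]. rewrite Rmult_assoc. apply Rmult_le_compat_l; [lra|].
    apply (Rmult_le_reg_l (lam / 2)); [lra|].
    replace (lam / 2 * (2 / lam * vnorm w)) with (vnorm w) by (field; lra). auto. }
  assert (H2l : 0 < 2 / lam) by (apply Rdiv_lt_0_compat; lra).
  assert (Heta : 0 < eta) by nra.
  assert (Hrel2 : vnorm (w [-] W) <= eta * vnorm w) by nra.
  (* In eps (1 + 2/lam) <= eta the summand 1 pays for the defect of orthogonality and 2/lam for
     replacing the chord w by W. *)
  assert (HWT : Rabs (dot W (T s)) <= eta * vnorm w).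
  { replace (dot W (T s)) with (dot w (T s) - dot (w [-] W) (T s)) by (dots; ring).
    unfold Rminus. eapply Rle_trans; [apply Rabs_triang|]. rewrite Rabs_Ropp.
    pose proof (dot_abs_le (w [-] W) (T s)) as E. rewrite N1 in E. nra. }
  pose proof (vnorm_sub_ge w W) as L1. pose proof (vnorm_sub_ge W w) as L2. rewrite vnorm_sub_sym in L2.
  rewrite <- (vnorm_sq W) in Htc.
  assert (Hsq : dot W (T s) * dot W (T s) <= eta * vnorm w * (eta * vnorm w)).
  { apply Rabs_le_inv in HWT. nra. }
  set (a := vnorm w) in *. set (B := vnorm W) in *. set (z := dot W (T s)) in *.
  assert (HB1 : (1 - eta) * a <= B) by lra. assert (HB2 : B <= (1 + eta) * a) by lra.
  assert (HB0 : 0 < B) by nra.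
  assert (Hz : z * z <= 2 * eta * eta * (B * B)).
  { assert (3 / 4 * a <= B) by nra. assert (9 / 16 * (a * a) <= B * B) by nra.
    assert (0 <= eta * eta) by nra. nra. }
  (* The tangent circle inequality 4 D^2 (B^2 - z^2) <= B^4 with z^2 <= 2 eta^2 B^2, divided by
     B^2. *)
  assert (HBB : 4 * D * D * (1 - 2 * eta * eta) <= B * B).
  { apply (Rmult_le_reg_l (B * B)); [nra|].
    assert (4 * D * D * (B * B - 2 * eta * eta * (B * B)) <= 4 * D * D * (B * B - z * z)).
    { apply Rmult_le_compat_l; nra. }
    nra. }
  assert (HB3 : 2 * D * (1 - 2 * eta * eta) <= B).
  { apply Rnot_lt_le. intros hlt.
    assert (0 < 1 - 2 * eta * eta <= 1) by nra.
    assert (B * B < (2 * D * (1 - 2 * eta * eta)) * (2 * D * (1 - 2 * eta * eta))) by nra.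
    set (c := 1 - 2 * eta * eta) in *.
    assert (4 * D * D * (c * c) <= 4 * D * D * c) by (apply Rmult_le_compat_l; nra). nra. }
  apply (Rmult_le_reg_l (1 + eta)); [lra|]. eapply Rle_trans; [|apply HB2]. eapply Rle_trans; [|apply HB3].
  assert ((1 + eta) * (1 - 2 * eta) <= 1 - 2 * eta * eta) by nra. nra.
Qed.
End Close.

Lemma recovery K0 g D om eps : in_CK K0 g -> 0 < D -> thick_at_least g D -> 0 < om < 1 -> 0 < eps ->
  exists N, forall n, (N <= n)%nat -> exists p, in_CK K0 p /\ W1inf_norm (csub p g) < eps /\
    ele (Fn n p) (Fin (/ (D * (1 - om)))).
Proof.
  intros (HC & Hinj & Hiso) HD Hthick Hom Heps.
  destruct (in_C_lipschitz g HC) as (L & HL).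
  assert (Hper : periodic1 g) by apply HC.
  destruct (regularity g L D HL HD Hthick Hinj Hper (proj2 HC)) as (T & K & HT).
  destruct (bilipschitz g T K HT Hper Hinj) as (lam & Hlam & Hbi).
  set (eta := Rmin (1 / 4) (om / 2)).
  assert (Heta : 0 < eta) by (apply Rmin_glb_lt; lra).
  assert (Heta1 : eta <= 1 / 4) by apply Rmin_l. assert (Heta2 : eta <= om / 2) by apply Rmin_r.
  assert (H2l : 0 < 2 / lam) by (apply Rdiv_lt_0_compat; lra).
  (* In order: the norm 2e stays below eps; injectivity and isotopy need lam/4; consecutive edges
     need e < 1/2; eta/(1 + 2/lam) is for critical pairs, with 2 eta <= om; and l <= e <= 2 D om
     bounds the curvature with q = om. *)
  set (e := Rmin (eps / 3) (Rmin (lam / 4) (Rmin (1 / 4) (Rmin (eta / (1 + 2 / lam)) (2 * D * om))))).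
  assert (He : 0 < e) by (repeat apply Rmin_glb_lt; try lra; [apply Rdiv_lt_0_compat; lra | nra]).
  assert (He1 : e <= eps / 3) by apply Rmin_l.
  assert (Hmin : e <= Rmin (lam / 4) (Rmin (1 / 4) (Rmin (eta / (1 + 2 / lam)) (2 * D * om)))) by apply Rmin_r.
  assert (He2 : e <= lam / 4) by (eapply Rle_trans; [apply Hmin | apply Rmin_l]).
  assert (He3 : e <= 1 / 4).
  { eapply Rle_trans; [apply Hmin|]. eapply Rle_trans; [apply Rmin_r | apply Rmin_l]. }
  assert (He4 : (1 + 2 / lam) * e <= eta).
  { apply mul_le_of_le_div; [lra|]. eapply Rle_trans; [apply Hmin|].
    eapply Rle_trans; [apply Rmin_r|]. eapply Rle_trans; [apply Rmin_r | apply Rmin_l]. }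
  assert (He5 : e <= 2 * D * om).
  { eapply Rle_trans; [apply Hmin|].
    eapply Rle_trans; [apply Rmin_r|]. eapply Rle_trans; [apply Rmin_r | apply Rmin_r]. }
  destruct (recovery_polygon g T K HT Hper e He) as (N & HN1 & HN).
  exists N. intros n Hn. destruct (HN n Hn) as (p & x & l & tt & Hrep & Pp & P0 & Hl & Hnl & Hle & Hlen & Hedge).
  assert (Hn1 : (1 <= n)%nat) by lia.
  assert (PC : in_C p) by (eapply (polygon_in_C g T K n p x e); eauto).
  assert (Pinj : injective_S1 p) by (eapply (polygon_injective g T K n p x e) with (lam := lam); eauto).
  exists p. split; [split; [auto|split; [auto|]]|split].
  - eapply ambient_isotopic_trans; [apply Hiso|].
    eapply (polygon_isotopic g T K n p x e) with (lam := lam); eauto.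
  - assert (W1inf_norm (csub p g) <= 2 * e) by (eapply (polygon_W1inf g T K n p x e); eauto). lra.
  - assert (Hd : 0 < D * (1 - om)) by nra.
    apply Fn_le_intro; auto.
    + split; auto. eauto.
    + intros s y Hy. split; [now apply (vertices_distinct_of_injective n p s y)|].
      intros i _. destruct (polygon_rep_unique n p x Hn1 Hrep Pp s y Hy) as (j & Hj).
      rewrite !Hj. replace (Z.of_nat i - 1 + j)%Z with (Z.of_nat i + j - 1)%Z by ring.
      replace (Z.of_nat i + 1 + j)%Z with (Z.of_nat i + j + 1)%Z by ring.
      eapply ele_trans; [eapply (polygon_kappa g T n p x e) with (q := om) (D := D) (l := l) (tt := tt); eauto; lra|].
      simpl. apply Rinv_le_contravar; auto. nra.
    + intros a b Hab.
      assert (2 * (D * (1 - 2 * eta)) <= dist3 a b)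
        by (eapply (polygon_dcrit g T K n p x e) with (lam := lam); eauto; lra).
      nra.
Qed.

(** Here Q n a j means that a is good to precision j at index n. The sequence satisfies at index n
    every precision j <= n that is attainable there, and falls back on the default if none is. *)
Lemma diagonal_choice {A : Type} (Q : nat -> A -> nat -> Prop) (dflt : nat -> A) :
  (forall n a j j', (j <= j')%nat -> Q n a j' -> Q n a j) ->
  (forall j, exists N, forall n, (N <= n)%nat -> exists a, Q n a j) ->
  exists c : nat -> A, (forall n, c n = dflt n \/ exists j, Q n (c n) j) /\
    forall j, exists N, forall n, (N <= n)%nat -> Q n (c n) j.
Proof.
  intros Hm HQ.
  assert (Hbest : forall n J, exists a, (a = dflt n \/ exists j, Q n a j) /\
     forall j, (j <= J)%nat -> (exists a', Q n a' j) -> Q n a j).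
  { intros n. induction J as [|J (a & Ha & HJ)].
    - destruct (classic (exists a', Q n a' 0%nat)) as [(a & Ha)|h].
      + exists a. split; [eauto|]. intros j Hj _. now replace j with 0%nat by lia.
      + exists (dflt n). split; auto. intros j Hj (a' & Ha'). exfalso. apply h. exists a'.
        now replace 0%nat with j by lia.
    - destruct (classic (exists a', Q n a' (S J))) as [(b & Hb)|h].
      + exists b. split; [eauto|]. intros j Hj _. now apply (Hm n b j (S J)).
      + exists a. split; auto. intros j Hj Hex. destruct (Nat.eq_dec j (S J)) as [->|]; [tauto|].
        apply HJ; auto. lia. }
  destruct (choose_fun _ (fun n => Hbest n n)) as (c & Hs).
  exists c. split; [intros n; apply Hs|].
  intros j. destruct (HQ j) as (N & HN). exists (Nat.max N j). intros n Hn.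
  apply Hs; [lia|]. apply HN. lia.
Qed.

Lemma recovery_rate K0 g Fg : in_CK K0 g -> F g = Fin Fg -> forall eps, 0 < eps ->
  exists N, forall n, (N <= n)%nat -> exists p, in_CK K0 p /\ W1inf_norm (csub p g) < eps /\
    ele (Fn n p) (Fin (Fg + eps)).
Proof.
  intros HC HF eps Heps. unfold F in HF. pose proof (thickness_nonneg g) as Hnn.
  pose proof (fun D HD => proj1 (thickness_ge_iff g D HD)) as Hth.
  destruct (thickness g) as [D|]; simpl in *.
  - destruct (Req_EM_T D 0) as [|hD]; [discriminate|]. injection HF as <-.
    assert (HD : 0 < D) by lra.
    (* This loss makes 1/(D (1 - om)) equal to 1/D + eps. *)
    destruct (recovery K0 g D (1 - / (1 + D * eps)) eps) as (N & HN); auto.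
    + apply Hth; lra.
    + assert (1 < 1 + D * eps) by nra.
      assert (/ (1 + D * eps) < 1) by (rewrite <- Rinv_1 at 2; apply Rinv_lt_contravar; lra).
      pose proof (Rinv_0_lt_compat (1 + D * eps)). lra.
    + exists N. intros n Hn. destruct (HN n Hn) as (p & H1 & H2 & H3). exists p. split; [auto|split; auto].
      eapply ele_trans; [apply H3|]. simpl. right. field. split; nra.
  - injection HF as <-.
    (* For infinite thickness the target value is 0 and every D is admissible; 2/eps with loss 1/2
       gives exactly eps. *)
    destruct (recovery K0 g (2 / eps) (1 / 2) eps) as (N & HN); auto; try lra.
    + apply Rdiv_lt_0_compat; lra.
    + apply Hth; [|exact I]. left. apply Rdiv_lt_0_compat; lra.
    + exists N. intros n Hn. destruct (HN n Hn) as (p & H1 & H2 & H3). exists p. split; [auto|split; auto].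
      eapply ele_trans; [apply H3|]. simpl. right. field. lra.
Qed.

Lemma W1inf_norm_self g : in_C g -> W1inf_norm (csub g g) <= 0.
Proof.
  intros HC. destruct (in_C_lipschitz g HC) as (L & HL).
  destruct (Linf_norm_glb _ _ (csub_lipschitz g g L L HL HL)) as [H1 _].
  destruct (Linf_norm_deriv_glb g g HC HC) as [H2 _].
  assert (Linf_norm (csub g g) <= 0).
  { apply H1. split; [lra|]. eapply null_subset; [|apply null_empty]. intros t [_ Hn]. apply Hn.
    unfold csub. rewrite vsub_self, vnorm_zero. lra. }
  assert (Linf_norm_deriv (csub g g) <= 0).
  { apply H2. split; [lra|]. eapply null_subset; [|apply HC]. intros t [Ht Hn]. split; auto.
    intros (v & Hv & _). apply Hn. exists (v [-] v). split; [now apply has_deriv_sub|].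
    rewrite vsub_self, vnorm_zero. lra. }
  unfold W1inf_norm. lra.
Qed.

Lemma limsup_ineq K0 (g : curve) : in_CK K0 g ->
  exists gs : nat -> curve, (forall n, in_CK K0 (gs n)) /\ W1inf_conv gs g /\
    limsup_le (fun n => Fn n (gs n)) (F g).
Proof.
  intros HC. destruct (F g) as [Fg|] eqn:HF.
  (* An infinite limit value imposes no upper bound, so the constant sequence serves. *)
  2: { exists (fun _ => g). split; [auto|split].
       - intros eps Heps. exists 0%nat. intros n _. pose proof (W1inf_norm_self g (proj1 HC)). lra.
       - intros c Hc. destruct Hc. }
  pose (Q := fun n p (j : nat) => in_CK K0 p /\ W1inf_norm (csub p g) < / INR (S j) /\
     ele (Fn n p) (Fin (Fg + / INR (S j)))).
  assert (Hpos : forall j, 0 < / INR (S j)) by (intros j; apply Rinv_0_lt_compat, lt_0_INR; lia).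
  destruct (diagonal_choice Q (fun _ => g)) as (gs & Hgs & Hev).
  - intros n p j j' Hj (H1 & H2 & H3).
    assert (/ INR (S j') <= / INR (S j)).
    { apply Rinv_le_contravar; [apply lt_0_INR; lia | apply le_INR; lia]. }
    split; [auto|split; [lra|]]. eapply ele_trans; [apply H3|]. cbn [ele]. lra.
  - intros j. apply (recovery_rate K0 g Fg HC HF). apply Hpos.
  - exists gs. split; [|split].
    + intros n. destruct (Hgs n) as [-> |(j & H & _)]; auto.
    + intros eps Heps. destruct (inv_INR_small eps Heps) as (M & HM).
      destruct (Hev M) as (N & HN). exists N. intros n Hn.
      destruct (HN n Hn) as (_ & H & _). destruct (HM (S M) ltac:(lia)) as [_ HM']. eapply Rlt_trans; [exact H | exact HM'].
    + intros c Hc. simpl in Hc. destruct (inv_INR_small (c - Fg) ltac:(lra)) as (M & HM).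
      destruct (Hev M) as (N & HN). exists N. intros n Hn.
      destruct (HN n Hn) as (_ & _ & H). destruct (HM (S M) ltac:(lia)).
      destruct (Fn n (gs n)); cbn [ele elt] in *; [lra | tauto].
Qed.

Theorem theorem1 (K0 : V3 -> Prop) (hK0 : tame_knot K0) :
  (forall (gs : nat -> curve) (g : curve),
      (forall n, in_CK K0 (gs n)) -> in_CK K0 g -> W1inf_conv gs g ->
      le_liminf (F g) (fun n => Fn n (gs n))) /\
  (forall g : curve, in_CK K0 g ->
      exists gs : nat -> curve,
        (forall n, in_CK K0 (gs n)) /\ W1inf_conv gs g /\
        limsup_le (fun n => Fn n (gs n)) (F g)).
Proof. split; [exact (liminf_ineq K0) | exact (limsup_ineq K0)]. Qed.
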